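(* Let $m_1,m_2$ be positive integers, $n=m_1+m_2$, and let $X_1,\dots,X_n$ be i.i.d. from $P$. For the classes $\mathcal{P}_{0,d,\mathrm{cov}}$ of distributions on $\mathbb{R}^d$ defined in the context, there exists a constant $C>0$ (not depending on $d$, $P$, $m_1$, $m_2$) such that $$\sup_{d\ge1}\ \sup_{P\in\mathcal{P}_{0,d,\mathrm{cov}}}\ \sup_{-\infty<z<\infty}\bigl|P(T_{\mathrm{cov}}\le z)-\Phi(z)\bigr|\le\frac{C}{\sqrt{m_1}} .$$
   Context: $\Phi$ is the cumulative distribution function of $N(0,1)$. Class $\mathcal{P}_{0,d,\mathrm{cov}}$ (for fixed constants $c>0$ small and $C_0>0$, the same for all $d$): all continuous distributions of a random vector $X=Z=(z_1,\dots,z_d)^\top$ in $\mathbb{R}^d$ such that $\mathbb{E}[Z]=0$, $\mathrm{Var}[Z]=I$, $\mathbb{E}[z_i^4]=3+\Delta<\infty$ and $\mathbb{E}[z_i^8]<C_0$ for all $i=1,\dots,d$ (where $\Delta$ is the difference between the fourth moment of $z_i$ and that of $N(0,1)$), $\Delta+2>c$, and $$\mathbb{E}[z_{\ell_1}^{\alpha_1}z_{\ell_2}^{\alpha_2}\cdots z_{\ell_q}^{\alpha_q}]=\mathbb{E}[z_{\ell_1}^{\alpha_1}]\,\mathbb{E}[z_{\ell_2}^{\alpha_2}]\cdots\mathbb{E}[z_{\ell_q}^{\alpha_q}]$$ for every positive integer $q$, distinct indices $\ell_1,\dots,\ell_q$ and positive integer exponents with $\sum_{\ell=1}^q\alpha_\ell\le8$.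 Test statistic: let $$f_{\mathrm{cov}}(x)=\frac1{m_2}\sum_{j=m_1+1}^{n}\mathrm{tr}\bigl\{(xx^\top-I)(X_jX_j^\top-I)\bigr\},\qquad \overline f_{\mathrm{cov}}=\frac1{m_1}\sum_{i=1}^{m_1}f_{\mathrm{cov}}(X_i),$$ $$T_{\mathrm{cov}}=\frac{\sqrt{m_1}\,\overline f_{\mathrm{cov}}}{\sqrt{m_1^{-1}\sum_{i=1}^{m_1}\{f_{\mathrm{cov}}(X_i)-\overline f_{\mathrm{cov}}\}^2}} .$$ *)

(* Defs.v *)
From mathcomp Require Import all_boot all_order all_algebra.
From mathcomp Require Import all_classical all_reals all_analysis.

Set Implicit Arguments.
Unset Strict Implicit.
Unset Printing Implicit Defensive.

Import Order.TTheory GRing.Theory Num.Theory.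

Local Open Scope classical_set_scope.
Local Open Scope ring_scope.

(* Points of R^d are d-tuples, with the product sigma-algebra. *)
Definition coord (R : realType) (d : nat) (i : 'I_d) : d.-tuple R -> R :=
  fun x => tnth x i.

Definition colvec (R : realType) (d : nat) (x : d.-tuple R) : 'cV[R]_d :=
  \col_i tnth x i.

(* A distribution is continuous when it has no atoms; in particular every
   distribution with a density is continuous in this sense. *)
Definition continuous_distribution (R : realType) (d : nat)
    (P : probability (d.-tuple R) R) : Prop :=
  forall x : d.-tuple R, P [set x] = 0%E.

(* E[z_l1^a1 ... z_lq^aq] = E[z_l1^a1] ... E[z_lq^aq] for distinct indices and
   positive exponents of total degree at most 8. *)
Definition mixed_moments_factor (R : realType) (d : nat)
    (P : probability (d.-tuple R) R) : Prop :=
  forall (q : nat) (l : 'I_q -> 'I_d) (a : 'I_q -> nat),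
    (0 < q)%N -> injective l -> (forall k, (0 < a k)%N) ->
    (\sum_(k < q) a k <= 8)%N ->
    ('E_P[fun x => (\prod_(k < q) coord (l k) x ^+ a k)%R]
     = \prod_(k < q) 'E_P[fun x => (coord (l k) x ^+ a k)%R])%E.

(* The existential [Delta] depends on P but is common to all the coordinates. *)
Definition class_cov (R : realType) (c C0 : R) (d : nat)
    (P : probability (d.-tuple R) R) : Prop :=
  continuous_distribution P /\
  (forall i : 'I_d, 'E_P[coord i] = 0)%E /\
  (forall i j : 'I_d, covariance P (coord i) (coord j) = ((i == j)%:R)%:E) /\
  (exists Delta : R,
    (forall i : 'I_d, 'E_P[fun x => (coord i x ^+ 4)%R] = (3 + Delta)%:E)%E /\
    c < Delta + 2) /\
  (forall i : 'I_d, 'E_P[fun x => (coord i x ^+ 8)%R] < C0%:E)%E /\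
  mixed_moments_factor P.

Definition iid_from (R : realType) (disp disp' : measure_display)
    (Omega : measurableType disp) (T : measurableType disp')
    (Pr : probability Omega R) (P : probability T R) (n : nat)
    (X : 'I_n -> {RV Pr >-> T}) : Prop :=
  (forall (i : 'I_n) (A : set T), measurable A -> distribution Pr (X i) A = P A)
  /\
  (forall A : 'I_n -> set T, (forall i, measurable (A i)) ->
    Pr (\bigcap_(i in [set: 'I_n]) (X i @^-1` A i))
    = (\prod_(i < n) Pr (X i @^-1` A i))%E).

Arguments iid_from {R disp disp' Omega T} Pr P {n} X.

Definition centered_outer (R : realType) (d : nat) (x : d.-tuple R) : 'M[R]_d :=
  colvec x *m (colvec x)^T - 1%:M.

(* A sample of size m1 + m2 is split into the points [lshift m2 i], which are
   the first m1 ones, and the points [rshift m1 j], the last m2 ones. *)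
Definition f_cov (R : realType) (d m1 m2 : nat)
    (X : 'I_(m1 + m2) -> d.-tuple R) (x : d.-tuple R) : R :=
  (m2%:R)^-1 *
  \sum_(j < m2) \tr (centered_outer x *m centered_outer (X (rshift m1 j))).

Definition f_cov_mean (R : realType) (d m1 m2 : nat)
    (X : 'I_(m1 + m2) -> d.-tuple R) : R :=
  (m1%:R)^-1 * \sum_(i < m1) f_cov X (X (lshift m2 i)).

(* When the denominator vanishes (always if m1 = 1), the value is 0. *)
Definition T_cov (R : realType) (d m1 m2 : nat)
    (X : 'I_(m1 + m2) -> d.-tuple R) : R :=
  Num.sqrt m1%:R * f_cov_mean X /
  Num.sqrt ((m1%:R)^-1 *
    \sum_(i < m1) (f_cov X (X (lshift m2 i)) - f_cov_mean X) ^+ 2).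

Definition Phi (R : realType) (z : R) : \bar R :=
  normal_prob (0 : R) 1 `]-oo, z]%classic.

(* Main.v *)
From HB Require Import structures.
Require Import Defs.
From mathcomp Require Import all_boot all_order all_algebra.
From mathcomp Require Import all_classical all_reals all_analysis.
From mathcomp Require Import measurable_realfun ring lra.

Set Implicit Arguments.
Unset Strict Implicit.
Unset Printing Implicit Defensive.

Import Order.TTheory GRing.Theory Num.Theory.
Import numFieldNormedType.Exports.

Local Open Scope classical_set_scope.
Local Open Scope ring_scope.

(** Given the second sample, let [A] be its empirical second-moment matrix minus
    the identity. Then [f_cov] is the centred quadratic form
    [x |-> \tr ((x x^T - 1) A)], and [T_cov] is Student's statistic of the i.i.d.
    values of this form at the points of the first sample. Two facts are thus
    enough: a Berry-Esseen bound for Student's statistic which is uniform over the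
    laws of bounded kurtosis, and a bound for the kurtosis of the quadratic form
    which depends neither on the dimension nor on [A]. Averaging over the second
    sample ([sample_law]) then gives the theorem, because [A] vanishes with
    probability zero: given the other observations, [A = 0] determines each
    observation up to sign, and the law of the observations has no atoms
    ([prob_cov_dev0]).

    Kurtosis. Let [Q] be the quadratic form. Adding the coordinates one by one
    turns [Q] into a sum of increments [D]. Up to total degree 8, moments factor
    as if the coordinates were independent ([pol_indep]), so that the increments
    are orthogonal to the cubes of the partial sums. For the second moment this
    gives at least [min c 2] times the squared Frobenius norm of [A]
    ([quad_part_sqr_ge]); for the fourth moment an induction based on
    [mean_pow4_step] gives at most a constant times the square of this norm
    ([quad_part_pow4]).

    Student's statistic. Write it as [S / sqrt q] with [S] the standardised sum
    and [q] the empirical variance, which is close to [1]. For [z ^ 4 <= sqrt n]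
    the square root is linearised ([student_linear]); the event
    [S <= z * sqrt q] then becomes, up to an event of probability [O(1 / sqrt n)]
    and a shift of the threshold, an event [S - z / 2 * (V - mu) <= z] about a sum
    of i.i.d. variables, where [V] is a mean of squares. The classical
    Berry-Esseen bound for this sum is enough: its variance differs from [1] by
    [O(|z| / sqrt n)], its threshold from [z] by [O(|z| / sqrt n)], and the decay
    of the normal density absorbs the powers of [z] ([ncdf_perturb]). The squares
    are clipped at the sample size to have the third moment that the classical
    bound asks for ([student_berry_esseen_moderate]). Larger [z] are handled by
    monotonicity ([student_berry_esseen]).

    The classical bound ([berry_esseen_iid]) is proved by Stein's method. The
    solution of Stein's equation has a bounded derivative with a jump at [z]; in
    the expansion with respect to a single summand the jump matters only if the
    rest of the sum is close to [z], and the probability of this is controlled by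
    a concentration inequality ([concentration]). *)

(* The name also belongs to the coordinates of vectors in a basis. *)
Local Notation coord := Defs.coord.

(** * Means and probabilities of real functions *)

Lemma measurable_le_set (R : realType) d (T : measurableType d) (f g : T -> R) :
  measurable_fun setT f -> measurable_fun setT g -> measurable [set x | f x <= g x].
Proof.
by move=> mf mg; rewrite -[X in measurable X]setTI; apply: (measurable_fun_ler mf mg).
Qed.

Section mean.
Context {R : realType} d {T : measurableType d}.
Implicit Types (P : probability T R) (f g h : T -> R) (k M : R).

(** Means are taken in [R] rather than in the extended reals, so that they can
    be handled by real arithmetic; integrability is then carried separately. *)
Definition L1fun P f := P.-integrable setT (EFin \o f).
Definition mean P f : R := \int[P]_x f x.
Definition prob P (A : set T) : R := fine (P A).

Variable P : probability T R.

Lemma L1_measurable f : L1fun P f -> measurable_fun setT f.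
Proof. by move=> /measurable_int/measurable_EFinP. Qed.

Lemma le_L1 f g : measurable_fun setT f -> L1fun P g -> (forall x, `|f x| <= g x) ->
  L1fun P f.
Proof.
move=> mf ig fg; apply: (le_integrable _ _ _ ig) => //; first exact/measurable_EFinP.
by move=> x _ /=; rewrite lee_fin (le_trans (fg x))// ler_norm.
Qed.

Lemma L1_cst k : L1fun P (fun=> k).
Proof. exact: finite_measure_integrable_cst. Qed.

Lemma L1_bounded f M : measurable_fun setT f -> (forall x, `|f x| <= M) -> L1fun P f.
Proof. by move=> mf fM; apply: le_L1 (L1_cst M) fM. Qed.

Lemma L1D f g : L1fun P f -> L1fun P g -> L1fun P (fun x => f x + g x).
Proof. by move=> fi gi; exact: (@integrableD _ _ _ P setT measurableT (EFin \o f) (EFin \o g) fi gi). Qed.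

Lemma L1Z k f : L1fun P f -> L1fun P (fun x => k * f x).
Proof. by move=> fi; exact: (@integrableZl _ _ _ P setT measurableT k (EFin \o f) fi). Qed.

Lemma L1N f : L1fun P f -> L1fun P (fun x => - f x).
Proof. by move=> fi; exact: (@integrableN _ _ _ P setT (EFin \o f) fi). Qed.

Lemma L1B f g : L1fun P f -> L1fun P g -> L1fun P (fun x => f x - g x).
Proof. by move=> fi gi; apply: L1D => //; exact: L1N. Qed.

Lemma L1_sum I (s : seq I) (Q : pred I) (F : I -> T -> R) :
  (forall i, Q i -> L1fun P (F i)) -> L1fun P (fun x => \sum_(i <- s | Q i) F i x).
Proof.
move=> Fi; elim: s => [|a s IH].
  by under [X in L1fun _ X]eq_fun do rewrite big_nil; exact: L1_cst.
under [X in L1fun _ X]eq_fun do rewrite big_cons.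
by case: (boolP (Q a)) => Qa //; apply: L1D => //; exact: Fi.
Qed.

Lemma L1_norm f : L1fun P f -> L1fun P (fun x => `|f x|).
Proof. exact: integrable_norm. Qed.

Lemma L1M_bounded f h M : L1fun P f -> measurable_fun setT h ->
  (forall x, `|h x| <= M) -> L1fun P (fun x => f x * h x).
Proof.
move=> fi mh hM; apply: (@le_L1 _ (fun x => M * `|f x|)).
- by apply: measurable_funM => //; exact: L1_measurable.
- by apply: L1Z; exact: L1_norm.
- by move=> x; rewrite normrM mulrC ler_wpM2r.
Qed.

Lemma mean_EFin f : L1fun P f -> (\int[P]_x (f x)%:E)%E = (mean P f)%:E.
Proof. by move=> fi; rewrite /mean /Rintegral fineK// integrable_fin_num. Qed.

Lemma eq_mean f g : f =1 g -> mean P f = mean P g.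
Proof. by move=> fg; congr mean; apply/funext. Qed.

Lemma meanD f g : L1fun P f -> L1fun P g ->
  mean P (fun x => f x + g x) = mean P f + mean P g.
Proof. exact: RintegralD. Qed.

Lemma meanB f g : L1fun P f -> L1fun P g ->
  mean P (fun x => f x - g x) = mean P f - mean P g.
Proof. exact: RintegralB. Qed.

Lemma meanZ k f : L1fun P f -> mean P (fun x => k * f x) = k * mean P f.
Proof. exact: RintegralZl. Qed.

Lemma mean_cst k : mean P (fun=> k) = k.
Proof.
rewrite /mean Rintegral_cst//.
have -> : fine (P [set: T]) = 1 by rewrite probability_setT.
exact: mulr1.
Qed.

Lemma mean_sum I (s : seq I) (Q : pred I) (F : I -> T -> R) :
  (forall i, Q i -> L1fun P (F i)) ->
  mean P (fun x => \sum_(i <- s | Q i) F i x) = \sum_(i <- s | Q i) mean P (F i).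
Proof.
move=> Fi; elim: s => [|a s IH].
  by rewrite big_nil; under eq_mean do rewrite big_nil; exact: mean_cst.
rewrite big_cons; under eq_mean do rewrite big_cons.
case: (boolP (Q a)) => Qa //; rewrite meanD ?IH//; [exact: Fi|exact: L1_sum].
Qed.

Lemma le_mean f g : L1fun P f -> L1fun P g -> (forall x, f x <= g x) ->
  mean P f <= mean P g.
Proof. by move=> fi gi fg; apply: le_Rintegral. Qed.

Lemma mean_ge0 f : (forall x, 0 <= f x) -> 0 <= mean P f.
Proof. by move=> f0; apply: Rintegral_ge0. Qed.

Lemma ler_norm_mean f : L1fun P f -> `|mean P f| <= mean P (fun x => `|f x|).
Proof. exact: le_normr_Rintegral. Qed.

Lemma L1_indic A : measurable A -> L1fun P (\1_A).
Proof.
move=> mA; apply: (@L1_bounded _ 1); first exact: measurable_indic.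
by move=> x; rewrite indicE; case: (_ \in _); rewrite ?normr1 ?normr0.
Qed.

Lemma prob_mean A : measurable A -> prob P A = mean P (\1_A).
Proof. by move=> mA; rewrite /prob /mean /Rintegral integral_indic// setIT. Qed.

Lemma prob_EFin A : measurable A -> (prob P A)%:E = P A.
Proof. by move=> mA; rewrite fineK// fin_num_measure. Qed.

Lemma prob_ge0 A : 0 <= prob P A.
Proof. exact: fine_ge0. Qed.

Lemma prob_le1 A : measurable A -> prob P A <= 1.
Proof. by move=> mA; rewrite -lee_fin prob_EFin// probability_le1. Qed.

Lemma le_prob A B : measurable A -> measurable B -> A `<=` B -> prob P A <= prob P B.
Proof.
by move=> mA mB AB; rewrite -lee_fin !prob_EFin// le_measure ?inE.
Qed.

Lemma prob_setU A B : measurable A -> measurable B ->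
  prob P (A `|` B) <= prob P A + prob P B.
Proof.
move=> mA mB; have mAB := measurableU _ _ mA mB.
by rewrite -lee_fin EFinD !prob_EFin// measureU2.
Qed.

Lemma markov_mean f t : 0 < t -> L1fun P f -> (forall x, 0 <= f x) ->
  prob P [set x | t <= f x] <= mean P f / t.
Proof.
move=> t0 fi f0; have mf := L1_measurable fi.
have mA : measurable [set x | t <= f x].
  exact: measurable_le_set.
rewrite prob_mean// ler_pdivlMr// mulrC -meanZ ?L1_indic//.
apply: le_mean => // [|x]; first by apply: L1Z; exact: L1_indic.
rewrite indicE; case: (boolP (x \in _)) => [|_]; last by rewrite mulr0.
by rewrite inE/= mulr1.
Qed.

End mean.

Section mean_product.
Context {R : realType} d1 d2 {T1 : measurableType d1} {T2 : measurableType d2}.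
Variables (P : probability T1 R) (Q : probability T2 R).

Lemma L1_prod (a : T1 -> R) (b : T2 -> R) : L1fun P a -> L1fun Q b ->
  L1fun (P \x Q)%E (fun z => a z.1 * b z.2).
Proof.
move=> ai bi.
have mab : measurable_fun setT (fun z : T1 * T2 => a z.1 * b z.2).
  by apply: measurable_funM; [exact: (measurableT_comp (L1_measurable ai))|exact: (measurableT_comp (L1_measurable bi))].
apply/integrable12ltyP; first exact/measurable_EFinP.
rewrite (_ : (fun _ => _) = (fun x => (mean Q (fun y => `|b y|) * `|a x|)%:E)).
  have /integrableP[_] := L1Z (mean Q (fun y => `|b y|)) (L1_norm ai).
  have mf := L1_measurable (L1Z (mean Q (fun y => `|b y|)) (L1_norm ai)).
  apply: le_lt_trans; apply: ge0_le_integral => //=.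
  - by move=> x _; rewrite lee_fin mulr_ge0// mean_ge0.
  - exact/measurable_EFinP.
  - apply/measurable_EFinP; exact: (measurableT_comp (@normr_measurable _ setT) mf).
  - by move=> x _; rewrite lee_fin ler_norm.
apply/funext => x; rewrite mulrC -meanZ; last exact: L1_norm.
rewrite -mean_EFin; last by apply: L1Z; exact: L1_norm.
by apply: eq_integral => y _ /=; rewrite normrM.
Qed.

Lemma L1_fst (a : T1 -> R) : L1fun P a -> L1fun (P \x Q)%E (fun z => a z.1).
Proof.
move=> ai; have := L1_prod ai (L1_cst Q 1).
by under [X in L1fun _ X]eq_fun do rewrite mulr1.
Qed.

Lemma L1_snd (b : T2 -> R) : L1fun Q b -> L1fun (P \x Q)%E (fun z => b z.2).
Proof.
move=> bi; have := L1_prod (L1_cst P 1) bi.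
by under [X in L1fun _ X]eq_fun do rewrite mul1r.
Qed.

Lemma mean_prod1 (F : T1 * T2 -> R) : L1fun (P \x Q)%E F ->
  (forall x, L1fun Q (fun y => F (x, y))) ->
  mean (P \x Q)%E F = mean P (fun x => mean Q (fun y => F (x, y))).
Proof.
move=> Fi Fxi; rewrite {1 2}/mean /Rintegral -(integral12_prod_meas1 Fi); congr fine.
by apply: eq_integral => x _; rewrite /fubini_F mean_EFin.
Qed.

Lemma mean_prod2 (F : T1 * T2 -> R) : L1fun (P \x Q)%E F ->
  (forall y, L1fun P (fun x => F (x, y))) ->
  mean (P \x Q)%E F = mean Q (fun y => mean P (fun x => F (x, y))).
Proof.
move=> Fi Fxi; rewrite {1 2}/mean /Rintegral -(integral21_prod_meas1 Fi); congr fine.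
by apply: eq_integral => x _; rewrite /fubini_G mean_EFin.
Qed.

Lemma L1_mean1 (F : T1 * T2 -> R) : L1fun (P \x Q)%E F ->
  (forall x, L1fun Q (fun y => F (x, y))) ->
  L1fun P (fun x => mean Q (fun y => F (x, y))).
Proof.
move=> Fi Fxi; have := integrable_fubini_F Fi; apply: eq_integrable => // x _.
by rewrite /fubini_F mean_EFin.
Qed.

Lemma mean_prodM (a : T1 -> R) (b : T2 -> R) : L1fun P a -> L1fun Q b ->
  mean (P \x Q)%E (fun z => a z.1 * b z.2) = mean P a * mean Q b.
Proof.
move=> ai bi; rewrite mean_prod1; [|exact: L1_prod|by move=> x /=; exact: L1Z].
rewrite mulrC -meanZ//; apply: eq_mean => x /=.
by rewrite meanZ// mulrC.
Qed.

End mean_product.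

(** * The law of an i.i.d. sample *)

Section tcons.
Context {d} {T : measurableType d} {n : nat}.

Definition tcons (z : T * n.-tuple T) : n.+1.-tuple T := [tuple of z.1 :: z.2].

Lemma measurable_tcons : measurable_fun setT tcons.
Proof. by apply: measurable_cons. Qed.

HB.instance Definition _ := isMeasurableFun.Build _ _ _ _ tcons measurable_tcons.

End tcons.

Section iid_tuple.
Context {R : realType} d {T : measurableType d} (P : probability T R).

(** Adding one coordinate at a time makes every statement on the sample
    provable by induction on its size, through Fubini's theorem for a single
    extra coordinate. *)
Fixpoint iid_law n : probability (n.-tuple T) R :=
  match n with
  | 0 => dirac [tuple]
  | n'.+1 => distribution (P \x iid_law n')%E (@tcons d T n')
  end.

Lemma L1_iid_lawS n (F : n.+1.-tuple T -> R) : measurable_fun setT F ->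
  L1fun (iid_law n.+1) F <-> L1fun (P \x iid_law n)%E (F \o tcons).
Proof.
move=> mF; have mF' : measurable_fun setT (F \o tcons).
  exact: (measurableT_comp mF measurable_tcons).
have e : (\int[iid_law n.+1]_x `|(F x)%:E| = \int[P \x iid_law n]_z `|(F (tcons z))%:E|)%E.
  apply: (@ge0_integral_distribution _ _ _ _ R (P \x iid_law n)%E (@tcons d T n)
    (fun t => `|(F t)%:E|%E)) => //.
  by apply: measurableT_comp => //; exact/measurable_EFinP.
split => /integrableP[_ h]; apply/integrableP; split; try exact/measurable_EFinP.
  by rewrite -e.
by rewrite e.
Qed.

Lemma mean_iid_lawS n (F : n.+1.-tuple T -> R) : L1fun (iid_law n.+1) F ->
  mean (iid_law n.+1) F = mean (P \x iid_law n)%E (F \o tcons).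
Proof.
move=> Fi; have mF := L1_measurable Fi; have Fi' := (L1_iid_lawS mF).1 Fi.
rewrite /mean /Rintegral; congr fine.
apply: (@integral_distribution _ _ _ _ R (P \x iid_law n)%E (@tcons d T n) (EFin \o F)) => //.
exact/measurable_EFinP.
Qed.

Variable g : T -> R.

Definition tsum n (t : n.-tuple T) : R := \sum_(i < n) g (tnth t i).

Lemma tsum0 (t : 0.-tuple T) : tsum t = 0.
Proof. by rewrite /tsum big_ord0. Qed.

Lemma tsum_tcons n (z : T * n.-tuple T) : tsum (tcons z) = g z.1 + tsum z.2.
Proof.
rewrite /tsum big_ord_recl; congr (_ + _).
by apply: eq_bigr => i _; rewrite tnthS.
Qed.

Lemma measurable_tsum n : measurable_fun setT g -> measurable_fun setT (@tsum n).
Proof.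
move=> mg; apply: measurable_sum => i.
exact: (measurableT_comp mg (measurable_tnth i)).
Qed.

Lemma L1_tsum n : L1fun P g -> L1fun (iid_law n) (@tsum n).
Proof.
move=> gi; elim: n => [|n IH].
  by rewrite (_ : @tsum 0 = fun=> 0); [exact: (L1_cst (iid_law 0))|apply/funext => t; rewrite tsum0].
apply/L1_iid_lawS; first by apply: measurable_tsum; exact: L1_measurable gi.
rewrite (_ : _ \o _ = fun z => g z.1 + tsum z.2); last first.
  by apply/funext => z /=; rewrite tsum_tcons.
by apply: L1D; [exact: L1_fst|exact: L1_snd].
Qed.

Lemma mean_tsum n : L1fun P g -> mean (iid_law n) (@tsum n) = n%:R * mean P g.
Proof.
move=> gi; elim: n => [|n IH].
  by rewrite mul0r (eq_mean _ (g := fun=> 0)) ?mean_cst// => t; rewrite tsum0.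
rewrite mean_iid_lawS; last exact: L1_tsum.
rewrite (eq_mean _ (g := fun z => g z.1 * 1 + 1 * tsum z.2)); last first.
  by move=> z /=; rewrite tsum_tcons mulr1 mul1r.
have ti := L1_tsum n gi.
rewrite meanD; [|exact: (L1_prod gi (L1_cst _ 1))|exact: (L1_prod (L1_cst _ 1) ti)].
rewrite (mean_prodM gi (L1_cst _ 1)) (mean_prodM (L1_cst _ 1) ti) !mean_cst IH.
by rewrite -[in RHS]addn1 natrD; ring.
Qed.

Lemma L1_tsum_sqr n : L1fun P g -> L1fun P (fun x => g x ^+ 2) ->
  L1fun (iid_law n) (fun t => @tsum n t ^+ 2).
Proof.
move=> gi g2i; elim: n => [|n IH].
  by rewrite (_ : (fun _ => _) = fun=> 0); [exact: (L1_cst (iid_law 0))|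
    apply/funext => t; rewrite tsum0 expr0n].
apply/L1_iid_lawS.
  by apply: measurable_funX; apply: measurable_tsum; exact: L1_measurable gi.
rewrite (_ : _ \o _ = fun z => g z.1 ^+ 2 + 2 * (g z.1 * tsum z.2) + tsum z.2 ^+ 2); last first.
  by apply/funext => z /=; rewrite tsum_tcons; ring.
apply: L1D; first apply: L1D.
- exact: (L1_fst _ g2i).
- by apply: L1Z; apply: L1_prod => //; exact: L1_tsum.
- exact: (L1_snd _ IH).
Qed.

Lemma mean_tsum_sqr n : L1fun P g -> L1fun P (fun x => g x ^+ 2) -> mean P g = 0 ->
  mean (iid_law n) (fun t => @tsum n t ^+ 2) = n%:R * mean P (fun x => g x ^+ 2).
Proof.
move=> gi g2i g0; elim: n => [|n IH].
  rewrite mul0r (eq_mean _ (g := fun=> 0)) ?mean_cst// => t.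
  by rewrite tsum0 expr0n.
rewrite mean_iid_lawS; last exact: L1_tsum_sqr.
rewrite (eq_mean _ (g := fun z => g z.1 ^+ 2 * 1 + 2 * (g z.1 * tsum z.2) + 1 * tsum z.2 ^+ 2)); last first.
  by move=> z /=; rewrite tsum_tcons; ring.
have ti := L1_tsum n gi; have t2i := L1_tsum_sqr n gi g2i.
have i1 := L1_prod g2i (L1_cst (iid_law n) 1).
have i2 := L1_prod gi ti.
have i3 := L1_prod (L1_cst P 1) t2i.
rewrite meanD//; last by apply: L1D => //; exact: L1Z.
rewrite meanD//; last exact: L1Z.
rewrite meanZ// (mean_prodM gi ti) g0 mul0r mulr0 addr0.
rewrite (mean_prodM g2i (L1_cst _ 1)) (mean_prodM (L1_cst _ 1) t2i) !mean_cst IH.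
by rewrite -[in RHS]addn1 natrD; ring.
Qed.

(** In an expectation of [S * f S], where [S] is a sum of i.i.d. terms, each
    summand can be singled out and replaced by the one that is independent of
    the rest of the sum. Exchangeability is obtained by induction: splitting off
    the first coordinate [x] leaves the same identity for the shifted function
    [f (g x + _)], after which the two coordinates [x] and [y] are exchanged by
    Fubini's theorem. *)
Lemma mean_tsum_mul n (f : R -> R) M : L1fun P g ->
  measurable_fun setT f -> (forall x, `|f x| <= M) ->
  mean (iid_law n.+1) (fun t => tsum t * f (tsum t)) =
  n.+1%:R * mean P (fun x => g x * mean (iid_law n) (fun t => f (g x + tsum t))).
Proof.
move=> gi; have mg := L1_measurable gi.
have msum (k : nat) : measurable_fun setT (@tsum k) by exact: measurable_tsum.
have mgs (k : nat) : measurable_fun setT (fun z : T * k.-tuple T => g z.1 + tsum z.2).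
  by apply: measurable_funD;
    [exact: (measurableT_comp mg)|exact: (measurableT_comp (msum k))].
have mfc (h : R -> R) (k : nat) (c : R) : measurable_fun setT h ->
    measurable_fun setT (fun t : k.-tuple T => h (c + tsum t)).
  by move=> mh; apply: (measurableT_comp mh); apply: measurable_funD => //; exact: msum.
have Lfc (h : R -> R) (k : nat) (c : R) : measurable_fun setT h ->
    (forall x, `|h x| <= M) -> L1fun (iid_law k) (fun t => h (c + tsum t)).
  by move=> mh hM; apply: (@L1_bounded _ _ _ _ _ M) => //; exact: mfc.
have LSf (h : R -> R) (k : nat) : measurable_fun setT h -> (forall x, `|h x| <= M) ->
    L1fun (iid_law k) (fun t => tsum t * h (tsum t)).
  move=> mh hM; apply: (@L1M_bounded _ _ _ _ _ _ M) => //; first exact: L1_tsum.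
  exact: (measurableT_comp mh (msum k)).
elim: n f => [|n IH] f mf fM; (rewrite mean_iid_lawS; last exact: LSf).
  rewrite mul1r (eq_mean _ (g := fun z => g z.1 * f (g z.1 + tsum z.2))); last first.
    by move=> z /=; rewrite tsum_tcons tsum0 addr0.
  rewrite mean_prod1.
  + by apply: eq_mean => x /=; rewrite meanZ//; exact: Lfc.
  + apply: (@L1M_bounded _ _ _ _ _ _ M) => //; first exact: L1_fst.
    exact: (measurableT_comp mf (mgs 0)).
  + by move=> x /=; apply: L1Z; exact: Lfc.
pose F1 (z : T * n.+1.-tuple T) := g z.1 * f (g z.1 + tsum z.2).
pose F2 (z : T * n.+1.-tuple T) := tsum z.2 * f (g z.1 + tsum z.2).
have iF1 : L1fun (P \x iid_law n.+1)%E F1.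
  apply: (@L1M_bounded _ _ _ _ _ _ M) => //; first exact: L1_fst.
  exact: (measurableT_comp mf (mgs n.+1)).
have iF2 : L1fun (P \x iid_law n.+1)%E F2.
  apply: (@L1M_bounded _ _ _ _ _ _ M) => //; first by apply: L1_snd; exact: L1_tsum.
  exact: (measurableT_comp mf (mgs n.+1)).
rewrite (eq_mean _ (g := fun z => F1 z + F2 z)); last first.
  by move=> z /=; rewrite tsum_tcons /F1 /F2 mulrDl.
rewrite meanD// mean_prod1//; last by move=> x; rewrite /F1/=; apply: L1Z; exact: Lfc.
rewrite (mean_prod1 iF2); last first.
  by move=> x; rewrite /F2/=; apply: (@L1M_bounded _ _ _ _ _ _ M) => //; [exact: L1_tsum|exact: mfc].
have -> : mean P (fun x => mean (iid_law n.+1) (fun y => F1 (x, y))) =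
    mean P (fun x => g x * mean (iid_law n.+1) (fun t => f (g x + tsum t))).
  by apply: eq_mean => x; rewrite /F1/= meanZ//; exact: Lfc.
rewrite -[in RHS]addn1 natrD mulrDl mul1r addrC; congr (_ + _).
(* the pair [z] consists of the first coordinate and of the one that the
   induction hypothesis singles out *)
pose H (z : T * T) := mean (iid_law n) (fun t => f (g z.1 + (g z.2 + tsum t))).
have iHt : L1fun ((P \x P) \x iid_law n)%E (fun w => f (g w.1.1 + (g w.1.2 + tsum w.2))).
  apply: (@L1_bounded _ _ _ _ _ M) => //; apply: (measurableT_comp mf).
  apply: measurable_funD; first exact: (measurableT_comp mg (measurableT_comp measurable_fst measurable_fst)).
  apply: measurable_funD; first exact: (measurableT_comp mg (measurableT_comp measurable_snd measurable_fst)).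
  exact: (measurableT_comp (msum n)).
have LH c c' : L1fun (iid_law n) (fun t => f (c + (c' + tsum t))).
  by under [X in L1fun _ X]eq_fun do rewrite addrA; exact: Lfc.
have iH : L1fun (P \x P)%E H by apply: (L1_mean1 iHt) => z /=; exact: LH.
have HM z : `|H z| <= M.
  apply: (le_trans (ler_norm_mean (LH _ _))).
  rewrite -[leRHS](mean_cst (iid_law n)); apply: le_mean => //.
  - by apply: L1_norm; exact: LH.
  - exact: L1_cst.
have igH : L1fun (P \x P)%E (fun z => g z.2 * H z).
  by apply: (@L1M_bounded _ _ _ _ _ _ M) => //; [exact: L1_snd|exact: L1_measurable iH].
have mH1 x : measurable_fun setT (fun y => H (x, y)).
  exact: (measurableT_comp (L1_measurable iH) (measurable_pair1 x)).
have mH2 y : measurable_fun setT (fun x => H (x, y)).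
  exact: (measurableT_comp (L1_measurable iH) (measurable_pair2 y)).
transitivity (mean P (fun x => n.+1%:R * mean P (fun y => g y * H (x, y)))).
  apply: eq_mean => x.
  rewrite (IH (fun c => f (g x + c))) => [//||c]; last exact: fM.
  by apply: (measurableT_comp mf); exact: measurable_funD.
have igH1 x : L1fun P (fun y => g y * H (x, y)).
  by apply: (@L1M_bounded _ _ _ _ _ _ M).
have igH2 y : L1fun P (fun x => g y * H (x, y)).
  by apply: L1Z; apply: (@L1_bounded _ _ _ _ _ M).
rewrite meanZ; last exact: (L1_mean1 igH igH1).
rewrite -(mean_prod1 igH igH1) (mean_prod2 igH igH2); congr (_ * _).
apply: eq_mean => y; rewrite /= meanZ; last by apply: (@L1_bounded _ _ _ _ _ M).
congr (_ * _); rewrite mean_iid_lawS; last exact: Lfc.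
rewrite mean_prod1.
- by apply: eq_mean => x; apply: eq_mean => t /=; rewrite tsum_tcons /=; congr f; ring.
- apply/L1_iid_lawS; [exact: mfc|exact: Lfc].
- move=> x; rewrite [X in L1fun _ X](_ : _ = fun t : n.-tuple T => f (g y + (g x + tsum t))); first exact: LH.
  by apply/funext => t /=; rewrite tsum_tcons.
Qed.

End iid_tuple.

(** * The normal distribution function and Stein's equation *)

Section normal_cdf.
Context {R : realType}.
Implicit Types (z w x t : R).
Notation npdf := (@normal_pdf R 0 1).

Definition ncdf z : R := fine (Phi z).

Lemma npdfE x : npdf x = normal_peak 1 * expR (- x ^+ 2 / 2).
Proof. by rewrite normal_pdfE ?oner_neq0// /normal_fun subr0 expr1n. Qed.

Lemma npeak_gt0 : 0 < normal_peak 1 :> R.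
Proof. by rewrite normal_peak_gt0 ?oner_neq0. Qed.

Lemma npdf_gt0 x : 0 < npdf x.
Proof. by rewrite npdfE mulr_gt0 ?npeak_gt0 ?expR_gt0. Qed.

Lemma is_derive_npdf x : is_derive x 1 npdf (- x * npdf x).
Proof.
have -> : npdf = fun x => normal_peak 1 * expR (- x ^+ 2 / 2).
  by apply/funext => y; exact: npdfE.
apply: is_derive_eq.
by rewrite /GRing.scale /=; field.
Qed.

Lemma is_derive_ncdf x : is_derive x 1 ncdf (npdf x).
Proof.
have hint (A : set R) : measurable A -> lebesgue_measure.-integrable A (EFin \o npdf).
  by move=> mA; apply: (@integrableS _ _ _ lebesgue_measure setT A); [exact: measurableT|
    exact: mA|exact: subsetT|exact: integrable_normal_pdf].
have [] := @continuous_FTC1 R npdf -oo%O x (x + 1) _ _ _ _.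
- by rewrite ltrDl.
- exact: hint.
- exact: ltNyr.
- by apply: continuous_normal_pdf; rewrite oner_neq0.
move=> d e; have -> : ncdf = (fun y => \int[lebesgue_measure]_(t in `]-oo, y]) npdf t).
  by apply/funext.
by apply: DeriveDef; [exact: d|rewrite -e derive1E].
Qed.

Lemma ncdf_fin z : (Phi z) \is a fin_num.
Proof. by rewrite /Phi; apply: fin_num_measure. Qed.

Lemma ncdf_ge0 z : 0 <= ncdf z.
Proof. by rewrite /ncdf fine_ge0// /Phi. Qed.

Lemma ncdf_le1 z : ncdf z <= 1.
Proof.
rewrite /ncdf -lee_fin fineK ?ncdf_fin// /Phi. exact: probability_le1.
Qed.

Lemma ncdf_le w z : w <= z -> ncdf w <= ncdf z.
Proof.
move=> wz; rewrite /ncdf fine_le ?ncdf_fin// /Phi le_measure ?inE//.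
exact: subitvPr.
Qed.

Let idR : measurableTypeR R -> R := idfun.
#[local] HB.instance Definition _ :=
  @isMeasurableFun.Build _ _ _ _ idR (@measurable_id _ _ setT).

Lemma ncdf_cvgy : ncdf x @[x --> +oo] --> (1 : R).
Proof.
have := @cvg_cdfy1 _ _ R (normal_prob 0 1) (idR : {RV (normal_prob 0 1) >-> R}).
by move/fine_cvg.
Qed.

Lemma ncdf_cvgNy : ncdf x @[x --> -oo] --> (0 : R).
Proof.
have := @cvg_cdfNy0 _ _ R (normal_prob 0 1) (idR : {RV (normal_prob 0 1) >-> R}).
by move/fine_cvg.
Qed.

Lemma mvt_ge (f df : R -> R) (a b : R) : (forall x, is_derive x 1 f (df x)) ->
  a <= b -> exists2 c, a <= c <= b & f b - f a = df c * (b - a).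
Proof.
move=> dfx ab.
have cf : {within `[a, b], continuous f}.
  by apply: derivable_within_continuous => x _; exact: ex_derive.
have [c] := @MVT_segment R f df a b ab (fun x _ => dfx x) cf.
by rewrite in_itv/= => cab e; exists c.
Qed.

(** The map [B |-> - npdf B - w * ncdf B] increases on [w, +oo[, since its
    derivative is [(B - w) * npdf B]; compare its values at [w] and at
    infinity. *)
Lemma mills_pos w : 0 <= w -> w * (1 - ncdf w) <= npdf w.
Proof.
move=> w0.
have lim : w * (ncdf B - ncdf w) @[B --> +oo] --> w * (1 - ncdf w).
  by apply: cvgM; [exact: cvg_cst|apply: cvgB; [exact: ncdf_cvgy|exact: cvg_cst]].
apply: (cvgr_to_le lim).
near=> B; have wB : w <= B by near: B; apply: nbhs_pinfty_ge; exact: num_real.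
have dk (x : R) : is_derive x 1 (fun x => npdf x + w * ncdf x) ((w - x) * npdf x).
  have ? := is_derive_npdf x; have ? := is_derive_ncdf x.
  by apply: is_derive_eq; rewrite /GRing.scale/=; ring.
have [c /andP[wc cB] e] := mvt_ge dk wB.
have : (w - c) * npdf c * (B - w) <= 0.
  by rewrite mulr_le0_ge0 ?subr_ge0// mulr_le0_ge0 ?subr_le0// ltW ?npdf_gt0.
have := npdf_gt0 B; rewrite -e; lra.
Unshelve. all: by end_near. Qed.

Lemma mills_neg w : w <= 0 -> - w * ncdf w <= npdf w.
Proof.
move=> w0.
have lim : - w * (ncdf w - ncdf B) @[B --> -oo] --> - w * (ncdf w - 0).
  by apply: cvgM; [exact: cvg_cst|apply: cvgB; [exact: cvg_cst|exact: ncdf_cvgNy]].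
rewrite -[X in _ * X]subr0; apply: (cvgr_to_le lim).
near=> B; have wB : B <= w by near: B; apply: nbhs_ninfty_le; exact: num_real.
have dk (x : R) : is_derive x 1 (fun x => npdf x + w * ncdf x) ((w - x) * npdf x).
  have ? := is_derive_npdf x; have ? := is_derive_ncdf x.
  by apply: is_derive_eq; rewrite /GRing.scale/=; ring.
have [c /andP[wc cB] e] := mvt_ge dk wB.
have : 0 <= (w - c) * npdf c * (w - B).
  by rewrite mulr_ge0 ?subr_ge0// mulr_ge0 ?subr_ge0// ltW ?npdf_gt0.
have := npdf_gt0 B; rewrite -e; lra.
Unshelve. all: by end_near. Qed.

Definition invpdf w : R := (normal_peak 1)^-1 * expR (w ^+ 2 / 2).

Lemma invpdfK w : npdf w * invpdf w = 1.
Proof.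
rewrite npdfE /invpdf mulrACA mulfV ?gt_eqF ?npeak_gt0// -expRD.
by rewrite mulNr addNr expR0 mulr1.
Qed.

Lemma invpdf_gt0 w : 0 < invpdf w.
Proof.
by rewrite /invpdf; apply: mulr_gt0; [rewrite invr_gt0; exact: npeak_gt0|exact: expR_gt0].
Qed.

Lemma is_derive_invpdf w : is_derive w 1 invpdf (w * invpdf w).
Proof.
by apply: is_derive_eq; rewrite /GRing.scale/= /invpdf; field; rewrite gt_eqF// npeak_gt0.
Qed.

Definition steinL z w : R := (1 - ncdf z) * (ncdf w * invpdf w).
Definition steinR z w : R := ncdf z * ((1 - ncdf w) * invpdf w).
(** The solution [f] of Stein's equation [f' w - w * f w = (w <= z) - ncdf z].
    It is also [ncdf (min w z) * (1 - ncdf (max w z)) / npdf w]; each of the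
    two pieces is smooth on the whole line, which makes the mean value theorem
    available on either side of [z]. *)
Definition stein z w : R := if w <= z then steinL z w else steinR z w.
(** The derivative of [stein z], extended to [w = z], where [stein z] has a
    corner, by the value that Stein's equation prescribes. *)
Definition stein_d z w : R := w * stein z w + (w <= z)%R%:R - ncdf z.

Lemma is_derive_steinL z w :
  is_derive w 1 (steinL z) (w * steinL z w + (1 - ncdf z)).
Proof.
have ? := is_derive_invpdf w; have ? := is_derive_ncdf w.
apply: is_derive_eq; rewrite /GRing.scale/= /steinL.
by have := invpdfK w => e; ring: e.
Qed.

Lemma is_derive_steinR z w :
  is_derive w 1 (steinR z) (w * steinR z w - ncdf z).
Proof.
have ? := is_derive_invpdf w; have ? := is_derive_ncdf w.
apply: is_derive_eq; rewrite /GRing.scale/= /steinR.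
by have := invpdfK w => e; ring: e.
Qed.

Lemma mvt_btw (f df : R -> R) (a b : R) : (forall x, is_derive x 1 f (df x)) ->
  exists2 c, (a <= c <= b) || (b <= c <= a) & f b - f a = df c * (b - a).
Proof.
move=> dfx; have [ab|/ltW ba] := leP a b.
  by have [c cab e] := mvt_ge dfx ab; exists c => //; rewrite cab.
have [c cab e] := mvt_ge dfx ba; exists c; first by rewrite cab orbT.
by rewrite -opprB e; ring.
Qed.

(** A bound for [stein z] that does not depend on [z]. *)
Let steinG w : R := ncdf w * (1 - ncdf w) * invpdf w.

Lemma stein_ge0 z w : 0 <= stein z w.
Proof.
have := ncdf_ge0 z; have := ncdf_le1 z; have := ncdf_ge0 w; have := ncdf_le1 w.
have i0 := ltW (invpdf_gt0 w).
move=> w1 w0 z1 z0; rewrite /stein /steinL /steinR; case: ifP => _;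
  by do 2?apply: mulr_ge0; rewrite ?subr_ge0.
Qed.

Let stein_leG z w : stein z w <= steinG w.
Proof.
have z0 := ncdf_ge0 z; have z1 := ncdf_le1 z; have w0 := ncdf_ge0 w; have w1 := ncdf_le1 w.
rewrite /stein /steinL /steinR /steinG; case: (leP w z) => [|/ltW] h;
  have := ncdf_le h => e.
- rewrite mulrA [ncdf w * (1 - _)]mulrC ler_wpM2r ?(ltW (invpdf_gt0 _))//.
  by rewrite ler_wpM2r//; lra.
- rewrite mulrA ler_wpM2r ?(ltW (invpdf_gt0 _))//.
  by rewrite ler_wpM2r//; lra.
Qed.

Let normr_steinG w : `|w| * steinG w <= 1.
Proof.
have w0 := ncdf_ge0 w; have w1 := ncdf_le1 w.
rewrite -[leRHS](invpdfK w) /steinG mulrA ler_wpM2r ?(ltW (invpdf_gt0 _))//.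
have [w_ge|/ltW w_le] := leP 0 w.
  rewrite ger0_norm// mulrCA; apply: le_trans (mills_pos w_ge).
  by rewrite ler_piMl// mulr_ge0// subr_ge0.
rewrite ler0_norm// mulrA; apply: le_trans (mills_neg w_le).
by rewrite ler_piMr//; [rewrite mulr_ge0 ?oppr_ge0|lra].
Qed.

(** For [1 <= |w|] Mills' inequality bounds the solution by [1]; for [|w| <= 1]
    it is at most [1 / npdf 1]. *)
Definition stein_ub : R := 1 + invpdf 1.

Lemma stein_ub_ge1 : 1 <= stein_ub.
Proof. by rewrite lerDl ltW// invpdf_gt0. Qed.

Let steinG_ge0 w : 0 <= steinG w.
Proof.
have w0 := ncdf_ge0 w; have w1 := ncdf_le1 w.
have i0 := ltW (invpdf_gt0 w).
by rewrite /steinG; apply: mulr_ge0 => //; apply: mulr_ge0 => //; rewrite subr_ge0.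
Qed.

Lemma stein_le_ub z w : stein z w <= stein_ub.
Proof.
have w0 := ncdf_ge0 w; have w1 := ncdf_le1 w.
apply: (le_trans (stein_leG z w)); have [w_ge1|/ltW w_le1] := leP 1 `|w|.
  apply: (@le_trans _ _ 1); last exact: stein_ub_ge1.
  apply: le_trans (normr_steinG w); rewrite ler_peMl ?steinG_ge0//.
apply: (@le_trans _ _ (invpdf 1)); last by rewrite /stein_ub; lra.
apply: (@le_trans _ _ (invpdf w)).
  rewrite /steinG ler_piMl ?(ltW (invpdf_gt0 _))//.
  by rewrite mulr_ile1 ?subr_ge0//; lra.
rewrite /invpdf ler_wpM2l ?invr_ge0 ?(ltW npeak_gt0)// ler_expR ler_pM2r//.
by rewrite -[leLHS]real_normK ?num_real// expr1n expr_le1.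
Qed.

Lemma normr_stein z w : `|w * stein z w| <= 1.
Proof.
rewrite normrM (ger0_norm (stein_ge0 _ _)); apply: le_trans (normr_steinG w).
by rewrite ler_wpM2l// stein_leG.
Qed.

Lemma normr_stein_d z w : `|stein_d z w| <= 2.
Proof.
have z0 := ncdf_ge0 z; have z1 := ncdf_le1 z; have := normr_stein z w.
by rewrite /stein_d; case: (w <= z); rewrite !ler_norml /=; lra.
Qed.

Let ler_dist_btw (a b c : R) : (a <= c <= b) || (b <= c <= a) -> `|c - a| <= `|b - a|.
Proof.
have := ler_norm (b - a); have := ler_norm (a - b); rewrite (distrC a) => h1 h2.
by case/orP => /andP[h3 h4]; rewrite ler_norml; lra.
Qed.

(** As long as [v] and [w] lie on the same side of the corner, so do all the
    intermediate points, and only one of the two pieces is involved. *)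
Lemma stein_mvt z v w : (v <= z) = (w <= z) ->
  exists c, [/\ `|c - w| <= `|v - w|, (c <= z) = (w <= z) &
    stein z v - stein z w = stein_d z c * (v - w)].
Proof.
rewrite /stein_d /stein => e; rewrite e; case: (leP w z) e => [wz vz|zw vz].
  have [c cb ->] := mvt_btw w v (is_derive_steinL z).
  have cz : c <= z by case/orP: cb => /andP[]; lra.
  exists c; rewrite cz; split => //=; last by ring.
  exact: ler_dist_btw.
have [c cb ->] := mvt_btw w v (is_derive_steinR z).
have {}vz : z < v by rewrite ltNge vz.
have cz : z < c by case/orP: cb => /andP[]; lra.
have {}cz : (c <= z) = false by rewrite leNgt cz.
exists c; rewrite cz; split => //=; last by ring.
exact: ler_dist_btw.
Qed.

Lemma stein_lip z v w : `|stein z v - stein z w| <= 2 * `|v - w|.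
Proof.
have [/stein_mvt[c [_ _ ->]]|] := eqVneq (v <= z) (w <= z).
  by rewrite normrM ler_wpM2r// normr_stein_d.
wlog: v w / v <= z.
  move=> h vw; have [vz|zv] := boolP (v <= z); first exact: h.
  have [wz|zw] := boolP (w <= z); last by rewrite (negbTE zv) (negbTE zw) in vw.
  by rewrite distrC (distrC v); apply: h => //; rewrite eq_sym.
move=> vz; rewrite vz; case: (leP w z) => // zw _.
have [c1 [_ _ e1]] := @stein_mvt z v z ltac:(by rewrite vz lexx).
have -> : stein z v - stein z w = (stein z v - stein z z) + (stein z z - stein z w) by ring.
have [c cb e2] := mvt_btw w z (is_derive_steinR z).
have zc : z <= c by case/orP: cb => /andP[]; lra.
have e3 : stein z z - stein z w = steinR z z - steinR z w.
  by rewrite /stein lexx leNgt zw/=; congr (_ - _); rewrite /steinL /steinR; ring.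
have df : `|c * steinR z c - ncdf z| <= 2.
  move: zc; rewrite le_eqVlt => /predU1P[<-|zc].
    have := normr_stein z z; have z0 := ncdf_ge0 z; have z1 := ncdf_le1 z.
    rewrite /stein lexx.
    have -> : steinL z z = steinR z z by rewrite /steinL /steinR; ring.
    by rewrite !ler_norml; lra.
  by have := normr_stein_d z c; rewrite /stein_d /stein (leNgt c z) zc /= addr0.
apply: (le_trans (ler_normD _ _)); rewrite e1 e3 e2 !normrM.
rewrite (ler0_norm (_ : v - z <= 0)); last by lra.
rewrite (ler0_norm (_ : z - w <= 0)); last by lra.
rewrite (ler0_norm (_ : v - w <= 0)); last by lra.
have h1 : 0 <= - (v - z) by lra.
have h2 : 0 <= - (z - w) by lra.
have := ler_wpM2r h1 (normr_stein_d z c1); have := ler_wpM2r h2 df; lra.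
Qed.

(** The derivative is [w * stein z w] up to a step at [z]; the step is felt only
    if [z] separates [v] and [w], in which case [z] is within [|v - w|] of
    [w]. *)
Lemma stein_d_lip z v w : `|stein_d z v - stein_d z w| <=
  (2 * `|w| + stein_ub) * `|v - w| + (`|w - z| <= `|v - w|)%R%:R.
Proof.
have -> : stein_d z v - stein_d z w =
   (w * (stein z v - stein z w) + (v - w) * stein z v) +
     ((v <= z)%R%:R - (w <= z)%R%:R) by rewrite /stein_d; ring.
apply: (le_trans (ler_normD _ _)); apply: lerD.
  apply: (le_trans (ler_normD _ _)); rewrite [leRHS]mulrDl; apply: lerD; rewrite normrM.
    by rewrite [2 * _]mulrC -mulrA ler_wpM2l// stein_lip.
  by rewrite mulrC ler_wpM2r// ger0_norm ?stein_ge0// stein_le_ub.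
have [h|h] := leP `|w - z| `|v - w|.
  by case: (v <= z); case: (w <= z); rewrite /= ?subrr ?normr0 ?subr0 ?sub0r ?normrN ?normr1 ?ler01.
suff -> : (v <= z) = (w <= z) by rewrite subrr normr0.
move: h; case: (leP v z) => vz; case: (leP w z) => wz //.
  by rewrite (ler0_norm (_ : v - w <= 0)); [rewrite (ger0_norm (_ : 0 <= w - z)); lra|lra].
by rewrite (ger0_norm (_ : 0 <= v - w)); [rewrite (ler0_norm (_ : w - z <= 0)); lra|lra].
Qed.

(** First-order expansion of the solution. Its remainder is quadratic unless the
    corner at [z] lies between the two points; that exceptional case is what
    makes a concentration inequality necessary. *)
Lemma stein_taylor z v w : `|stein z v - stein z w - (v - w) * stein_d z w| <=
  (2 * `|w| + stein_ub) * (v - w) ^+ 2 + 4 * `|v - w| * (`|w - z| <= `|v - w|)%R%:R.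
Proof.
have ub := stein_ub_ge1.
have [h|h] := eqVneq (v <= z) (w <= z).
  have [c [cv cz ->]] := stein_mvt h.
  rewrite mulrC -mulrBr normrM.
  have /le_trans := ler_wpM2l (normr_ge0 (v - w)) (stein_d_lip z c w); apply.
  rewrite -[(v - w) ^+ 2]real_normK ?num_real// mulrDr; apply: lerD.
    rewrite expr2 mulrCA; apply: ler_wpM2l; last by rewrite ler_wpM2l.
    by have := normr_ge0 w; lra.
  have [h1|h1] := leP `|w - z| `|c - w|.
    by rewrite (le_trans h1 cv) /= !mulr1 ler_peMl//; lra.
  by rewrite /= mulr0 !mulr_ge0.
(* the corner lies between [w] and [v] *)
have -> : `|w - z| <= `|v - w|.
  move: h; case: (leP v z) => vz; case: (leP w z) => wz // _.
    by rewrite (ler0_norm (_ : v - w <= 0)) ?ler_norml; lra.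
  by rewrite (ger0_norm (_ : 0 <= v - w)) ?ler_norml; lra.
rewrite mulr1; apply: (le_trans (ler_normB _ _)); rewrite normrM.
have h1 := stein_lip z v w; have h2 := normr_stein_d z w.
have h3 : 0 <= (2 * `|w| + stein_ub) * (v - w) ^+ 2.
  by apply: mulr_ge0; [have := normr_ge0 w; lra|exact: sqr_ge0].
have := ler_wpM2l (normr_ge0 (v - w)) h2; lra.
Qed.

Lemma continuous_ncdf : continuous ncdf.
Proof.
move=> x; apply: differentiable_continuous; apply/derivable1_diffP.
by have := is_derive_ncdf x => ?; exact: ex_derive.
Qed.

Lemma measurable_ncdf : measurable_fun setT ncdf.
Proof. by apply: continuous_measurable_fun; exact: continuous_ncdf. Qed.

Lemma measurable_stein z : measurable_fun setT (stein z).
Proof.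
have mi : measurable_fun setT invpdf.
  apply: measurable_funM => //; apply: measurableT_comp => //.
  by apply: measurable_funM => //; exact: measurable_funX.
rewrite /stein; apply: measurable_fun_ifT.
- by apply: measurable_fun_ler.
- by apply: measurable_funM => //; apply: measurable_funM => //; exact: measurable_ncdf.
- apply: measurable_funM => //; apply: measurable_funM => //.
  by apply: measurable_funB => //; exact: measurable_ncdf.
Qed.

Lemma measurable_stein_d z : measurable_fun setT (stein_d z).
Proof.
apply: measurable_funB => //; apply: measurable_funD.
  by apply: measurable_funM => //; exact: measurable_stein.
rewrite (_ : (fun _ => _) = fun w => if w <= z then 1 else 0).
  by apply: measurable_fun_ifT => //; exact: measurable_fun_ler.
by apply/funext => w; case: ifP.
Qed.

(** A bound that stays valid when [z] is moved to any [c] with [|c| >= |z| / 2]. *)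
Lemma npdf_le c z : z ^+ 2 <= 4 * c ^+ 2 ->
  npdf c * (1 + z ^+ 2 / 8) <= normal_peak 1.
Proof.
move=> h; rewrite npdfE -mulrA ler_piMr ?(ltW npeak_gt0)//.
rewrite mulNr expRN mulrC ler_pdivrMr ?expR_gt0// mul1r.
apply: le_trans (expR_ge1Dx _) => /=; lra.
Qed.

(** A perturbation of the threshold of size [e * |z| * (1 + |z|)] costs only
    [O(e)], however large [z] is: the factor [|z| * (1 + |z|)] is absorbed by the
    decay of the density. *)
Lemma ncdf_perturb z w e : 0 <= e -> `|w - z| <= `|z| / 2 ->
  `|w - z| <= e * (`|z| * (1 + `|z|)) ->
  `|ncdf w - ncdf z| <= 12 * normal_peak 1 * e.
Proof.
move=> e0 h1 h2; have [c cb ->] := mvt_btw z w is_derive_ncdf.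
have cz : `|c - z| <= `|z| / 2 by apply: le_trans h1; exact: ler_dist_btw.
have hc : z ^+ 2 <= 4 * c ^+ 2.
  rewrite -[z ^+ 2]real_normK ?num_real// -[c ^+ 2]real_normK ?num_real//.
  have : `|z| <= 2 * `|c|.
    have := ler_distD c z 0; rewrite !subr0 distrC; lra.
  have := normr_ge0 z; have := normr_ge0 c; nra.
have hp := npdf_le hc; have p0 := npdf_gt0 c; have k0 := @npeak_gt0.
rewrite normrM (gtr0_norm p0).
have hz : `|z| * (1 + `|z|) <= 12 * (1 + z ^+ 2 / 8).
  (* from [y * (1 + y) <= (1 + 3 * y ^ 2) / 2] *)
  by rewrite -[z ^+ 2]real_normK ?num_real//; have := normr_ge0 z; nra.
apply: (@le_trans _ _ (npdf c * (e * (12 * (1 + z ^+ 2 / 8))))).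
  apply: ler_wpM2l; first exact: ltW.
  by apply: (le_trans h2); rewrite ler_wpM2l.
have := ler_wpM2r e0 hp; lra.
Qed.

(** Any polynomial rate would hold; the fourth power is the one that matches
    [z ^ 4 = sqrt n] in the treatment of large thresholds. *)
Lemma ncdf_tail : exists2 K : R, 0 < K &
  forall z, 0 < z -> z ^+ 4 * (1 - ncdf z) <= K /\ z ^+ 4 * ncdf (- z) <= K.
Proof.
have k0 := npeak_gt0.
exists (1 + 8 * normal_peak 1) => [|z z0]; first by lra.
have main (p : R) : 0 <= p <= 1 -> z * p <= npdf z -> z ^+ 4 * p <= 1 + 8 * normal_peak 1.
  move=> /andP[p0 p1] hp; have [z1|/ltW z1] := leP 1 z; last first.
    by apply: (@le_trans _ _ 1); [rewrite mulr_ile1 ?exprn_ge0 ?exprn_ile1// ltW|lra].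
  apply: (@le_trans _ _ (z ^+ 4 * npdf z)).
    have -> : z ^+ 4 * p = z ^+ 3 * (z * p) by ring.
    apply: (@le_trans _ _ (z ^+ 3 * npdf z)); first by rewrite ler_wpM2l// exprn_ge0 ?ltW.
    by rewrite ler_wpM2r ?ler_weXn2l// ltW// npdf_gt0.
  rewrite npdfE mulNr expRN mulrCA.
  suff : z ^+ 4 / expR (z ^+ 2 / 2) <= 8 by move=> /(ler_wpM2l (ltW k0)); lra.
  rewrite ler_pdivrMr ?expR_gt0//.
  have := @expR_ge1Dxn R (z ^+ 2 / 2) 1.
  by rewrite divr_ge0 ?sqr_ge0// => /(_ isT); rewrite (_ : 2`!%:R = 2)//; lra.
split; apply: main.
- by rewrite subr_ge0 ncdf_le1 gerBl ncdf_ge0.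
- exact/mills_pos/ltW.
- by rewrite ncdf_ge0 ncdf_le1.
- have := @mills_neg (- z); rewrite oppr_le0 opprK => /(_ (ltW z0)).
  by rewrite !npdfE sqrrN.
Qed.
End normal_cdf.

(** * The Berry-Esseen bound for i.i.d. sums *)

Section berry_esseen.
Context {R : realType} {d} {T : measurableType d} (P : probability T R).
Variables (g : T -> R) (n : nat).
Hypotheses (gi : L1fun P g) (g2i : L1fun P (fun x => g x ^+ 2))
  (g3i : L1fun P (fun x => `|g x| ^+ 3)).
Hypotheses (g0 : mean P g = 0) (g2 : n.+1%:R * mean P (fun x => g x ^+ 2) = 1).
Let gam : R := n.+1%:R * mean P (fun x => `|g x| ^+ 3).
Let N : R := n.+1%:R.
Let nu : probability (n.-tuple T) R := iid_law P n.
Let W : n.-tuple T -> R := @tsum R d T g n.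

Let mg : measurable_fun setT g. Proof. exact: L1_measurable gi. Qed.
Let mW : measurable_fun setT W. Proof. exact: measurable_tsum. Qed.
Let N0 : 0 < N. Proof. by rewrite ltr0n. Qed.
Let mg2 : mean P (fun x => g x ^+ 2) = N^-1.
Proof. by apply: (mulfI (lt0r_neq0 N0)); rewrite g2 mulfV ?gt_eqF. Qed.
Let Wi : L1fun nu W. Proof. exact: L1_tsum. Qed.

Let mean_norm_tsum k : (k <= n.+1)%N -> mean (iid_law P k) (fun t => `|tsum g t|) <= 1.
Proof.
move=> kn; have Si := L1_tsum k gi; have S2i := L1_tsum_sqr k gi g2i.
have i : L1fun (iid_law P k) (fun t => 2^-1 * (1 + tsum g t ^+ 2)).
  by apply: L1Z; apply: L1D => //; exact: L1_cst.
apply: (@le_trans _ _ (mean (iid_law P k) (fun t => 2^-1 * (1 + tsum g t ^+ 2)))).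
  apply: le_mean => //; first exact: L1_norm.
  move=> t; rewrite -[tsum g t ^+ 2]real_normK ?num_real//.
  have : 0 <= (`|tsum g t| - 1) ^+ 2 by exact: sqr_ge0.
  by rewrite sqrrB; lra.
rewrite meanZ; last by apply: L1D => //; exact: L1_cst.
rewrite meanD//; last exact: L1_cst.
rewrite mean_cst mean_tsum_sqr// mg2.
have : k%:R / N <= 1 by rewrite ler_pdivrMr// mul1r ler_nat.
by move: (k%:R / N) => u hu; lra.
Qed.

Let s : R := Num.sqrt N^-1.
Let s0 : 0 < s. Proof. by rewrite sqrtr_gt0 invr_gt0. Qed.
Let sE : N^-1 = s ^+ 2. Proof. by rewrite sqr_sqrtr// invr_ge0 ltW. Qed.

(** By the inequality [2 * s * |y| <= y ^ 2 + s ^ 2]. *)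
Let mean_norm_le_s : mean P (fun x => `|g x|) <= s.
Proof.
have i : L1fun P (fun x => (2 * s)^-1 * (g x ^+ 2 + s ^+ 2)).
  by apply: L1Z; apply: L1D => //; exact: L1_cst.
apply: (@le_trans _ _ (mean P (fun x => (2 * s)^-1 * (g x ^+ 2 + s ^+ 2)))).
  apply: le_mean => //; first exact: L1_norm.
  move=> x; rewrite mulrC ler_pdivlMr ?mulr_gt0// -[g x ^+ 2]real_normK ?num_real//.
  have : 0 <= (`|g x| - s) ^+ 2 by exact: sqr_ge0.
  by rewrite sqrrB; lra.
rewrite meanZ; last by apply: L1D => //; exact: L1_cst.
rewrite meanD//; last exact: L1_cst.
rewrite mean_cst mg2 sE mulrC ler_pdivrMr ?mulr_gt0//.
by rewrite expr2; lra.
Qed.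

(** Lyapunov's inequality: the third moment cannot be smaller than its value for
    a variable of constant absolute value. It lets [gam] absorb the terms of order
    [1 / sqrt N]. *)
Let s_le_gam : s <= gam.
Proof.
have gi' := L1_norm gi.
have i1 : L1fun P (fun x => s * `|g x|) by exact: L1Z.
have h : mean P (fun x => 2 * s * g x ^+ 2) <=
    mean P (fun x => `|g x| ^+ 3 + s * (s * `|g x|)).
  apply: le_mean; [exact: L1Z|by apply: L1D => //; exact: L1Z|].
  move=> x; rewrite -[g x ^+ 2]real_normK ?num_real//.
  have : 0 <= `|g x| * (`|g x| - s) ^+ 2 by rewrite mulr_ge0// sqr_ge0.
  by rewrite sqrrB !exprS !expr0; lra.
move: h; rewrite meanD ?meanZ//; last exact: L1Z.
rewrite mg2 sE => h.
have h2 : s * (s * mean P (fun x => `|g x|)) <= s * (s * s).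
  by do 2 (rewrite ler_wpM2l ?(ltW s0)//); exact: mean_norm_le_s.
have h3 : s ^+ 2 * s <= mean P (fun x => `|g x| ^+ 3).
  by move: h h2; rewrite !expr2; lra.
have : N * (s ^+ 2 * s) <= gam by rewrite /gam ler_pM2l.
by rewrite -sE mulrA mulfV ?gt_eqF// mul1r.
Qed.

Let gam0 : 0 < gam. Proof. exact: lt_le_trans s0 s_le_gam. Qed.

Let mset_itv a b : measurable [set t | a <= W t <= b].
Proof.
rewrite (_ : [set _ | _] = W @^-1` `[a, b]%classic).
  by rewrite -[X in measurable X]setTI; exact: mW.
by apply/seteqP; split => t /=; rewrite in_itv.
Qed.

(** Take [k] to be the identity, recentred at the middle of [a, b] and clamped at
    distance [del] outside of it. On one hand the mean of [S * k S] is at most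
    [h], as the mean of [|S|] is at most [1]. On the other hand it is a sum of
    means of nonnegative terms [g x * (k (g x + W) - k W)], and such a term equals
    [g x ^ 2] when [W] lies in [a, b] and [|g x| <= del]. With [del = 2 * gam] these
    small values of [g] carry half of the variance. *)
Let concentration a b : a <= b ->
  prob nu [set t | a <= W t <= b] <= (b - a) + 4 * gam.
Proof.
move=> ab.
pose del := 2 * gam; pose h := (b - a) / 2 + del; pose m := (a + b) / 2.
pose k (w : R) := Num.min (Num.max (w - m) (- h)) h.
have del0 : 0 < del by rewrite mulr_gt0.
have h0 : 0 < h by rewrite /h; lra.
have mk : measurable_fun setT k.
  apply: measurable_minr => //; apply: measurable_maxr => //.
  exact: measurable_funB.
have kh w : `|k w| <= h.
  by rewrite /k ler_norml le_min ge_min lexx orbT andbT le_max lexx orbT/=; lra.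
have kmono v w : v <= w -> k v <= k w.
  move=> vw; rewrite /k le_min !ge_min lexx orbT andbT; apply/orP; left.
  by rewrite ge_max !le_max lexx orbT andbT; apply/orP; left; lra.
have kid w : a - del <= w <= b + del -> k w = w - m.
  move=> hw; rewrite /k /h /m; case: leP => h1; case: leP => h2; rewrite /h /m in h1 h2; lra.
pose A := [set t | a <= W t <= b].
have mA : measurable A by exact: mset_itv.
have Lk c : L1fun nu (fun t => k (c + W t)).
  apply: (@L1_bounded _ _ _ _ _ h) => //; apply: (measurableT_comp mk).
  exact: measurable_funD.
have Lk0 : L1fun nu (fun t => k (W t)).
  by apply: (@L1_bounded _ _ _ _ _ h) => //; exact: (measurableT_comp mk mW).
(* a lower bound for [g x ^ 2] restricted to [|g x| <= del] *)
pose q x := g x ^+ 2 - `|g x| ^+ 3 / del.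
have key x : q x * prob nu A <= g x * (mean nu (fun t => k (g x + W t)) - mean nu (fun t => k (W t))).
  rewrite prob_mean// -meanB// -!meanZ ?L1_indic//; last exact: L1B.
  apply: le_mean => [||t]; [by apply: L1Z; exact: L1_indic|by apply: L1Z; exact: L1B|].
  have nonneg : 0 <= g x * (k (g x + W t) - k (W t)).
    have [gx|/ltW gx] := leP 0 (g x).
      by rewrite mulr_ge0// subr_ge0 kmono//; lra.
    by rewrite mulr_le0// subr_le0 kmono//; lra.
  have [tA|tA] := boolP (t \in A); last by rewrite indicE (negbTE tA) mulr0.
  rewrite indicE tA mulr1; move: tA; rewrite inE /A/= => /andP[aW Wb].
  have [gx|gx] := leP `|g x| del.
    rewrite !kid; try by move: gx; rewrite ler_norml => /andP[]; lra.
    have -> : g x * (g x + W t - m - (W t - m)) = g x ^+ 2 by ring.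
    by rewrite /q gerBl divr_ge0 ?exprn_ge0// ltW.
  apply: le_trans nonneg; rewrite /q subr_le0 ler_pdivlMr//.
  by rewrite -[g x ^+ 2]real_normK ?num_real// [leRHS]exprSr ler_wpM2l ?sqr_ge0// ltW.
have qi : L1fun P q by apply: L1B => //; under [X in L1fun _ X]eq_fun do rewrite mulrC; exact: L1Z.
have mq : mean P q = (2 * N)^-1.
  rewrite meanB//; last by under [X in L1fun _ X]eq_fun do rewrite mulrC; exact: L1Z.
  under [X in _ - X]eq_mean do rewrite mulrC; rewrite meanZ// mg2.
  by rewrite /del /gam; field; rewrite !gt_eqF//= -(pmulr_rgt0 _ N0).
have Lpair : L1fun (P \x nu)%E (fun z => g z.1 * k (g z.1 + W z.2)).
  apply: (@L1M_bounded _ _ _ _ _ _ h) => //; first exact: L1_fst.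
  apply: (measurableT_comp mk); apply: measurable_funD.
    exact: (measurableT_comp mg). exact: (measurableT_comp mW).
have Lin x : L1fun nu (fun t => g x * k (g x + W t)) by exact: L1Z.
have Lmk : L1fun P (fun x => g x * mean nu (fun t => k (g x + W t))).
  have := L1_mean1 Lpair Lin; apply: eq_integrable => // x _ /=.
  by rewrite meanZ.
have e := mean_tsum_mul n gi mk kh.
have up : mean (iid_law P n.+1) (fun t => tsum g t * k (tsum g t)) <= h.
  have Si := L1_tsum n.+1 gi.
  apply: (@le_trans _ _ (mean (iid_law P n.+1) (fun t => h * `|tsum g t|))).
    apply: le_mean.
    - apply: (@L1M_bounded _ _ _ _ _ _ h) => //.
      by apply: (measurableT_comp mk); exact: measurable_tsum.
    - by apply: L1Z; exact: L1_norm.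
    - move=> t; rewrite mulrC; apply: (le_trans (ler_norm _)).
      by rewrite normrM ler_wpM2r.
  rewrite meanZ; last exact: L1_norm.
  by rewrite ler_piMr ?(ltW h0)//; exact: mean_norm_tsum.
have low : mean P q * prob nu A <= mean P (fun x => g x * mean nu (fun t => k (g x + W t))).
  rewrite mulrC -meanZ//.
  have -> : mean P (fun x => g x * mean nu (fun t => k (g x + W t))) =
     mean P (fun x => g x * (mean nu (fun t => k (g x + W t)) - mean nu (fun t => k (W t)))).
    under [RHS]eq_mean do rewrite mulrBr.
    rewrite meanB//; last by under [X in L1fun _ X]eq_fun do rewrite mulrC; exact: L1Z.
    under [X in _ - X]eq_mean do rewrite mulrC.
    by rewrite meanZ// g0 mulr0 subr0.
  apply: le_mean; first exact: L1Z.
    under [X in L1fun _ X]eq_fun do rewrite mulrBr.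
    by apply: L1B => //; under [X in L1fun _ X]eq_fun do rewrite mulrC; exact: L1Z.
  by move=> x; rewrite mulrC; exact: key.
move: up; rewrite e => up.
have : N * (mean P q * prob nu A) <= h by apply: le_trans up; rewrite ler_pM2l.
rewrite mq mulrA; have -> : N * (2 * N)^-1 = 2^-1 by field; rewrite gt_eqF.
by rewrite /h /del /A; lra.
Qed.

(** Stein's method. By Stein's equation the difference is the mean of
    [D S - S * F S]; singling out one summand [g x] of [S] and writing [W] for the
    others, and using that [g] is centred with variance [1 / N], it becomes the
    mean of the increment of [D] and of the first-order remainder of [F] between
    [W] and [W + g x]. Both are small except when [W] is within [|g x|] of the
    corner [z], an event to which [concentration] applies because [W] is
    independent of [g x]. *)
Theorem berry_esseen_iid z :
  `|prob (iid_law P n.+1) [set t | tsum g t <= z] - ncdf z| <= (34 + 2 * @stein_ub R) * gam.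
Proof.
have c0 : 1 <= @stein_ub R := stein_ub_ge1.
set c := @stein_ub R in c0 *.
pose F := stein z; pose D := stein_d z.
have mF : measurable_fun setT F := measurable_stein z.
have mD : measurable_fun setT D := measurable_stein_d z.
have FM w : `|F w| <= c by rewrite ger0_norm ?stein_ge0// stein_le_ub.
have DM w : `|D w| <= 2 := normr_stein_d z w.
have mgW : measurable_fun setT (fun w : T * n.-tuple T => g w.1 + W w.2).
  by apply: measurable_funD; [exact: (measurableT_comp mg)|exact: (measurableT_comp mW)].
have Lb (h : R -> R) M x : measurable_fun setT h -> (forall w, `|h w| <= M) ->
    L1fun nu (fun t => h (x + W t)).
  move=> mh hM; apply: (@L1_bounded _ _ _ _ _ M) => //; apply: (measurableT_comp mh).
  exact: measurable_funD.
have LF0 : L1fun nu (fun t => F (W t)).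
  by apply: (@L1_bounded _ _ _ _ _ c) => //; exact: (measurableT_comp mF mW).
have LD0 : L1fun nu (fun t => D (W t)).
  by apply: (@L1_bounded _ _ _ _ _ 2) => //; exact: (measurableT_comp mD mW).
have LF x : L1fun nu (fun t => F (x + W t)) by exact: Lb.
have LD x : L1fun nu (fun t => D (x + W t)) by exact: Lb.
have LPF : L1fun (P \x nu)%E (fun w => g w.1 * F (g w.1 + W w.2)).
  apply: (@L1M_bounded _ _ _ _ _ _ c) => //; first exact: L1_fst.
  exact: (measurableT_comp mF mgW).
have LPD : L1fun (P \x nu)%E (fun w => D (g w.1 + W w.2)).
  by apply: (@L1_bounded _ _ _ _ _ 2) => //; exact: (measurableT_comp mD mgW).
have LinF x : L1fun nu (fun t => g x * F (g x + W t)) by exact: L1Z.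
have LgF : L1fun P (fun x => g x * mean nu (fun t => F (g x + W t))).
  have := L1_mean1 LPF LinF.
  by apply: eq_integrable => // x _ /=; rewrite meanZ.
have LmD : L1fun P (fun x => mean nu (fun t => D (g x + W t))).
  exact: (L1_mean1 LPD (fun x => LD (g x))).
have mS : measurable_fun setT (@tsum R d T g n.+1) by exact: measurable_tsum.
have mA : measurable [set t | @tsum R d T g n.+1 t <= z].
  exact: measurable_le_set.
have LDS : L1fun (iid_law P n.+1) (fun t => D (tsum g t)).
  by apply: (@L1_bounded _ _ _ _ _ 2) => //; exact: (measurableT_comp mD).
have LFS : L1fun (iid_law P n.+1) (fun t => tsum g t * F (tsum g t)).
  apply: (@L1M_bounded _ _ _ _ _ _ c) => //; first exact: L1_tsum.
  exact: (measurableT_comp mF).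
have -> : prob (iid_law P n.+1) [set t | tsum g t <= z] - ncdf z =
    mean P (fun x => mean nu (fun t => D (g x + W t))) -
    N * mean P (fun x => g x * mean nu (fun t => F (g x + W t))).
  rewrite -(mean_tsum_mul n gi mF FM).
  have <- : mean (iid_law P n.+1) (fun t => D (tsum g t)) =
      mean P (fun x => mean nu (fun t => D (g x + W t))).
    rewrite mean_iid_lawS// mean_prod1.
    - by apply: eq_mean => x; apply: eq_mean => t /=; rewrite tsum_tcons.
    - by apply/L1_iid_lawS => //; exact: (measurableT_comp mD).
    - move=> x; rewrite [X in L1fun _ X](_ : _ = fun t : n.-tuple T => D (g x + W t)) => //.
      by apply/funext => t /=; rewrite tsum_tcons.
  rewrite -meanB// prob_mean// -[X in _ - X](mean_cst (iid_law P n.+1)).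
  rewrite -meanB//; [|exact: L1_indic|exact: L1_cst].
  apply: eq_mean => t; rewrite /D /stein_d /F indicE.
  have -> : (t \in [set t | tsum g t <= z]) = (tsum g t <= z) by apply/idP/idP; rewrite inE.
  by ring.
(* the increment of [D] and the remainder of [F], averaged over [W] *)
pose B1 x := mean nu (fun t => D (g x + W t) - D (W t)).
pose B2 x := mean nu (fun t => F (g x + W t) - F (W t) - g x * D (W t)).
have LB1 x : L1fun nu (fun t => D (g x + W t) - D (W t)) by exact: L1B.
have LB2 x : L1fun nu (fun t => F (g x + W t) - F (W t) - g x * D (W t)).
  by apply: L1B; [exact: L1B|exact: L1Z].
have B1E x : B1 x = mean nu (fun t => D (g x + W t)) - mean nu (fun t => D (W t)).
  by rewrite /B1 meanB.
have B2E x : B2 x = mean nu (fun t => F (g x + W t)) - mean nu (fun t => F (W t))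
    - g x * mean nu (fun t => D (W t)).
  by rewrite /B2 meanB; [rewrite meanB// meanZ|exact: L1B|exact: L1Z].
have LB1' : L1fun P B1.
  rewrite (_ : B1 = fun x => mean nu (fun t => D (g x + W t)) - mean nu (fun t => D (W t))).
    by apply: L1B => //; exact: L1_cst.
  by apply/funext.
have gB2E x : g x * B2 x = g x * mean nu (fun t => F (g x + W t))
    - (mean nu (fun t => F (W t)) * g x + mean nu (fun t => D (W t)) * g x ^+ 2).
  by rewrite B2E; move: (mean nu _) (mean nu _) (mean nu _) => u1 u2 u3; ring.
have LgB2 : L1fun P (fun x => g x * B2 x).
  rewrite (_ : (fun _ => _) = fun x => g x * mean nu (fun t => F (g x + W t))
    - (mean nu (fun t => F (W t)) * g x + mean nu (fun t => D (W t)) * g x ^+ 2)).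
    by apply: L1B => //; apply: L1D; exact: L1Z.
  by apply/funext.
have -> : mean P (fun x => mean nu (fun t => D (g x + W t))) -
    N * mean P (fun x => g x * mean nu (fun t => F (g x + W t))) =
    mean P (fun x => B1 x - N * (g x * B2 x)).
  pose a0 := mean nu (fun t => F (W t)); pose a1 := mean nu (fun t => D (W t)).
  pose mnF x := mean nu (fun t => F (g x + W t)).
  pose mnD x := mean nu (fun t => D (g x + W t)).
  have e1 : mean P B1 = mean P mnD - a1.
    rewrite (eq_mean P B1E) -[X in _ - X](mean_cst P).
    by apply: meanB => //; exact: L1_cst.
  have e2 : mean P (fun x => g x * B2 x) = mean P (fun x => g x * mnF x) - a1 * N^-1.
    rewrite (eq_mean P gB2E).
    have i0 : L1fun P (fun x => a0 * g x) by exact: L1Z.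
    have i1 : L1fun P (fun x => a1 * g x ^+ 2) by exact: L1Z.
    have := meanB LgF (L1D i0 i1); rewrite (meanD i0 i1) (meanZ a0 gi) (meanZ a1 g2i).
    by rewrite g0 mulr0 add0r mg2.
  rewrite (meanB LB1' (L1Z N LgB2)) (meanZ N LgB2) e1 e2.
  rewrite -/mnF -/mnD; move: (mean P mnD) (mean P _) => u1 u2.
  by field; rewrite gt_eqF.
apply: le_trans.
  by apply: ler_norm_mean; apply: L1B => //; exact: L1Z.
have near x : prob nu [set t | `|W t - z| <= `|g x|] <= 2 * `|g x| + 4 * gam.
  have := @concentration (z - `|g x|) (z + `|g x|).
  have -> : [set t | z - `|g x| <= W t <= z + `|g x|] = [set t | `|W t - z| <= `|g x|].
    by apply/seteqP; split => t /=; rewrite ler_distl.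
  by have gx := normr_ge0 (g x) => /(_ ltac:(lra)); lra.
have mB x : measurable [set t | `|W t - z| <= `|g x|].
  rewrite (_ : [set _ | _] = [set t | z - `|g x| <= W t <= z + `|g x|]); first exact: mset_itv.
  by apply/seteqP; split => t /=; rewrite ler_distl.
have Wn1 : mean nu (fun t => `|W t|) <= 1 by exact: mean_norm_tsum.
have LW := L1_norm Wi.
(* the common shape of the bounds of [stein_d_lip] and [stein_taylor], averaged over [W] *)
have bnd (al be : R) x : 0 <= al -> 0 <= be ->
    let f t := al * (2 * `|W t| + c) + be * (`|W t - z| <= `|g x|)%R%:R in
    L1fun nu f /\ mean nu f <= al * (2 + c) + be * (2 * `|g x| + 4 * gam).
  move=> al0 be0 f.
  have -> : f = fun t => al * (2 * `|W t| + c) + be * \1_[set t | `|W t - z| <= `|g x|] t.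
    apply/funext => t; rewrite /f indicE; congr (_ + _ * _%:R).
    by congr nat_of_bool; apply/idP/idP; rewrite inE.
  have L1a : L1fun nu (fun t => 2 * `|W t| + c) by apply: L1D; [exact: L1Z|exact: L1_cst].
  have L1b := L1_indic nu (mB x).
  split; first by apply: L1D; exact: L1Z.
  rewrite meanD ?meanZ//; try exact: L1Z.
  rewrite -prob_mean// meanD ?meanZ ?mean_cst//; [|exact: L1Z|exact: L1_cst].
  by apply: lerD; rewrite ler_wpM2l//; lra.
have b1 x : `|B1 x| <= `|g x| * (2 + c) + (2 * `|g x| + 4 * gam).
  apply: (le_trans (ler_norm_mean (LB1 x))).
  have [Lf hf] := bnd `|g x| 1 x (normr_ge0 _) ler01.
  rewrite mul1r in hf; apply: le_trans hf; apply: le_mean => //; first exact: L1_norm.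
  move=> t; have := stein_d_lip z (g x + W t) (W t).
  by rewrite addrK mul1r mulrC.
have b2 x : `|B2 x| <= g x ^+ 2 * (2 + c) + 4 * `|g x| * (2 * `|g x| + 4 * gam).
  apply: (le_trans (ler_norm_mean (LB2 x))).
  have [Lf hf] := bnd (g x ^+ 2) (4 * `|g x|) x (sqr_ge0 _) ltac:(by rewrite mulr_ge0).
  apply: le_trans hf; apply: le_mean => //; first exact: L1_norm.
  move=> t; have := stein_taylor z (g x + W t) (W t).
  by rewrite addrK mulrC [_ ^+ 2 * _]mulrC.
have LB : L1fun P (fun x => ((4 + c) * `|g x| + 4 * gam) +
    (N * ((10 + c) * `|g x| ^+ 3) + N * (16 * gam * g x ^+ 2))).
  have gi' := L1_norm gi.
  apply: L1D; first by apply: L1D; [exact: L1Z|exact: L1_cst].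
  by apply: L1D; do 2 apply: L1Z.
apply: (@le_trans _ _ (mean P (fun x => ((4 + c) * `|g x| + 4 * gam) +
    (N * ((10 + c) * `|g x| ^+ 3) + N * (16 * gam * g x ^+ 2))))).
  apply: le_mean => //; first by apply: L1_norm; apply: L1B => //; exact: L1Z.
  move=> x; apply: (le_trans (ler_normB _ _)); apply: lerD.
    by apply: (le_trans (b1 x)); lra.
  rewrite normrM (gtr0_norm N0) -mulrDr ler_pM2l// normrM.
  apply: (le_trans (ler_wpM2l (normr_ge0 _) (b2 x))).
  rewrite -[g x ^+ 2]real_normK ?num_real//.
  by rewrite le_eqVlt; apply/orP; left; apply/eqP; ring.
have gi' := L1_norm gi.
rewrite meanD; [|by apply: L1D; [exact: L1Z|exact: L1_cst]|
  by apply: L1D; do 2 apply: L1Z].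
rewrite meanD; [|exact: L1Z|exact: L1_cst].
rewrite meanD; [|by do 2 apply: L1Z..].
rewrite mean_cst (meanZ _ gi') (meanZ _ (L1Z _ g3i)) (meanZ _ g3i) (meanZ _ (L1Z _ g2i)) (meanZ _ g2i).
have e1 : N * ((10 + c) * mean P (fun x => `|g x| ^+ 3)) = (10 + c) * gam.
  by rewrite /gam; ring.
have e2 : N * (16 * gam * mean P (fun x => g x ^+ 2)) = 16 * gam.
  by rewrite mg2; field; rewrite gt_eqF.
rewrite e1 e2.
have h1 : mean P (fun x => `|g x|) <= gam := le_trans mean_norm_le_s s_le_gam.
have : (4 + c) * mean P (fun x => `|g x|) <= (4 + c) * gam by rewrite ler_wpM2l//; lra.
lra.
Qed.

End berry_esseen.

(** * Student's statistic *)

Section studentT.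
Context {R : realType}.

Definition studentT n (y : 'I_n -> R) : R :=
  Num.sqrt n%:R * (n%:R^-1 * \sum_(i < n) y i) /
  Num.sqrt (n%:R^-1 * \sum_(i < n) (y i - n%:R^-1 * \sum_(i < n) y i) ^+ 2).

(** In terms of the standardised sum [S] and of the uncentred second moment, the
    denominator is what remains to be linearised. *)
Lemma studentTE n (y : 'I_n.+1 -> R) (N := n.+1%:R) (S := (\sum_i y i) / Num.sqrt N) :
  studentT y = S / Num.sqrt ((\sum_i y i ^+ 2) / N - S ^+ 2 / N).
Proof.
have N0 : 0 < N by rewrite ltr0n.
have r0 : 0 < Num.sqrt N by rewrite sqrtr_gt0.
have rr : Num.sqrt N ^+ 2 = N by rewrite sqr_sqrtr// ltW.
rewrite /studentT -/N; congr (_ / Num.sqrt _).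
  rewrite /S -{2}rr; field; rewrite gt_eqF//.
set m := N^-1 * \sum_(i < n.+1) y i.
have -> : \sum_(i < n.+1) (y i - m) ^+ 2 = \sum_i y i ^+ 2 - N * m ^+ 2.
  under eq_bigr do rewrite sqrrB.
  rewrite big_split/= sumrB sumr_const card_ord -/N.
  rewrite (_ : \sum_(i < n.+1) y i * m *+ 2 = 2 * N * m ^+ 2); last first.
    by rewrite sumrMnl -mulr_suml /m; field; rewrite gt_eqF.
  by rewrite -mulr_natl -/N; ring.
have -> : S ^+ 2 = (\sum_i y i) ^+ 2 / N by rewrite /S expr_div_n rr.
by rewrite /m; field; rewrite gt_eqF.
Qed.

Lemma studentT_scale n (y : 'I_n -> R) a : 0 < a ->
  studentT (fun i => a * y i) = studentT y.
Proof.
move=> a0; rewrite /studentT -!mulr_sumr.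
under [X in _ / Num.sqrt (_ * X)]eq_bigr do rewrite mulrCA -mulrBr exprMn.
rewrite -mulr_sumr [n%:R^-1 * (_ ^+ 2 * _)]mulrCA sqrtrM ?sqr_ge0// sqrtr_sqr gtr0_norm//.
rewrite [n%:R^-1 * (a * _)]mulrCA [Num.sqrt n%:R * (a * _)]mulrCA.
by rewrite -mulf_div mulfV ?gt_eqF// mul1r.
Qed.

(** The inverse square root is measurable as a real power; the convention that a
    vanishing denominator gives [0] is the same for both. *)
Lemma measurable_studentT d (T : measurableType d) n (y : 'I_n -> T -> R) :
  (forall i, measurable_fun setT (y i)) ->
  measurable_fun setT (fun w => studentT (fun i => y i w)).
Proof.
move=> my.
have ms : measurable_fun setT (fun w => n%:R^-1 * \sum_(i < n) y i w).
  by apply: measurable_funM => //; exact: measurable_sum.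
pose q w := n%:R^-1 * \sum_(i < n) (y i w - n%:R^-1 * \sum_(i < n) y i w) ^+ 2.
have mq : measurable_fun setT q.
  apply: measurable_funM => //; apply: measurable_sum => i.
  by apply: measurable_funX; exact: measurable_funB.
have q0 w : 0 <= q w.
  by rewrite /q mulr_ge0 ?invr_ge0// sumr_ge0// => i _; exact: sqr_ge0.
rewrite (_ : (fun _ => _) = fun w => Num.sqrt n%:R * (n%:R^-1 * \sum_(i < n) y i w) * (q w `^ (- 2^-1))).
  apply: measurable_funM; first exact: measurable_funM.
  exact: (measurableT_comp (measurable_powR _) mq).
by apply/funext => w; rewrite powRN powR12_sqrt.
Qed.

Lemma ler_norm_sub_cube (x y : R) : `|x - y| ^+ 3 <= 4 * `|x| ^+ 3 + 4 * `|y| ^+ 3.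
Proof.
apply: (@le_trans _ _ ((`|x| + `|y|) ^+ 3)).
  by rewrite ler_pXn2r// ?nnegrE// ?addr_ge0// ler_normB.
have := normr_ge0 x; have := normr_ge0 y; move: `|x| `|y| => u w w0 u0.
have : 0 <= (u + w) * (u - w) ^+ 2 by rewrite mulr_ge0 ?sqr_ge0// addr_ge0.
by rewrite !exprS !expr0; lra.
Qed.

Lemma sqrt_linear (q : R) : 0 <= q -> `|Num.sqrt q - 1 - (q - 1) / 2| <= (q - 1) ^+ 2 / 2.
Proof.
move=> q0; rewrite -{2 3}(sqr_sqrtr q0); set s := Num.sqrt q.
have s0 : 0 <= s by exact: sqrtr_ge0.
(* with [s = sqrt q] the error of the linearisation is [(s - 1) ^ 2 / 2] *)
have -> : s - 1 - (s ^+ 2 - 1) / 2 = - ((s - 1) ^+ 2 / 2) by field.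
rewrite normrN ger0_norm ?divr_ge0 ?sqr_ge0// ler_pM2r// .
have -> : s ^+ 2 - 1 = (s - 1) * (s + 1) by ring.
rewrite exprMn ler_peMr ?sqr_ge0// expr_ge1//; lra.
Qed.

(** The square root is replaced by its linearisation at [q = 1]. For Student's
    statistic [S] is the squared standardised sum over the sample size, which is
    negligible; the linear term [z / 2 * (V - mu)] is again a sum of i.i.d.
    variables and can be moved to the numerator. *)
Lemma student_linear (S q V mu z del K : R) : 0 <= del <= 1 -> 0 <= K ->
  3 * (2 + K ^+ 2) * del < 1 ->
  q - 1 = (V - mu) + (mu - 1) - S -> 0 <= S <= del ->
  (V - mu) ^+ 2 <= del -> `|mu - 1| <= K * del -> 0 <= q ->
  0 < q /\ `|z * Num.sqrt q - (z + z / 2 * (V - mu))| <=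
    `|z| * ((7 + K + 3 * K ^+ 2) / 2 * del).
Proof.
move=> /andP[d0 d1] K0 small qe /andP[S0 Sd] Vd mud q0.
have q1 : (q - 1) ^+ 2 <= 3 * (2 + K ^+ 2) * del.
  rewrite qe.
  have h1 : (mu - 1) ^+ 2 <= K ^+ 2 * del.
    rewrite -real_normK ?num_real//.
    apply: (@le_trans _ _ ((K * del) ^+ 2)).
      by rewrite ler_pXn2r// nnegrE// mulr_ge0.
    by rewrite exprMn ler_wpM2l ?sqr_ge0// expr2 ler_piMl.
  have h2 : S ^+ 2 <= del by apply: le_trans (_ : del * del <= _); [rewrite expr2 ler_pM|rewrite ler_piMl].
  have : 0 <= ((V - mu) - (mu - 1)) ^+ 2 by exact: sqr_ge0.
  have : 0 <= ((V - mu) + S) ^+ 2 by exact: sqr_ge0.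
  have : 0 <= ((mu - 1) + S) ^+ 2 by exact: sqr_ge0.
  move: h1 h2 Vd; move: (V - mu) (mu - 1) => x y; nra.
split.
  rewrite lt_neqAle q0 andbT; apply/negP => /eqP q00.
  by move: q1; rewrite -q00 sub0r sqrrN expr1n leNgt small.
have sl := sqrt_linear q0.
have -> : z * Num.sqrt q - (z + z / 2 * (V - mu)) =
    z * (Num.sqrt q - 1 - (q - 1) / 2 + (mu - 1) / 2 - S / 2).
  by rewrite qe; field.
rewrite normrM ler_wpM2l//.
move: sl mud; rewrite !ler_norml => /andP[? ?] /andP[? ?].
by apply/andP; split; lra.
Qed.

Lemma student_le (S q z : R) : 0 < q -> (S / Num.sqrt q <= z) = (S <= z * Num.sqrt q).
Proof. by move=> q0; rewrite ler_pdivrMr// sqrtr_gt0. Qed.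

End studentT.

Section student_moderate.
Context {R : realType} {d} {T : measurableType d} (P : probability T R).
Variables (g : T -> R) (n : nat) (K : R).
Hypotheses (mg : measurable_fun setT g) (g4i : L1fun P (fun x => g x ^+ 4)).
Hypotheses (g0 : mean P g = 0) (g2 : mean P (fun x => g x ^+ 2) = 1)
  (g4 : mean P (fun x => g x ^+ 4) <= K) (K1 : 1 <= K).

Let N : R := n.+1%:R.
Let r : R := Num.sqrt N.
Let del : R := r^-1.

Let N1 : 1 <= N. Proof. by rewrite ler1n. Qed.
Let N0 : 0 < N. Proof. exact: lt_le_trans ltr01 N1. Qed.
Let r0 : 0 < r. Proof. by rewrite sqrtr_gt0. Qed.
Let rr : N = r ^+ 2. Proof. by rewrite sqr_sqrtr// ltW. Qed.
Let del0 : 0 < del. Proof. by rewrite invr_gt0. Qed.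
Let del2 : N^-1 = del ^+ 2. Proof. by rewrite rr exprVn. Qed.
Let r1 : 1 <= r. Proof. by rewrite -sqrtr1 ler_sqrt. Qed.
Let del1 : del <= 1. Proof. by rewrite invf_le1. Qed.
Let N_le_del : N^-1 <= del. Proof. by rewrite del2 expr2 ler_piMl// ltW. Qed.

Let i14 : L1fun P (fun x => 1 + g x ^+ 4).
Proof. by apply: L1D => //; exact: L1_cst. Qed.

(** All the moments up to the fourth are controlled by the fourth. *)
Let pow_le (y : R) : [/\ `|y| <= 1 + y ^+ 4, y ^+ 2 <= 1 + y ^+ 4 &
  `|y| ^+ 3 <= 1 + y ^+ 4].
Proof.
have -> : y ^+ 4 = `|y| ^+ 4 by rewrite (_ : 4%N = (2 * 2)%N)// !exprM real_normK ?num_real.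
rewrite -(real_normK (num_real y)); have := normr_ge0 y; move: `|y| => u u0.
have [u1|/ltW u1] := leP u 1.
  have h k : 0 <= u ^+ k <= 1 by rewrite exprn_ge0// exprn_ile1.
  have := h 2; have := h 3; have := h 4 => /andP[? ?] /andP[? ?] /andP[? ?].
  by split; lra.
have h k l : (k <= l)%N -> u ^+ k <= u ^+ l by move=> kl; exact: ler_weXn2l.
have := h 1 4 isT; have := h 2 4 isT; have := h 3 4 isT; rewrite expr1 => ? ? ?.
by split; lra.
Qed.

Let gi : L1fun P g.
Proof. by apply: le_L1 i14 _ => // x; case: (pow_le (g x)). Qed.
Let g2i : L1fun P (fun x => g x ^+ 2).
Proof.
apply: le_L1 i14 _ => [|x]; first exact: measurable_funX.
by rewrite ger0_norm ?sqr_ge0//; case: (pow_le (g x)).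
Qed.
Let g3i : L1fun P (fun x => `|g x| ^+ 3).
Proof.
apply: le_L1 i14 _ => [|x].
  by apply: measurable_funX; exact: (measurableT_comp (@normr_measurable R setT)).
by rewrite ger0_norm ?exprn_ge0//; case: (pow_le (g x)).
Qed.

Let g3 : mean P (fun x => `|g x| ^+ 3) <= K.
Proof.
have i : L1fun P (fun x => 2^-1 * (g x ^+ 2 + g x ^+ 4)) by apply: L1Z; exact: L1D.
apply: (@le_trans _ _ (mean P (fun x => 2^-1 * (g x ^+ 2 + g x ^+ 4)))).
  apply: le_mean => // x; have : 0 <= (g x ^+ 2) * (`|g x| - 1) ^+ 2.
    by rewrite mulr_ge0// sqr_ge0.
  have -> : g x ^+ 4 = g x ^+ 2 * g x ^+ 2 by rewrite -exprD.
  rewrite -(real_normK (num_real (g x))); move: `|g x| => u; rewrite !exprS expr0; lra.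
rewrite meanZ ?meanD ?g2//; last exact: L1D.
by have := g4; have := K1; move: (mean P _) => u; lra.
Qed.

(** The squares are clipped at [N], which makes their third moments finite at the
    price of the event, of probability [O(1 / N)], that some value exceeds
    [sqrt N]. *)
Let cg x : R := Num.min (g x ^+ 2) N.
Let mu := mean P cg.

Let mcg : measurable_fun setT cg.
Proof. by apply: measurable_minr => //; exact: measurable_funX. Qed.
Let cg0 x : 0 <= cg x. Proof. by rewrite le_min sqr_ge0 ltW. Qed.
Let cgN x : cg x <= N. Proof. by rewrite ge_min lexx orbT. Qed.
Let cg_le x : cg x <= g x ^+ 2. Proof. by rewrite ge_min lexx. Qed.
Let cgi : L1fun P cg.
Proof. by apply: (@L1_bounded _ _ _ _ _ N) => // x; rewrite ger0_norm. Qed.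
Let cg2_le x : cg x ^+ 2 <= g x ^+ 4.
Proof. by rewrite (_ : 4%N = (2 * 2)%N)// exprM ler_pXn2r ?nnegrE ?sqr_ge0. Qed.
Let cg2i : L1fun P (fun x => cg x ^+ 2).
Proof.
apply: le_L1 g4i _ => [|x]; first exact: measurable_funX.
by rewrite ger0_norm ?sqr_ge0.
Qed.
Let cg2 : mean P (fun x => cg x ^+ 2) <= K.
Proof. by apply: le_trans g4; exact: le_mean. Qed.
Let mu0 : 0 <= mu. Proof. exact: mean_ge0. Qed.
Let mu_le1 : mu <= 1. Proof. by rewrite -g2; exact: le_mean. Qed.

Let mu_near : `|mu - 1| <= K * del.
Proof.
rewrite distrC ger0_norm ?subr_ge0// -g2 -meanB//.
apply: (@le_trans _ _ (mean P (fun x => N^-1 * g x ^+ 4))).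
  apply: le_mean; [exact: L1B|exact: L1Z|move=> x].
  rewrite /cg; case: (leP (g x ^+ 2) N) => h; first by rewrite subrr mulr_ge0 ?invr_ge0 ?(ltW N0)// exprn_even_ge0.
  apply: (@le_trans _ _ (g x ^+ 2)); first by rewrite gerBl ltW.
  rewrite mulrC ler_pdivlMr// (_ : g x ^+ 4 = g x ^+ 2 * g x ^+ 2); last by rewrite -exprD.
  by rewrite ler_wpM2l ?sqr_ge0// ltW.
rewrite meanZ// mulrC; apply: ler_pM => //; first by apply: mean_ge0 => x; rewrite exprn_even_ge0.
by rewrite invr_ge0 ltW.
Qed.

Let cmi : L1fun P (fun x => cg x - mu). Proof. by apply: L1B => //; exact: L1_cst. Qed.
Let cm2i : L1fun P (fun x => (cg x - mu) ^+ 2).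
Proof.
rewrite (_ : (fun _ => _) = fun x => cg x ^+ 2 - 2 * mu * cg x + mu ^+ 2).
  by apply: L1D; [apply: L1B => //; exact: L1Z|exact: L1_cst].
by apply/funext => x; ring.
Qed.
Let cm0 : mean P (fun x => cg x - mu) = 0.
Proof. by rewrite meanB ?mean_cst ?subrr//; exact: L1_cst. Qed.
Let cm2 : mean P (fun x => (cg x - mu) ^+ 2) <= K.
Proof.
rewrite (eq_mean _ (g := fun x => cg x ^+ 2 - 2 * mu * cg x + mu ^+ 2)); last by move=> x; ring.
rewrite meanD; [|by apply: L1B => //; exact: L1Z|exact: L1_cst].
rewrite mean_cst meanB//; last exact: L1Z.
rewrite meanZ// -/mu; have := sqr_ge0 mu; have := cg2; rewrite expr2; lra.
Qed.

Let Tn (t : n.+1.-tuple T) : R := studentT (fun i => g (tnth t i)).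
Let S (t : n.+1.-tuple T) : R := tsum g t / r.
Let q (t : n.+1.-tuple T) : R := tsum (fun x => g x ^+ 2) t / N - S t ^+ 2 / N.
(** The mean of the clipped squares; outside of [bad] it is the second moment of the sample. *)
Let V (t : n.+1.-tuple T) : R := tsum cg t / N.

Let TE t : Tn t = S t / Num.sqrt (q t). Proof. exact: studentTE. Qed.

Let q_ge0 t : 0 <= q t.
Proof.
rewrite /q /S expr_div_n -rr; set m := tsum g t.
suff : 0 <= \sum_(i < n.+1) (g (tnth t i) - m / N) ^+ 2.
  under eq_bigr do rewrite sqrrB.
  rewrite big_split/= sumrB sumr_const card_ord -mulr_natl -/N sumrMnl -mulr_suml.
  rewrite -/(tsum g t) -/m -/(tsum (fun x => g x ^+ 2) t) => h.
  rewrite -mulrBl divr_ge0 ?(ltW N0)//.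
  have e : N * (m / N) ^+ 2 = m ^+ 2 / N by field; rewrite gt_eqF.
  move: h; rewrite e (_ : m * (m / N) *+ 2 = 2 * (m ^+ 2 / N)); last by ring.
  by move: (m ^+ 2 / N) => u; lra.
by apply: sumr_ge0 => i _; exact: sqr_ge0.
Qed.

Let mTn : measurable_fun setT Tn.
Proof.
by apply: measurable_studentT => i; exact: (measurableT_comp mg (measurable_tnth i)).
Qed.

Let mle (f : n.+1.-tuple T -> R) (a : R) : measurable_fun setT f -> measurable [set t | f t <= a].
Proof. by move=> mf; exact: measurable_le_set. Qed.

Let mge (f : n.+1.-tuple T -> R) (a : R) : measurable_fun setT f -> measurable [set t | a <= f t].
Proof. by move=> mf; exact: measurable_le_set. Qed.

(** Outside of this event no square has been clipped, and [q] is within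
    [O(sqrt del)] of [1], so that the error of the linearisation is [O(del)]. *)
Let bad : set (n.+1.-tuple T) :=
  [set t | N ^+ 2 <= tsum (fun x => g x ^+ 4) t] `|`
  ([set t | r <= S t ^+ 2] `|` [set t | del <= (V t - mu) ^+ 2]).

Let ctsum t : tsum (fun x => cg x - mu) t = N * (V t - mu).
Proof.
rewrite /tsum sumrB sumr_const card_ord -mulr_natl -/N -/(tsum cg t) /V.
by field; rewrite gt_eqF.
Qed.

Let mbad : measurable bad.
Proof.
apply: measurableU; [|apply: measurableU]; apply: mge.
- by apply: measurable_tsum; exact: measurable_funX.
- by apply: measurable_funX; apply: measurable_funM => //; exact: measurable_tsum.
- apply: measurable_funX; apply: measurable_funB => //; apply: measurable_funM => //.
  exact: measurable_tsum.
Qed.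

Let bad_le : prob (iid_law P n.+1) bad <= (2 * K + 1) * del.
Proof.
have m1 : measurable [set t : n.+1.-tuple T | N ^+ 2 <= tsum (fun x => g x ^+ 4) t].
  by apply: mge; apply: measurable_tsum; exact: measurable_funX.
have m2 : measurable [set t | r <= S t ^+ 2].
  by apply: mge; apply: measurable_funX; apply: measurable_funM => //; exact: measurable_tsum.
have m3 : measurable [set t | del <= (V t - mu) ^+ 2].
  apply: mge; apply: measurable_funX; apply: measurable_funB => //; apply: measurable_funM => //.
  exact: measurable_tsum.
(* by Markov's inequality for the sum of the fourth powers *)
have p1 : prob (iid_law P n.+1) [set t : n.+1.-tuple T | N ^+ 2 <= tsum (fun x => g x ^+ 4) t] <= K * del.
  apply: le_trans (markov_mean _ (L1_tsum n.+1 g4i) _) _.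
  - by rewrite exprn_gt0.
  - by move=> t; apply: sumr_ge0 => i _; rewrite exprn_even_ge0.
  rewrite mean_tsum// -/N expr2 invfM mulrA [N * _]mulrC mulfK ?gt_eqF//.
  by apply: ler_pM => //; [apply: mean_ge0 => x; rewrite exprn_even_ge0|rewrite invr_ge0 ltW].
(* by Markov's inequality for the square of the sum *)
have p2 : prob (iid_law P n.+1) [set t | r <= S t ^+ 2] <= del.
  have i2 := L1_tsum_sqr n.+1 gi g2i.
  have iS : L1fun (iid_law P n.+1) (fun t => S t ^+ 2).
    rewrite (_ : (fun _ => _) = fun t => N^-1 * tsum g t ^+ 2); first exact: L1Z.
    by apply/funext => t; rewrite /S expr_div_n -rr mulrC.
  apply: le_trans (markov_mean r0 iS _) _; first by move=> t; exact: sqr_ge0.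
  rewrite (eq_mean _ (g := fun t => N^-1 * tsum g t ^+ 2)); last first.
    by move=> t; rewrite /S expr_div_n -rr mulrC.
  by rewrite meanZ// mean_tsum_sqr// g2 mulr1 mulVf ?gt_eqF// mul1r.
(* by Chebyshev's inequality for the clipped squares *)
have p3 : prob (iid_law P n.+1) [set t | del <= (V t - mu) ^+ 2] <= K * del.
  have i2 := L1_tsum_sqr n.+1 cmi cm2i.
  have e t : (V t - mu) ^+ 2 = N ^- 2 * tsum (fun x => cg x - mu) t ^+ 2.
    by rewrite ctsum; field; rewrite gt_eqF.
  have iV : L1fun (iid_law P n.+1) (fun t => (V t - mu) ^+ 2).
    by rewrite (funext e); exact: L1Z.
  apply: le_trans (markov_mean del0 iV _) _; first by move=> t; exact: sqr_ge0.
  rewrite (eq_mean _ e) meanZ// mean_tsum_sqr// -/N.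
  rewrite ler_pdivrMr// -mulrA -expr2 -del2 mulrA.
  have -> : N ^- 2 * N = N^-1 by field; rewrite gt_eqF.
  by rewrite mulrC ler_wpM2r// invr_ge0 ltW.
apply: le_trans (prob_setU _ m1 (measurableU _ _ m2 m3)) _.
by have := prob_setU (iid_law P n.+1) m2 m3; lra.
Qed.

Let K2 : R := (7 + K + 3 * K ^+ 2) / 2.
Let A : R := 2 * K2 + 4 * K.

Let K2_ge0 : 0 <= K2.
Proof. by rewrite /K2; have := sqr_ge0 K; have := K1; lra. Qed.
Let A_ge4K : 4 * K <= A.
Proof. by rewrite /A; have := K2_ge0; lra. Qed.

Section moderate_threshold.
Variable z : R.
Hypotheses (hz : z ^+ 4 * del <= 1) (K_small : 3 * (2 + K ^+ 2) * del < 1)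
  (A_small : A * (1 + `|z|) * del <= 2^-1).

Let e : R := `|z| * del.
Let e_ge0 : 0 <= e. Proof. by rewrite mulr_ge0// ltW. Qed.

Let Ke_small : 8 * (K * e) <= 1.
Proof.
have h1 : 4 * K * e <= A * e by exact: ler_wpM2r.
have h2 : 0 <= A * del.
  by apply: mulr_ge0; [have := K1; have := A_ge4K; lra|exact: ltW].
by have := A_small; rewrite mulrDr mulr1 mulrDl -mulrA -/e; lra.
Qed.

Let e_small : 8 * e <= 1.
Proof.
have : 1 * e <= K * e by exact: ler_wpM2r.
by have := Ke_small; lra.
Qed.

Let b : R := z * del / 2.
Let b_norm : `|b| = e / 2.
Proof. by rewrite /b !normrM (gtr0_norm del0) normfV (@ger0_norm _ 2). Qed.

(** Up to the factor [k] below, the summand of the linearised statistic: its sum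
    over the sample, divided by [r], is [S t - z / 2 * (V t - mu)]. *)
Let a x : R := g x - b * (cg x - mu).

Let ai : L1fun P a. Proof. by apply: L1B => //; exact: L1Z. Qed.
Let gci : L1fun P (fun x => g x * cg x).
Proof. by apply: (@L1M_bounded _ _ _ _ _ _ N) => // x; rewrite ger0_norm. Qed.
Let gcmi : L1fun P (fun x => g x * (cg x - mu)).
Proof.
rewrite (_ : (fun _ => _) = fun x => g x * cg x - mu * g x).
  by apply: L1B => //; exact: L1Z.
by apply/funext => x; ring.
Qed.

Let gcm_le : `|mean P (fun x => g x * (cg x - mu))| <= K.
Proof.
rewrite (eq_mean _ (g := fun x => g x * cg x - mu * g x)); last by move=> x; ring.
rewrite meanB ?meanZ ?g0 ?mulr0 ?subr0//; last exact: L1Z.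
apply: le_trans (ler_norm_mean gci) _; apply: le_trans g3; apply: le_mean => //.
  exact: L1_norm.
move=> x; rewrite normrM (ger0_norm (cg0 x)) exprS real_normK ?num_real//.
by rewrite ler_wpM2l.
Qed.

Let a2E x : a x ^+ 2 =
  g x ^+ 2 - 2 * b * (g x * (cg x - mu)) + b ^+ 2 * (cg x - mu) ^+ 2.
Proof. by rewrite /a; ring. Qed.

Let a2i : L1fun P (fun x => a x ^+ 2).
Proof.
rewrite (funext a2E); apply: L1D; last exact: L1Z.
by apply: L1B => //; exact: L1Z.
Qed.

Let v : R := mean P (fun x => a x ^+ 2).

(** The correction has size [e = |z| / sqrt N], and so has its effect on the
    variance. *)
Let v_near1 : `|v - 1| <= 2 * (K * e).
Proof.
have i1 := L1Z (2 * b) gcmi; have i2 := L1Z (b ^+ 2) cm2i.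
have -> : v - 1 = - (2 * b * mean P (fun x => g x * (cg x - mu))) +
    b ^+ 2 * mean P (fun x => (cg x - mu) ^+ 2).
  rewrite /v (eq_mean _ a2E) (meanD (L1B g2i i1) i2) (meanB g2i i1).
  by rewrite (meanZ _ gcmi) (meanZ _ cm2i) g2; ring.
have m0 : 0 <= mean P (fun x => (cg x - mu) ^+ 2).
  by apply: mean_ge0 => x; exact: sqr_ge0.
apply: (le_trans (ler_normD _ _)).
rewrite normrN (normrM (2 * b)) (normrM 2 b) (normrM (b ^+ 2)) (normrX 2 b).
rewrite b_norm (ger0_norm m0) (@ger0_norm _ 2)//.
have h1 := ler_wpM2l e_ge0 gcm_le.
have h2 := ler_wpM2l (sqr_ge0 (e / 2)) cm2.
have Ke0 : 0 <= e * K by apply: mulr_ge0 => //; have := K1; lra.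
have e1 : e <= 1 by have := e_ge0; have := e_small; lra.
have h3 : e * (e * K) <= e * K by exact: ler_piMl.
move: h1 h2 h3 Ke0; move: (mean P _) (`|mean P _|) => m m'.
by rewrite !expr2; lra.
Qed.

Let v_ge_half : 2^-1 <= v.
Proof. by have := v_near1; rewrite ler_norml => /andP[h _]; have := Ke_small; lra. Qed.

Let s : R := Num.sqrt v.
Let v0 : 0 < v. Proof. by have := v_ge_half; lra. Qed.
Let s0 : 0 < s. Proof. by rewrite sqrtr_gt0. Qed.
Let ss : v = s ^+ 2. Proof. by rewrite sqr_sqrtr// ltW. Qed.

Let s_ge_half : 2^-1 <= s.
Proof.
rewrite -(@ler_pXn2r _ 2)// ?nnegrE ?invr_ge0 ?(ltW s0)// -ss.
by apply: le_trans v_ge_half; lra.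
Qed.

Let s_near1 : `|1 - s| <= 2 * (K * e).
Proof.
apply: le_trans v_near1; rewrite distrC ss.
have -> : s ^+ 2 - 1 = (s - 1) * (s + 1) by ring.
by rewrite normrM ler_peMr// ger0_norm; have := s0; lra.
Qed.

(** The third moment of a clipped square may be as large as [N]; the factor
    [|z| ^ 3 / N ^ (3 / 2)] compensates for it as long as [z ^ 4 <= sqrt N]. *)
Let b3_le : `|b| ^+ 3 * N <= 4^-1.
Proof.
rewrite b_norm (_ : (e / 2) ^+ 3 * N = `|z| ^+ 3 * del / 8); last first.
  by rewrite /e /del rr; field; rewrite gt_eqF.
have [_ _ h] := pow_le z.
have : `|z| ^+ 3 * del <= (1 + z ^+ 4) * del by rewrite ler_wpM2r// ltW.
by have := del1; have := hz; lra.
Qed.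

Let cm3_le x : `|cg x - mu| ^+ 3 <= N * g x ^+ 4 + 1.
Proof.
have [h|/ltW h] := leP mu (cg x).
  rewrite ger0_norm ?subr_ge0//.
  apply: (@le_trans _ _ (cg x ^+ 3)).
    by rewrite ler_pXn2r// ?nnegrE ?subr_ge0// gerBl.
  apply: (@le_trans _ _ (N * g x ^+ 4)); last by rewrite lerDl.
  by rewrite exprS; apply: ler_pM => //; exact: sqr_ge0.
rewrite distrC ger0_norm ?subr_ge0//.
apply: (@le_trans _ _ 1).
  by rewrite exprn_ile1 ?subr_ge0//; have := cg0 x; have := mu_le1; lra.
by rewrite lerDr mulr_ge0 ?(ltW N0)// exprn_even_ge0.
Qed.

Let a3_le x : `|a x| ^+ 3 <= 4 * `|g x| ^+ 3 + (1 + g x ^+ 4).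
Proof.
have b3 : `|b| ^+ 3 <= 4^-1.
  by apply: le_trans b3_le; rewrite ler_peMr// exprn_ge0.
have h4 : `|b * (cg x - mu)| ^+ 3 <= 4^-1 * (1 + g x ^+ 4).
  rewrite normrM exprMn.
  apply: (@le_trans _ _ (`|b| ^+ 3 * (N * g x ^+ 4 + 1))).
    by rewrite ler_wpM2l// exprn_ge0.
  have : `|b| ^+ 3 * N * g x ^+ 4 <= 4^-1 * g x ^+ 4 by rewrite ler_wpM2r// exprn_even_ge0.
  by move: b3; lra.
apply: (le_trans (ler_norm_sub_cube _ _)).
by move: h4; lra.
Qed.

Let a3i : L1fun P (fun x => `|a x| ^+ 3).
Proof.
have i : L1fun P (fun x => 4 * `|g x| ^+ 3 + (1 + g x ^+ 4)).
  by apply: L1D => //; exact: L1Z.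
apply: le_L1 i _ => [|x]; last by rewrite ger0_norm ?exprn_ge0.
apply: measurable_funX; apply: (measurableT_comp (@normr_measurable R setT)).
exact: L1_measurable ai.
Qed.

Let a3_mean : mean P (fun x => `|a x| ^+ 3) <= 6 * K.
Proof.
have i : L1fun P (fun x => 4 * `|g x| ^+ 3) by exact: L1Z.
apply: le_trans (le_mean a3i (L1D i i14) a3_le) _.
rewrite (meanD i i14) (meanZ _ g3i) (meanD (L1_cst P 1) g4i) mean_cst.
by have := g3; have := g4; have := K1; lra.
Qed.

Let k : R := (r * s)^-1.
Let k0 : 0 < k. Proof. by rewrite invr_gt0 mulr_gt0. Qed.
Let h x : R := k * a x.

Let mh : measurable_fun setT h.
Proof. by apply: measurable_funM => //; exact: L1_measurable ai. Qed.

(** The sum of [h] is the linearised statistic, normalised to variance [1]. *)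
Let berry_esseen_h u : `|prob (iid_law P n.+1) [set t | tsum h t <= u] - ncdf u| <=
  (34 + 2 * stein_ub) * (48 * K * del).
Proof.
have e2 x : h x ^+ 2 = k ^+ 2 * a x ^+ 2 by rewrite exprMn.
have e3 x : `|h x| ^+ 3 = k ^+ 3 * `|a x| ^+ 3 by rewrite normrM exprMn (gtr0_norm k0).
have i1 : L1fun P h by exact: L1Z.
have i2 : L1fun P (fun x => h x ^+ 2) by rewrite (funext e2); exact: L1Z.
have i3 : L1fun P (fun x => `|h x| ^+ 3) by rewrite (funext e3); exact: L1Z.
have m1 : mean P h = 0.
  rewrite (meanZ k ai) (meanB gi (L1Z b cmi)) (meanZ b cmi) g0 cm0.
  by rewrite mulr0 subr0 mulr0.
have m2 : n.+1%:R * mean P (fun x => h x ^+ 2) = 1.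
  rewrite (eq_mean _ e2) (meanZ _ a2i) -/v -/N ss rr /k; field.
  by rewrite !gt_eqF.
apply: (le_trans (berry_esseen_iid i1 i2 i3 m1 m2 u)).
apply: ler_wpM2l; first by have := @stein_ub_ge1 R; lra.
rewrite (eq_mean _ e3) (meanZ _ a3i) -/N.
have -> : N * (k ^+ 3 * mean P (fun x => `|a x| ^+ 3)) =
    del * (s ^- 3 * mean P (fun x => `|a x| ^+ 3)).
  by rewrite rr /k /del; field; rewrite !gt_eqF.
rewrite [leRHS]mulrC ler_wpM2l ?(ltW del0)//.
rewrite mulrC ler_pdivrMr ?exprn_gt0//; apply: (le_trans a3_mean).
have h1 : 2^-1 ^+ 3 <= s ^+ 3 by rewrite ler_pXn2r// nnegrE ?invr_ge0// ltW.
have k48 : 0 <= 48 * K by have := K1; lra.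
have := ler_wpM2l k48 h1; rewrite !exprS !expr0; move: (s * _) => u3.
by lra.
Qed.

Let tsum_hE t : tsum h t = (S t - z / 2 * (V t - mu)) / s.
Proof.
have -> : tsum h t = k * (tsum g t - b * tsum (fun x => cg x - mu) t).
  by rewrite /tsum mulr_sumr -sumrB mulr_sumr.
rewrite ctsum /S /k /b /del rr; field.
by rewrite !gt_eqF.
Qed.

(** The threshold for the sum of [h], with the linearisation error on either side
    according to the sign [sg]. *)
Let w (sg : R) : R := (z + sg * (`|z| * (K2 * del))) / s.

(** The threshold moves by the linearisation error and by the normalisation [s],
    both at most proportional to [|z| * (1 + |z|) * del]. *)
Let w_near (sg : R) : `|sg| = 1 ->
  `|ncdf (w sg) - ncdf z| <= 12 * normal_peak 1 * (A * del).
Proof.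
move=> sg1.
have Adel : 0 <= A * del.
  by apply: mulr_ge0; [have := K1; have := A_ge4K; lra|exact: ltW].
have wz : `|w sg - z| <= `|z| * (A * (1 + `|z|) * del).
  have -> : w sg - z = (sg * (`|z| * (K2 * del)) + z * (1 - s)) / s.
    by rewrite /w; field; rewrite gt_eqF.
  rewrite normrM normfV (gtr0_norm s0) ler_pdivrMr//.
  have e0 : `|sg * (`|z| * (K2 * del))| = `|z| * (K2 * del).
    rewrite normrM sg1 mul1r ger0_norm//.
    by apply: mulr_ge0 => //; apply: mulr_ge0 => //; exact: ltW.
  apply: (le_trans (ler_normD _ _)); rewrite e0 (normrM z).
  have h1 := ler_wpM2l (normr_ge0 z) s_near1.
  have h2 : `|z| * (A * (1 + `|z|) * del) * 2^-1 <= `|z| * (A * (1 + `|z|) * del) * s.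
    apply: ler_wpM2l s_ge_half; apply: mulr_ge0 => //.
    by rewrite mulrAC; apply: mulr_ge0 => //; have := normr_ge0 z; lra.
  apply: le_trans h2.
  have h3 : 0 <= `|z| * (K2 * e) by apply: mulr_ge0 => //; exact: mulr_ge0.
  have h4 : 0 <= `|z| * (K * del).
    by apply: mulr_ge0 => //; apply: mulr_ge0; [have := K1; lra|exact: ltW].
  move: h1 h3 h4; rewrite /A /e; move: K2 `|1 - s| => k2 u; lra.
apply: ncdf_perturb => //.
- by apply: (le_trans wz); exact: ler_wpM2l.
- by apply: (le_trans wz); rewrite le_eqVlt; apply/orP; left; apply/eqP; ring.
Qed.

Let good t : ~ bad t -> 0 < q t /\
  `|z * Num.sqrt (q t) - (z + z / 2 * (V t - mu))| <= `|z| * (K2 * del).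
Proof.
move=> /not_orP[/negP + /not_orP[/negP + /negP +]]; rewrite -!ltNge => b1 b2 b3.
have cE i : cg (tnth t i) = g (tnth t i) ^+ 2.
  rewrite /cg; apply/min_idPl.
  rewrite -(@ler_pXn2r _ 2)// ?nnegrE ?sqr_ge0 ?(ltW N0)// -exprM.
  apply: le_trans (ltW b1); rewrite /tsum (bigD1 i)//= lerDl sumr_ge0// => j _.
  by rewrite exprn_even_ge0.
have VE : V t = tsum (fun x => g x ^+ 2) t / N.
  by rewrite /V /tsum; congr (_ / _); apply: eq_bigr => i _; exact: cE.
apply: (@student_linear _ (S t ^+ 2 / N)) => //.
- by rewrite (ltW del0) del1.
- by have := K1; lra.
- by rewrite /q -VE; ring.
- rewrite divr_ge0 ?sqr_ge0 ?(ltW N0)//=.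
  by rewrite del2 expr2 mulrA ler_piMl ?(ltW del0)// ler_pdivrMr// mul1r ltW.
- exact: ltW.
Qed.

Let mTz : measurable [set t | Tn t <= z]. Proof. exact: mle. Qed.
Let mh_le u : measurable [set t : n.+1.-tuple T | tsum h t <= u].
Proof. by apply: mle; exact: measurable_tsum. Qed.

Let Tn_upper : prob (iid_law P n.+1) [set t | Tn t <= z] <=
  prob (iid_law P n.+1) [set t | tsum h t <= w 1] + prob (iid_law P n.+1) bad.
Proof.
apply: le_trans (prob_setU _ (mh_le _) mbad); apply: le_prob => //; first exact: measurableU.
move=> t /= Tz; have [bt|/good[q0 hq]] := pselect (bad t); [by right|left].
move: Tz; rewrite TE student_le// => Tz.
rewrite /= tsum_hE /w ler_pM2r ?invr_gt0// mul1r.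
by move: hq; rewrite ler_norml => /andP[_ +]; move: Tz; lra.
Qed.

Let Tn_lower : prob (iid_law P n.+1) [set t | tsum h t <= w (-1)] <=
  prob (iid_law P n.+1) [set t | Tn t <= z] + prob (iid_law P n.+1) bad.
Proof.
apply: le_trans (prob_setU _ mTz mbad); apply: le_prob => //; first exact: measurableU.
move=> t /= hz'; have [bt|/good[q0 hq]] := pselect (bad t); [by right|left].
rewrite /= TE student_le//.
move: hz'; rewrite /= tsum_hE /w ler_pM2r ?invr_gt0// mulN1r.
by move: hq; rewrite ler_norml => /andP[+ _]; lra.
Qed.

(** Outside of [bad], Student's event lies between two events about the sum of
    [h]. The classical bound gives their probabilities up to [O(del)], and
    [w_near] compares their thresholds with [z]. *)
Lemma student_berry_esseen_moderate :
  `|prob (iid_law P n.+1) [set t | Tn t <= z] - ncdf z| <=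
    ((34 + 2 * stein_ub) * (48 * K) + 12 * normal_peak 1 * A + (2 * K + 1)) * del.
Proof.
have := @w_near 1; rewrite normr1 => /(_ erefl); have := @w_near (-1).
rewrite normrN1 => /(_ erefl); have := berry_esseen_h (w 1); have := berry_esseen_h (w (-1)).
have := bad_le; have := Tn_upper; have := Tn_lower.
move: (prob _ _) (prob _ _) (prob _ bad) (prob _ _) (ncdf (w 1)) (ncdf (w (-1))) (ncdf z).
move: (normal_peak 1) stein_ub A => pk c A'; move=> p1 p2 p3 p4 f1 f2 f3.
move=> low up bl; rewrite !ler_norml => /andP[h1 h2] /andP[h3 h4] /andP[h5 h6] /andP[h7 h8].
apply/andP; split; move: up low bl h1 h2 h3 h4 h5 h6 h7 h8; lra.
Qed.

End moderate_threshold.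
End student_moderate.

(** For [z ^ 4 <= sqrt n] the statistic is linearised. Beyond that range both
    distribution functions are within [O(1 / sqrt n)] of [0] or [1]: for the normal
    one by its tail bound and for the statistic by monotonicity, from its value at
    the threshold [z0] with [z0 ^ 4 = sqrt n]. For the finitely many [n] that are too
    small for the estimates, the constant makes the bound trivial. *)
Theorem student_berry_esseen (R : realType) (K : R) : 1 <= K ->
  exists2 C : R, 0 < C & forall d (T : measurableType d) (P : probability T R)
    (g : T -> R) (n : nat) (z : R),
    measurable_fun setT g -> L1fun P (fun x => g x ^+ 4) -> mean P g = 0 ->
    mean P (fun x => g x ^+ 2) = 1 -> mean P (fun x => g x ^+ 4) <= K ->
    `|prob (iid_law P n.+1) [set t | studentT (fun i => g (tnth t i)) <= z] - ncdf z| <=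
      C / Num.sqrt n.+1%:R.
Proof.
move=> K1; have [Kt Kt0 tail] := @ncdf_tail R.
have k0 := @npeak_gt0 R; have c0 := @stein_ub_ge1 R.
pose A : R := 2 * ((7 + K + 3 * K ^+ 2) / 2) + 4 * K.
pose C1 : R := (34 + 2 * @stein_ub R) * (48 * K) + 12 * normal_peak 1 * A + (2 * K + 1).
have K20 := sqr_ge0 K.
have A1 : 1 <= A by rewrite /A; lra.
have A3 : 3 * (2 + K ^+ 2) <= A by rewrite /A; lra.
have C10 : 0 < C1.
  rewrite /C1 addr_gt0//; last by lra.
  by rewrite addr_gt0// !mulr_gt0//; lra.
pose e := (2 * A)^-1; have e0 : 0 < e by rewrite invr_gt0; lra.
have eA : A * e = 2^-1 by rewrite /e; field; lra.
have e1 : e <= 1 by rewrite /e invf_le1; lra.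
(* [del <= d0] and [u ^ 4 * del <= 1] force [|u| * del <= e / 2], because
   [(2 * |u| * del) ^ 4 <= 16 * del ^ 3] *)
pose d0 := e ^+ 4 / 16; have d00 : 0 < d0 by rewrite divr_gt0 ?exprn_gt0.
have d0e : 16 * d0 <= e.
  rewrite /d0 mulrC divfK ?gt_eqF// exprS ler_piMr ?(ltW e0)//.
  by apply: exprn_ile1 => //; exact: ltW.
exists (C1 + Kt + d0^-1); first by have : 0 < d0^-1 by [rewrite invr_gt0]; lra.
move=> d T P g n z mg g4i g0 g2 g4.
set Tn := fun t : n.+1.-tuple T => studentT (fun i => g (tnth t i)).
have mTn : measurable_fun setT Tn.
  by apply: measurable_studentT => i; exact: (measurableT_comp mg (measurable_tnth i)).
have mT u : measurable [set t | Tn t <= u].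
  exact: measurable_le_set.
pose F u := prob (iid_law P n.+1) [set t | Tn t <= u].
have F0 u : 0 <= F u by exact: prob_ge0.
have F1 u : F u <= 1 by exact: prob_le1.
have Fle u v : u <= v -> F u <= F v.
  by move=> uv; apply: le_prob => // t /= /le_trans; apply.
have P0 u := @ncdf_ge0 R u; have P1 u := @ncdf_le1 R u.
rewrite -/(F z).
pose r := Num.sqrt (n.+1%:R : R); pose del := r^-1.
have r1 : 1 <= r by rewrite -sqrtr1 ler_sqrt// ler1n.
have r0 : 0 < r by lra.
have del0 : 0 < del by rewrite invr_gt0.
have del1 : del <= 1 by rewrite invf_le1.
rewrite -/r -/del.
have dd0 : 0 <= d0^-1 * del by rewrite mulr_ge0 ?invr_ge0 ?ltW.
have Ktd : 0 <= Kt * del by rewrite mulr_ge0// ltW.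
have C1d : 0 <= C1 * del by rewrite mulr_ge0// ltW.
have [sm|big] := leP del d0; last first.
  apply: (@le_trans _ _ 1).
    by have := F0 z; have := F1 z; have := P0 z; have := P1 z; rewrite ler_norml; lra.
  have : 1 <= d0^-1 * del by rewrite mulrC ler_pdivlMr// mul1r ltW.
  by lra.
have small u : u ^+ 4 * del <= 1 -> `|F u - ncdf u| <= C1 * del.
  move=> ud; apply: student_berry_esseen_moderate => //.
  - have : 3 * (2 + K ^+ 2) * del <= A * del by rewrite ler_wpM2r// ltW.
    have : A * del <= A * e by rewrite ler_wpM2l; lra.
    by rewrite -/r -/del; lra.
  - rewrite -/A -/r -/del -mulrA -eA ler_wpM2l//; first by lra.
    have [u1|u1] := leP `|u| 1.
      by have : `|u| * del <= 1 * del by [rewrite ler_wpM2r// ltW]; lra.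
    have : (2 * (`|u| * del)) ^+ 4 <= e ^+ 4.
      have -> : (2 * (`|u| * del)) ^+ 4 = 16 * (`|u| ^+ 4 * del * del ^+ 3) by ring.
      have -> : `|u| ^+ 4 = u ^+ 4 by rewrite (_ : 4%N = (2 * 2)%N)// !exprM real_normK ?num_real.
      have -> : e ^+ 4 = 16 * d0 by rewrite /d0 mulrC divfK// gt_eqF.
      rewrite ler_pM2l//; apply: le_trans sm.
      apply: (@le_trans _ _ (1 * del ^+ 3)); first by rewrite ler_wpM2r// exprn_ge0// ltW.
      by rewrite mul1r exprS ler_piMr ?(ltW del0)//; apply: exprn_ile1 => //; exact: ltW.
    have ud0 : 0 <= `|u| * del by rewrite mulr_ge0// ltW.
    rewrite ler_pXn2r// ?nnegrE ?(ltW e0)//; last by rewrite mulr_ge0.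
    move=> h; apply: le_trans h.
    by have : 1 * del <= `|u| * del by [rewrite ler_wpM2r// ltW]; lra.
have [/small h|h] := leP (z ^+ 4 * del) 1.
  by apply: (le_trans h); lra.
pose z0 := Num.sqrt (Num.sqrt r).
have z00 : 0 < z0 by rewrite !sqrtr_gt0.
have z04 : z0 ^+ 4 = r.
  by rewrite (_ : 4%N = (2 * 2)%N)// exprM !sqr_sqrtr ?sqrtr_ge0// ltW.
have z0d : z0 ^+ 4 * del = 1 by rewrite z04 mulfV// gt_eqF.
have zz0 : z0 < `|z|.
  rewrite -(@ltr_pXn2r _ 4)// ?nnegrE ?(ltW z00)// z04.
  have -> : `|z| ^+ 4 = z ^+ 4 by rewrite (_ : 4%N = (2 * 2)%N)// !exprM real_normK ?num_real.
  by move: h; rewrite ltr_pdivlMr// mul1r.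
have [t1 t2] := tail z0 z00.
have {}t1 : 1 - ncdf z0 <= Kt * del by rewrite ler_pdivlMr// mulrC -z04.
have {}t2 : ncdf (- z0) <= Kt * del by rewrite ler_pdivlMr// mulrC -z04.
have s1 : `|F z0 - ncdf z0| <= C1 * del by apply: small; rewrite z0d.
have s2 : `|F (- z0) - ncdf (- z0)| <= C1 * del.
  by apply: small; rewrite exprNn -signr_odd mul1r z0d.
have [zp|zn] := leP 0 z.
  rewrite ger0_norm// in zz0.
  have := Fle _ _ (ltW zz0); have := ncdf_le (ltW zz0); have := F1 z; have := P1 z.
  by move: s1; rewrite !ler_norml; lra.
rewrite ltr0_norm// in zz0; have {}zz0 : z <= - z0 by lra.
have := Fle _ _ zz0; have := ncdf_le zz0; have := F0 z; have := P0 z.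
by move: s2; rewrite !ler_norml; lra.
Qed.

(** * Moments of quadratic forms *)

Section cauchy_schwarz.
Context {R : realType} {d} {T : measurableType d} (P : probability T R).

Lemma cauchy_schwarz_mean (u v : T -> R) :
  L1fun P (fun x => u x ^+ 2) -> L1fun P (fun x => v x ^+ 2) ->
  L1fun P (fun x => u x * v x) ->
  mean P (fun x => u x * v x) ^+ 2 <=
    mean P (fun x => u x ^+ 2) * mean P (fun x => v x ^+ 2).
Proof.
move=> u2 v2 uv; set W := mean P (fun x => u x * v x).
set U := mean P (fun x => u x ^+ 2); set V := mean P (fun x => v x ^+ 2).
have U0 : 0 <= U by apply: mean_ge0 => x; exact: sqr_ge0.
have q t : 0 <= t ^+ 2 * U - 2 * t * W + V.
  have <- : mean P (fun x => (t * u x - v x) ^+ 2) = t ^+ 2 * U - 2 * t * W + V.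
    rewrite (eq_mean _ (g := fun x => t ^+ 2 * u x ^+ 2 - 2 * t * (u x * v x) + v x ^+ 2)).
      rewrite meanD//; last by apply: L1B; exact: L1Z.
      by rewrite meanB ?meanZ//; exact: L1Z.
    by move=> x; ring.
  by apply: mean_ge0 => x; exact: sqr_ge0.
have [U1|U1] := ltP 0 U.
  have := q (W / U); have -> : (W / U) ^+ 2 * U - 2 * (W / U) * W + V = V - W ^+ 2 / U.
    by field; rewrite gt_eqF.
  by rewrite subr_ge0 ler_pdivrMr// mulrC.
have {}U0 : U = 0 by apply: le_anti; rewrite U1.
have W0 : W = 0.
  apply/eqP; apply: contraT => W0; have := q ((V + 1) / (2 * W)).
  have -> : ((V + 1) / (2 * W)) ^+ 2 * U - 2 * ((V + 1) / (2 * W)) * W + V = -1.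
    by rewrite U0; field.
  by rewrite oppr_ge0 ler10.
by rewrite W0 U0 mul0r expr0n.
Qed.

(** One step of the induction for fourth moments: when [D] is a martingale
    increment over [F], the term [F ^ 3 * D] has mean zero, [F * D ^ 3] is split
    between its neighbours and [F ^ 2 * D ^ 2] is bounded by the Cauchy-Schwarz
    inequality. The constant [16] is chosen so that the bounds [sg] and [s] for the
    square roots of the fourth moments add up. *)
Lemma mean_pow4_step (F D : T -> R) (B sg s : R) :
  0 <= B -> 0 <= sg -> 0 <= s ->
  L1fun P (fun x => F x ^+ 4) -> L1fun P (fun x => D x ^+ 4) ->
  L1fun P (fun x => F x ^+ 3 * D x) -> L1fun P (fun x => F x ^+ 2 * D x ^+ 2) ->
  L1fun P (fun x => (F x + D x) ^+ 4) ->
  mean P (fun x => F x ^+ 3 * D x) = 0 ->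
  mean P (fun x => F x ^+ 4) <= 16 * B * sg ^+ 2 -> mean P (fun x => D x ^+ 4) <= B * s ^+ 2 ->
  mean P (fun x => (F x + D x) ^+ 4) <= 16 * B * (sg + s) ^+ 2.
Proof.
move=> B0 sg0 s0 F4 D4 F3D F2D2 FD4 m0 hF hD.
have sq (f : T -> R) x : (f x ^+ 2) ^+ 2 = f x ^+ 4 by rewrite -exprM.
have W4 : mean P (fun x => F x ^+ 2 * D x ^+ 2) <= 4 * B * sg * s.
  rewrite -(@ler_pXn2r _ 2)// ?nnegrE; last 2 first.
  - by apply: mean_ge0 => x; rewrite mulr_ge0 ?sqr_ge0.
  - by apply: mulr_ge0 => //; apply: mulr_ge0 => //; lra.
  apply: le_trans (cauchy_schwarz_mean _ _ F2D2) _.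
  - by rewrite (funext (sq F)).
  - by rewrite (funext (sq D)).
  rewrite (eq_mean _ (sq F)) (eq_mean _ (sq D)).
  have -> : (4 * B * sg * s) ^+ 2 = (16 * B * sg ^+ 2) * (B * s ^+ 2) by ring.
  by apply: ler_pM => //; apply: mean_ge0 => x; rewrite exprn_even_ge0.
pose G x := F x ^+ 4 + 4 * (F x ^+ 3 * D x) + (8 * (F x ^+ 2 * D x ^+ 2) + 3 * D x ^+ 4).
have a1 : L1fun P (fun x => F x ^+ 4 + 4 * (F x ^+ 3 * D x)) by apply: L1D => //; exact: L1Z.
have a2 : L1fun P (fun x => 8 * (F x ^+ 2 * D x ^+ 2) + 3 * D x ^+ 4).
  by apply: L1D => //; exact: L1Z.
apply: (@le_trans _ _ (mean P G)).
  apply: le_mean => //; first exact: L1D.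
  move=> x; rewrite /G; move: (F x) (D x) => u w.
  (* [4 * F * D ^ 3 <= 2 * F ^ 2 * D ^ 2 + 2 * D ^ 4] *)
  have : 0 <= w ^+ 2 * (u - w) ^+ 2 by rewrite mulr_ge0 ?sqr_ge0.
  by rewrite !exprS !expr0; lra.
rewrite meanD// meanD//; last exact: L1Z.
rewrite (meanZ _ F3D) m0 meanD; [|exact: L1Z..].
rewrite (meanZ _ F2D2) (meanZ _ D4).
have : 0 <= B * s ^+ 2 by rewrite mulr_ge0 ?sqr_ge0.
by move: hF hD W4; rewrite !expr2; lra.
Qed.

End cauchy_schwarz.

Section moments.
Context {R : realType} {d : nat} (P : probability (d.-tuple R) R).
Implicit Types (al be : 'I_d -> nat) (f g : d.-tuple R -> R).

Definition mono al (x : d.-tuple R) : R := \prod_i coord i x ^+ al i.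

Lemma measurable_coord i : measurable_fun setT (@coord R d i).
Proof. exact: measurable_tnth. Qed.

Lemma measurable_mono al : measurable_fun setT (mono al).
Proof.
by apply: measurable_prod => i _; apply: measurable_funX; exact: measurable_coord.
Qed.

(** A monomial of degree at most [8] is at most [M ^ 8], with [M] the largest of
    [1] and of the absolute values of the coordinates. *)
Lemma normr_mono_le al x : (\sum_i al i <= 8)%N ->
  `|mono al x| <= 1 + \sum_i coord i x ^+ 8.
Proof.
move=> al8; pose M : R := \big[Num.max/1]_i `|coord i x|.
have M1 : 1 <= M by exact: bigmax_ge_id.
have Mi i : `|coord i x| <= M by exact: le_bigmax.
have p8 (y : R) : y ^+ 8 = `|y| ^+ 8.
  by rewrite (_ : 8%N = (2 * 4)%N)// !exprM real_normK ?num_real.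
have M8 : M ^+ 8 <= 1 + \sum_i coord i x ^+ 8.
  have S0 : 0 <= \sum_i coord i x ^+ 8.
    by apply: sumr_ge0 => i _; rewrite p8 exprn_ge0.
  rewrite /M; elim/big_ind: _ => [|a b ha hb|i _].
  - by rewrite expr1n lerDl.
  - by rewrite /Num.max; case: ifP.
  - rewrite -p8 (bigD1 i)//= addrCA lerDl addr_ge0// sumr_ge0// => j _.
    by rewrite p8 exprn_ge0.
apply: le_trans M8; apply: (@le_trans _ _ (M ^+ \sum_i al i)).
  rewrite normr_prod expr_sum; apply: ler_prod => i _.
  by rewrite normr_ge0 normrX /=; apply: lerXn2r => //; rewrite nnegrE (le_trans ler01).
exact: ler_weXn2l.
Qed.

(** Polynomial functions of degree at most [m] in the first [k] coordinates, as
    combinations of monomials: this is the class of functions on which moments of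
    total degree at most [8] behave as under independence. *)
Inductive pol (k m : nat) : (d.-tuple R -> R) -> Prop :=
| pol_mono a al : (forall i : 'I_d, (k <= i)%N -> al i = 0%N) ->
    (\sum_i al i <= m)%N -> pol k m (fun x => a * mono al x)
| pol_add f g : pol k m f -> pol k m g -> pol k m (fun x => f x + g x).

Lemma eq_pol k m f g : f =1 g -> pol k m f -> pol k m g.
Proof. by move=> /funext ->. Qed.

Lemma pol_widen k m k' m' f : (k <= k')%N -> (m <= m')%N -> pol k m f -> pol k' m' f.
Proof.
move=> kk mm; elim=> [a al h1 h2|f1 f2 _ h1 _ h2]; last exact: pol_add.
apply: pol_mono; last exact: leq_trans mm.
by move=> i /(leq_trans kk); exact: h1.
Qed.

Lemma pol_mul k m m' f g : pol k m f -> pol k m' g -> pol k (m + m') (fun x => f x * g x).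
Proof.
elim=> [a al ha hm|f1 f2 _ h1 _ h2] pg; last first.
  by apply: (eq_pol _ (pol_add (h1 pg) (h2 pg))) => x; rewrite mulrDl.
elim: pg => [b be hb hm'|g1 g2 _ h1 _ h2]; last first.
  by apply: (eq_pol _ (pol_add h1 h2)) => x; rewrite mulrDr.
apply: (@eq_pol _ _ (fun x => a * b * mono (fun i => al i + be i)%N x)).
  move=> x; rewrite mulrACA; congr (_ * _); rewrite /mono -big_split/=.
  by apply: eq_bigr => i _; rewrite exprD.
apply: pol_mono => [i ki|]; first by rewrite ha// hb.
by rewrite big_split/= leq_add.
Qed.

Lemma pol_cst k m a : pol k m (fun=> a).
Proof.
apply: (@eq_pol _ _ (fun x => a * mono (fun=> 0%N) x)).
  by move=> x; rewrite /mono big1 ?mulr1// => i _; rewrite expr0.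
by apply: pol_mono => //; rewrite big1.
Qed.

Lemma pol_coord k (i : 'I_d) : (i < k)%N -> pol k 1 (coord i).
Proof.
move=> ik; apply: (@eq_pol _ _ (fun x => 1 * mono (fun j => (j == i) : nat) x)).
  move=> x; rewrite mul1r /mono (bigD1 i)//= eqxx expr1 big1 ?mulr1// => j /negbTE ->.
  by rewrite expr0.
apply: pol_mono => [j kj|].
  by case: eqP => // ji; move: kj; rewrite ji leqNgt ik.
by rewrite (bigD1 i)//= eqxx big1 ?addn0// => j /negbTE ->.
Qed.

Lemma pol_scale k m a f : pol k m f -> pol k m (fun x => a * f x).
Proof. by move=> pf; have := pol_mul (pol_cst k 0 a) pf. Qed.

Lemma pol_exp k m n f : pol k m f -> pol k (m * n) (fun x => f x ^+ n).
Proof.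
move=> pf; elim: n => [|n IH]; first by rewrite muln0; exact: (pol_cst _ _ 1).
rewrite mulnS; apply: (eq_pol _ (pol_mul pf IH)) => x; by rewrite exprS.
Qed.

Lemma pol_sum k m (I : Type) (s : seq I) (Q : pred I) (F : I -> d.-tuple R -> R) :
  (forall i, Q i -> pol k m (F i)) -> pol k m (fun x => \sum_(i <- s | Q i) F i x).
Proof.
move=> pF; elim: s => [|a s IH].
  by apply: (eq_pol _ (pol_cst k m 0)) => x; rewrite big_nil.
have [Qa|Qa] := boolP (Q a).
  by apply: (eq_pol _ (pol_add (pF _ Qa) IH)) => x; rewrite big_cons Qa.
by apply: (eq_pol _ IH) => x; rewrite big_cons (negbTE Qa).
Qed.

Lemma pol_measurable k m f : pol k m f -> measurable_fun setT f.
Proof.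
elim=> [a al _ _|f1 f2 _ h1 _ h2]; last exact: measurable_funD.
by apply: measurable_funM => //; exact: measurable_mono.
Qed.

Hypothesis x8i : forall i : 'I_d, L1fun P (fun x => coord i x ^+ 8).

Lemma mono_L1 al : (\sum_i al i <= 8)%N -> L1fun P (mono al).
Proof.
move=> al8; apply: (@le_L1 _ _ _ _ _ (fun x => 1 + \sum_i coord i x ^+ 8)).
- exact: measurable_mono.
- by apply: L1D; [exact: L1_cst|apply: L1_sum => i _; exact: x8i].
- by move=> x; exact: normr_mono_le.
Qed.

Lemma pol_L1 k m f : (m <= 8)%N -> pol k m f -> L1fun P f.
Proof.
move=> m8; elim=> [a al _ h|f1 f2 _ h1 _ h2]; last exact: L1D.
by apply: L1Z; apply: mono_L1; exact: leq_trans m8.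
Qed.

Hypothesis factor : forall al, (\sum_i al i <= 8)%N ->
  mean P (mono al) = \prod_i mean P (fun x => coord i x ^+ al i).

(** For moments of total degree at most [8] a new coordinate acts as if it were
    independent of the previous ones, by linearity from the case of a monomial. *)
Lemma pol_indep k m f (i : 'I_d) a : (k <= i)%N -> (m + a <= 8)%N -> pol k m f ->
  mean P (fun x => f x * coord i x ^+ a) = mean P f * mean P (fun x => coord i x ^+ a).
Proof.
move=> ki ma.
have pa : pol d a (fun x => coord i x ^+ a).
  by have := pol_exp a (pol_coord (ltn_ord i)); rewrite mul1n.
elim=> [b al h1 h2|f1 f2 p1 h1 p2 h2]; last first.
  have Lp g : pol k m g -> L1fun P (fun x => g x * coord i x ^+ a).
    move=> pg; apply: (pol_L1 ma); apply: pol_mul pa.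
    by apply: pol_widen pg => //; apply: leq_trans ki _; exact: ltnW.
  have m8 : (m <= 8)%N by apply: leq_trans ma; exact: leq_addr.
  under eq_mean do rewrite mulrDl.
  rewrite meanD; [|exact: Lp..].
  by rewrite h1 h2 meanD ?mulrDl//; [exact: (pol_L1 m8 p1)|exact: (pol_L1 m8 p2)].
pose be (j : 'I_d) := if j == i then a else al j.
have mE x : b * mono al x * coord i x ^+ a = b * mono be x.
  rewrite -mulrA; congr (_ * _); rewrite /mono [in RHS](bigD1 i)//= (bigD1 i)//=.
  rewrite /be eqxx (h1 _ ki) expr0 mul1r mulrC; congr (_ * _).
  by apply: eq_bigr => j /negbTE ->.
have sb : (\sum_i be i <= 8)%N.
  apply: leq_trans ma; rewrite (bigD1 i)//= {1}/be eqxx addnC leq_add2r.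
  apply: leq_trans h2; rewrite [leqRHS](bigD1 i)//= (h1 _ ki) add0n.
  by apply: leq_sum => j /negbTE ji; rewrite /be ji.
have sa : (\sum_i al i <= 8)%N.
  by apply: leq_trans h2 _; apply: leq_trans ma; exact: leq_addr.
rewrite (eq_mean _ mE) !meanZ; [|exact: mono_L1..].
rewrite -mulrA !factor//; congr (_ * _).
rewrite (bigD1 i)//= [in RHS](bigD1 i)//= (h1 _ ki).
rewrite {1}/be eqxx mulrC; congr (_ * _).
rewrite (eq_mean _ (g := fun=> 1)) ?mean_cst ?mul1r; last by move=> x; rewrite expr0.
by apply: eq_bigr => j /negbTE ji; rewrite /be ji.
Qed.

Hypothesis m1 : forall i : 'I_d, mean P (coord i) = 0.
Hypothesis m2 : forall i : 'I_d, mean P (fun x => coord i x ^+ 2) = 1.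
Variables (c C0 Delta : R).
Hypothesis m4 : forall i : 'I_d, mean P (fun x => coord i x ^+ 4) = 3 + Delta.
Hypothesis m8 : forall i : 'I_d, mean P (fun x => coord i x ^+ 8) <= C0.
Hypotheses (c0 : 0 < c) (cD : c < Delta + 2) (C00 : 0 <= C0).

Let coord_pol (i : 'I_d) : pol i.+1 1 (coord i). Proof. exact: pol_coord. Qed.

Let m4_le (i : 'I_d) : mean P (fun x => coord i x ^+ 4) <= 1 + C0.
Proof.
have L4 : L1fun P (fun x => coord i x ^+ 4).
  by apply: (@pol_L1 i.+1 4) => //; have := pol_exp 4 (coord_pol i).
apply: (@le_trans _ _ (mean P (fun x => 1 + coord i x ^+ 8))).
  apply: le_mean => // [|x]; first by apply: L1D => //; exact: L1_cst.
  have -> : coord i x ^+ 8 = (coord i x ^+ 4) ^+ 2 by rewrite -exprM.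
  move: (coord i x ^+ 4) => u; have : 0 <= (u - 1) ^+ 2 by exact: sqr_ge0.
  by have := sqr_ge0 u; rewrite sqrrB !expr2; lra.
by rewrite meanD ?mean_cst ?lerD2l//; exact: L1_cst.
Qed.

Let sum_ltS (k : nat) (kd : (k < d)%N) (G : 'I_d -> R) :
  \sum_(i < d | (i < k.+1)%N) G i = \sum_(i < d | (i < k)%N) G i + G (Ordinal kd).
Proof.
rewrite (bigD1 (Ordinal kd))//= addrC; congr (_ + _).
apply: eq_bigl => i; rewrite ltnS ltn_neqAle andbC; congr (_ && _).
Qed.

Definition lin_part (a : 'I_d -> R) (k : nat) x : R := \sum_(i < d | (i < k)%N) a i * coord i x.

Let sum_lt0 (G : 'I_d -> R) : \sum_(i < d | (i < 0)%N) G i = 0.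
Proof. by rewrite big_pred0. Qed.

Let lin_partS a k (kd : (k < d)%N) x :
  lin_part a k.+1 x = lin_part a k x + a (Ordinal kd) * coord (Ordinal kd) x.
Proof. exact: sum_ltS. Qed.

Let pol_lin a k : pol k 1 (lin_part a k).
Proof. by apply: pol_sum => i ik; apply: pol_scale; exact: pol_coord. Qed.

Let pL m f k : pol k m f -> (m <= 8)%N -> L1fun P f.
Proof. by move=> pf h; exact: pol_L1 h pf. Qed.

Lemma lin_part_mean a k : mean P (lin_part a k) = 0.
Proof.
rewrite /lin_part mean_sum => [|i _].
  rewrite big1// => i _; rewrite meanZ ?m1 ?mulr0//; exact: pL (coord_pol i) _.
by apply: L1Z; exact: pL (coord_pol i) _.
Qed.

Let polW k l m f : pol k m f -> (k <= l)%N -> pol l m f.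
Proof. by move=> pf kl; exact: pol_widen pf. Qed.

Let indepS k (kd : (k < d)%N) m f a : pol k m f -> (m + a <= 8)%N ->
  mean P (fun x => f x * coord (Ordinal kd) x ^+ a) =
  mean P f * mean P (fun x => coord (Ordinal kd) x ^+ a).
Proof. by move=> pf ma; exact: (@pol_indep k m f (Ordinal kd) a (leqnn k) ma pf). Qed.

Lemma lin_part_sqr a k : (k <= d)%N ->
  mean P (fun x => lin_part a k x ^+ 2) = \sum_(i < d | (i < k)%N) a i ^+ 2.
Proof.
elim: k => [|k IH] kd.
  by rewrite sum_lt0 (eq_mean _ (g := fun=> 0)) ?mean_cst// => x; rewrite /lin_part sum_lt0 expr0n.
pose i := Ordinal kd; rewrite (sum_ltS kd) -/i -IH ?(ltnW kd)//.
have pX := coord_pol i; have pl := pol_lin a k.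
rewrite (eq_mean _ (g := fun x => lin_part a k x ^+ 2 +
   (2 * a i * (lin_part a k x * coord i x ^+ 1) + a i ^+ 2 * coord i x ^+ 2))); last first.
  by move=> x; rewrite (lin_partS a kd) -/i; ring.
have l1 : L1fun P (fun x => lin_part a k x ^+ 2) by exact: pL (pol_exp 2 pl) _.
have l2 : L1fun P (fun x => lin_part a k x * coord i x ^+ 1).
  by apply: pL (pol_mul (polW pl (leqnSn k)) (pol_exp 1 pX)) _.
have l3 : L1fun P (fun x => coord i x ^+ 2) by exact: pL (pol_exp 2 pX) _.
rewrite meanD//; last by apply: L1D; exact: L1Z.
rewrite meanD; [|exact: L1Z..].
rewrite !meanZ// (indepS kd pl)// lin_part_mean mul0r mulr0 add0r.
by rewrite m2 mulr1.
Qed.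

Lemma lin_part_pow4 a k : (k <= d)%N ->
  mean P (fun x => lin_part a k x ^+ 4) <=
    16 * (1 + C0) * (\sum_(i < d | (i < k)%N) a i ^+ 2) ^+ 2.
Proof.
elim: k => [|k IH] kd.
  rewrite sum_lt0 (eq_mean _ (g := fun=> 0)) ?mean_cst => [|x]; first by rewrite expr0n/= mulr0.
  by rewrite /lin_part sum_lt0 expr0n.
pose i := Ordinal kd; rewrite (sum_ltS kd) -/i.
have {}IH := IH (ltnW kd).
have pX := coord_pol i; have pl := pol_lin a k; have pl' := polW pl (leqnSn k).
have pD : pol k.+1 1 (fun x => a i * coord i x) by exact: pol_scale.
rewrite (eq_mean _ (g := fun x => (lin_part a k x + a i * coord i x) ^+ 4)); last first.
  by move=> x; rewrite (lin_partS a kd).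
apply: mean_pow4_step => //.
- by have := C00; lra.
- by apply: sumr_ge0 => j _; exact: sqr_ge0.
- exact: sqr_ge0.
- exact: pL (pol_exp 4 pl) _.
- exact: pL (pol_exp 4 pD) _.
- exact: pL (pol_mul (pol_exp 3 pl') pD) _.
- exact: pL (pol_mul (pol_exp 2 pl') (pol_exp 2 pD)) _.
- exact: pL (pol_exp 4 (pol_add pl' pD)) _.
- rewrite (eq_mean _ (g := fun x => a i * (lin_part a k x ^+ 3 * coord i x ^+ 1))); last first.
    by move=> x; ring.
  rewrite meanZ; last exact: pL (pol_mul (pol_exp 3 pl') (pol_exp 1 pX)) _.
  by rewrite (indepS kd (pol_exp 3 pl))// m1 !mulr0.
- rewrite (eq_mean _ (g := fun x => a i ^+ 4 * coord i x ^+ 4)); last by move=> x; rewrite exprMn.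
  rewrite meanZ; last exact: pL (pol_exp 4 pX) _.
  rewrite -exprM mulrC ler_wpM2r ?exprn_even_ge0//; exact: m4_le.
Qed.

(** The terms of the quadratic form (for a symmetric matrix [A]) with largest
    index [i]. In terms of moments of degree at most [8] these are martingale
    differences, which reduces fourth moments to an induction on the number of
    coordinates. *)
Definition quad_incr (A : 'I_d -> 'I_d -> R) (i : 'I_d) x : R :=
  A i i * (coord i x ^+ 2 - 1) + 2 * (lin_part (A i) i x * coord i x).
Definition quad_part A (k : nat) x : R := \sum_(i < d | (i < k)%N) quad_incr A i x.
(** The share of the indices with maximum [i] in the squared Frobenius norm of a
    symmetric matrix. *)
Definition quad_weight (A : 'I_d -> 'I_d -> R) (i : 'I_d) : R :=
  A i i ^+ 2 + 2 * \sum_(j < d | (j < i)%N) A i j ^+ 2.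

Let pol_sq1 (i : 'I_d) : pol i.+1 2 (fun x => coord i x ^+ 2 - 1).
Proof. by apply: pol_add; [exact: (pol_exp 2 (coord_pol i))|exact: pol_cst]. Qed.

Let pol_cross A (i : 'I_d) : pol i.+1 2 (fun x => lin_part (A i) i x * coord i x).
Proof. by apply: (pol_mul (polW (pol_lin _ _) (leqnSn i)) (coord_pol i)). Qed.

Let pol_incr A (i : 'I_d) : pol i.+1 2 (quad_incr A i).
Proof. by apply: pol_add; apply: pol_scale; [exact: pol_sq1|exact: pol_cross]. Qed.

Let pol_quad A k : pol k 2 (quad_part A k).
Proof. by apply: pol_sum => i ik; exact: polW (pol_incr A i) ik. Qed.

Let weight_ge0 A i : 0 <= quad_weight A i.
Proof.
by rewrite addr_ge0 ?sqr_ge0// mulr_ge0// sumr_ge0// => j _; exact: sqr_ge0.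
Qed.

Let mean_mul_incr A (i : 'I_d) f m : (m + 2 <= 8)%N -> pol i m f ->
  mean P (fun x => f x * quad_incr A i x) = 0.
Proof.
move=> m8' pf; have pf' := polW pf (leqnSn i); have pX := coord_pol i.
have pl := pol_lin (A i) i.
have mle8 : (m <= 8)%N by apply: leq_trans m8'; exact: leq_addr.
rewrite (eq_mean _ (g := fun x => A i i * (f x * coord i x ^+ 2 - f x) +
   2 * (f x * lin_part (A i) i x * coord i x ^+ 1))); last first.
  by move=> x; rewrite /quad_incr; ring.
have l1 : L1fun P (fun x => f x * coord i x ^+ 2) by exact: pL (pol_mul pf' (pol_exp 2 pX)) _.
have l2 : L1fun P f by exact: pL pf _.
have pfl := pol_mul pf pl.
have l3 : L1fun P (fun x => f x * lin_part (A i) i x * coord i x ^+ 1).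
  by apply: pL (pol_mul (polW pfl (leqnSn i)) (pol_exp 1 pX)) _; rewrite -addnA.
rewrite meanD; [|by apply: L1Z; exact: L1B|exact: L1Z].
rewrite meanZ ?meanB//; last exact: L1B.
rewrite meanZ// (pol_indep (leqnn _) m8' pf) m2 mulr1 subrr mulr0 add0r.
by rewrite (pol_indep (leqnn _) _ pfl) ?m1 ?mulr0// -addnA.
Qed.

(** The cross term vanishes because the linear part has mean zero; what is left is
    where the kurtosis of the coordinates, through [2 + Delta], enters the
    variance. *)
Lemma incr_sqr A (i : 'I_d) :
  mean P (fun x => quad_incr A i x ^+ 2) =
    A i i ^+ 2 * (2 + Delta) + 4 * \sum_(j < d | (j < i)%N) A i j ^+ 2.
Proof.
have pX := coord_pol i; have pl := pol_lin (A i) i; have pl' := polW pl (leqnSn i).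
pose L := lin_part (A i) i; rewrite -/L in pl pl'.
rewrite (eq_mean _ (g := fun x => A i i ^+ 2 * (coord i x ^+ 4 - 2 * coord i x ^+ 2 + 1) +
   (4 * A i i * (L x * coord i x ^+ 3 - L x * coord i x ^+ 1) +
    4 * (L x ^+ 2 * coord i x ^+ 2)))); last first.
  by move=> x; rewrite /quad_incr -/(L x); ring.
have x4 : L1fun P (fun x => coord i x ^+ 4) by exact: pL (pol_exp 4 pX) _.
have x2 : L1fun P (fun x => coord i x ^+ 2) by exact: pL (pol_exp 2 pX) _.
have l3 : L1fun P (fun x => L x * coord i x ^+ 3) by exact: pL (pol_mul pl' (pol_exp 3 pX)) _.
have l1 : L1fun P (fun x => L x * coord i x ^+ 1) by exact: pL (pol_mul pl' (pol_exp 1 pX)) _.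
have l2 : L1fun P (fun x => L x ^+ 2 * coord i x ^+ 2).
  by exact: pL (pol_mul (pol_exp 2 pl') (pol_exp 2 pX)) _.
have x42 : L1fun P (fun x => coord i x ^+ 4 - 2 * coord i x ^+ 2).
  by apply: L1B => //; exact: L1Z.
have x421 : L1fun P (fun x => coord i x ^+ 4 - 2 * coord i x ^+ 2 + 1).
  by apply: L1D => //; exact: L1_cst.
have l31 := L1B l3 l1.
rewrite meanD; [|exact: L1Z|by apply: L1D; exact: L1Z].
rewrite meanD; [|exact: L1Z..].
rewrite !meanZ// meanD//; last exact: L1_cst.
rewrite meanB//; last exact: L1Z.
rewrite meanZ// mean_cst m4 m2 meanB//.
rewrite (pol_indep (leqnn _) _ pl)// (pol_indep (leqnn _) _ pl)//.
rewrite (lin_part_mean _ _) (pol_indep (leqnn _) _ (pol_exp 2 pl))// m2.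
by rewrite /L (lin_part_sqr _ (ltnW (ltn_ord i))); ring.
Qed.

Lemma quad_part_mean A k : mean P (quad_part A k) = 0.
Proof.
rewrite /quad_part mean_sum => [|i _]; last exact: pL (pol_incr A i) _.
rewrite big1// => i _; have := @mean_mul_incr A i (fun=> 1) 0 isT (pol_cst _ _ _).
by under eq_mean do rewrite mul1r.
Qed.

Let quad_partS A k (kd : (k < d)%N) x :
  quad_part A k.+1 x = quad_part A k x + quad_incr A (Ordinal kd) x.
Proof. exact: sum_ltS. Qed.

Lemma quad_part_sqr_ge A k : (k <= d)%N ->
  Num.min c 2 * \sum_(i < d | (i < k)%N) quad_weight A i <=
    mean P (fun x => quad_part A k x ^+ 2).
Proof.
elim: k => [|k IH] kd.
  rewrite sum_lt0 mulr0; apply: mean_ge0 => x; exact: sqr_ge0.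
pose i := Ordinal kd; rewrite (sum_ltS kd) -/i.
have {}IH := IH (ltnW kd).
have pQ := pol_quad A k; have pQ' := polW pQ (leqnSn k).
have pD : pol k.+1 2 (quad_incr A i) := pol_incr A i.
rewrite (eq_mean _ (g := fun x => quad_part A k x ^+ 2 +
   (2 * (quad_part A k x * quad_incr A i x) + quad_incr A i x ^+ 2))); last first.
  by move=> x; rewrite (quad_partS A kd); ring.
have l1 : L1fun P (fun x => quad_part A k x ^+ 2) by exact: pL (pol_exp 2 pQ) _.
have l2 : L1fun P (fun x => quad_part A k x * quad_incr A i x) by exact: pL (pol_mul pQ' pD) _.
have l3 : L1fun P (fun x => quad_incr A i x ^+ 2) by exact: pL (pol_exp 2 pD) _.
rewrite meanD//; last by apply: L1D => //; exact: L1Z.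
rewrite meanD//; last exact: L1Z.
rewrite meanZ// (@mean_mul_incr A i _ 2)// mulr0 add0r mulrDr; apply: lerD => //.
rewrite incr_sqr /quad_weight mulrDr; apply: lerD.
  rewrite mulrC ler_wpM2l ?sqr_ge0// ge_min; apply/orP; left.
  by have := cD; lra.
rewrite mulrA ler_wpM2r ?sumr_ge0// => [j _|]; first exact: sqr_ge0.
have : Num.min c 2 <= 2 by rewrite ge_min lexx orbT.
lra.
Qed.

Definition quad_cst : R := 64 * (1 + C0) + 2048 * (1 + C0) ^+ 2.

(** By convexity of the fourth power, [quad_incr] contributes through its diagonal
    part and its off-diagonal part, each of which is a product of moments. *)
Let incr_pow4 A (i : 'I_d) :
  mean P (fun x => quad_incr A i x ^+ 4) <= quad_cst * quad_weight A i ^+ 2.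
Proof.
have pX := coord_pol i; have pl := pol_lin (A i) i; have pl' := polW pl (leqnSn i).
pose L := lin_part (A i) i; rewrite -/L in pl pl'.
have C0' := C00.
have x8 := x8i i.
have lx4 : L1fun P (fun x => L x ^+ 4 * coord i x ^+ 4).
  by exact: pL (pol_mul (pol_exp 4 pl') (pol_exp 4 pX)) _.
have x81 : L1fun P (fun x => 1 + coord i x ^+ 8) by apply: L1D => //; exact: L1_cst.
apply: (@le_trans _ _ (mean P (fun x => 64 * A i i ^+ 4 * (1 + coord i x ^+ 8) +
   128 * (L x ^+ 4 * coord i x ^+ 4)))).
  apply: le_mean.
  - exact: pL (pol_exp 4 (pol_incr A i)) _.
  - by apply: L1D; exact: L1Z.
  move=> x; rewrite /quad_incr -/(L x).
  have h4 (u w : R) : (u + w) ^+ 4 <= 8 * u ^+ 4 + 8 * w ^+ 4.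
    have : 0 <= (u ^+ 2 - w ^+ 2) ^+ 2 by exact: sqr_ge0.
    have : 0 <= (u - w) ^+ 2 * (3 * (u ^+ 2 + w ^+ 2) + 4 * (u + w) ^+ 2).
      rewrite mulr_ge0 ?sqr_ge0// addr_ge0// mulr_ge0// ?addr_ge0 ?sqr_ge0//.
    by rewrite !exprS !expr0; lra.
  apply: (le_trans (h4 _ _)).
  have e8 : coord i x ^+ 8 = (coord i x ^+ 2) ^+ 4 by rewrite -exprM.
  have e1 : (-1 : R) ^+ 4 = 1 by rewrite -signr_odd expr0.
  have := h4 (coord i x ^+ 2) (-1); rewrite -e8 e1 => h8.
  have a4 : 0 <= A i i ^+ 4 by rewrite exprn_even_ge0.
  have := ler_wpM2l a4 h8; rewrite !exprMn; lra.
rewrite meanD; [|exact: L1Z..].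
rewrite !meanZ// meanD//; last exact: L1_cst.
rewrite mean_cst (pol_indep (leqnn _) _ (pol_exp 4 pl))//.
have lp4 := lin_part_pow4 (A i) (ltnW (ltn_ord i)).
rewrite -/L in lp4.
set S := \sum_(j < d | (j < i)%N) A i j ^+ 2 in lp4 *.
have S0 : 0 <= S by apply: sumr_ge0 => j _; exact: sqr_ge0.
have L40 : 0 <= mean P (fun x => L x ^+ 4) by apply: mean_ge0 => x; rewrite exprn_even_ge0.
have h1 : mean P (fun x => L x ^+ 4) * mean P (fun x => coord i x ^+ 4) <=
    16 * (1 + C0) * S ^+ 2 * (1 + C0).
  apply: ler_pM; [exact: L40| |exact: lp4|exact: m4_le].
  by apply: mean_ge0 => x; rewrite exprn_even_ge0.
have h2 : A i i ^+ 4 * (1 + mean P (fun x => coord i x ^+ 8)) <= A i i ^+ 4 * (1 + C0).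
  by rewrite ler_wpM2l ?exprn_even_ge0// lerD2l.
have hw : A i i ^+ 4 + 4 * S ^+ 2 <= quad_weight A i ^+ 2.
  have -> : A i i ^+ 4 = A i i ^+ 2 * A i i ^+ 2 by rewrite -exprD.
  rewrite /quad_weight -/S; have := sqr_ge0 (A i i); move: (A i i ^+ 2) => u u0.
  have : 0 <= u * S by rewrite mulr_ge0.
  by rewrite !expr2; lra.
have a40 : 0 <= A i i ^+ 4 by rewrite exprn_even_ge0.
have S20 : 0 <= S ^+ 2 by exact: sqr_ge0.
have k0 : 0 <= quad_cst by rewrite /quad_cst; have := sqr_ge0 (1 + C0); lra.
have := ler_wpM2l k0 hw.
have q1 : 0 <= (1 + C0) * A i i ^+ 4 by rewrite mulr_ge0//; lra.
have q2 : 0 <= (1 + C0) * S ^+ 2 by rewrite mulr_ge0//; lra.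
have q3 : 0 <= (1 + C0) ^+ 2 * A i i ^+ 4 by rewrite mulr_ge0// sqr_ge0.
have q4 : 0 <= (1 + C0) ^+ 2 * S ^+ 2 by rewrite mulr_ge0// sqr_ge0.
rewrite /quad_cst; move: h1 h2 q1 q2 q3 q4; move: (1 + C0) => k.
rewrite !expr2; lra.
Qed.

Lemma quad_part_pow4 A k : (k <= d)%N ->
  mean P (fun x => quad_part A k x ^+ 4) <=
    16 * quad_cst * (\sum_(i < d | (i < k)%N) quad_weight A i) ^+ 2.
Proof.
elim: k => [|k IH] kd.
  rewrite sum_lt0 (eq_mean _ (g := fun=> 0)) ?mean_cst => [|x]; first by rewrite expr0n/= mulr0.
  by rewrite /quad_part sum_lt0 expr0n.
pose i := Ordinal kd; rewrite (sum_ltS kd) -/i.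
have {}IH := IH (ltnW kd).
have pQ := pol_quad A k; have pQ' := polW pQ (leqnSn k).
have pD : pol k.+1 2 (quad_incr A i) := pol_incr A i.
rewrite (eq_mean _ (g := fun x => (quad_part A k x + quad_incr A i x) ^+ 4)); last first.
  by move=> x; rewrite (quad_partS A kd).
apply: mean_pow4_step => //.
- by rewrite /quad_cst; have := sqr_ge0 (1 + C0); have := C00; lra.
- by apply: sumr_ge0.
- exact: pL (pol_exp 4 pQ) _.
- exact: pL (pol_exp 4 pD) _.
- exact: pL (pol_mul (pol_exp 3 pQ') pD) _.
- exact: pL (pol_mul (pol_exp 2 pQ') (pol_exp 2 pD)) _.
- exact: pL (pol_exp 4 (pol_add pQ' pD)) _.
- by apply: (@mean_mul_incr A i _ 6) => //; exact: (pol_exp 3 pQ).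
Qed.

Lemma quad_part_L1 A k n : (2 * n <= 8)%N -> L1fun P (fun x => quad_part A k x ^+ n).
Proof. by move=> h; exact: pL (pol_exp n (pol_quad A k)) h. Qed.

Lemma measurable_quad_part A k : measurable_fun setT (quad_part A k).
Proof. exact: pol_measurable (pol_quad A k). Qed.

End moments.

(** * Reduction of an i.i.d. sample to a product law *)

Section boxes.
Context {R : realType} {d} {T : measurableType d}.

Definition box n (A : 'I_n -> set T) : set (n.-tuple T) := [set t | forall i, A i (tnth t i)].

Lemma measurable_box n (A : 'I_n -> set T) : (forall i, measurable (A i)) -> measurable (box A).
Proof.
move=> mA; rewrite (_ : box A = \big[setI/setT]_(i < n) ((@tnth n T ^~ i) @^-1` A i)).
  apply: bigsetI_measurable => i _.
  by rewrite -[X in measurable X]setTI; apply: (measurable_tnth i).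
rewrite -bigcap_seq; apply/seteqP; split => t /= h i; first by move=> _; exact: h.
by have := h i; rewrite /= mem_index_enum; exact.
Qed.

(** Boxes are stable under intersection and generate the product
    sigma-algebra. *)
Lemma measure_box_unique n (m1 m2 : {measure set (n.-tuple T) -> \bar R}) :
  (m1 setT < +oo)%E ->
  (forall A : 'I_n -> set T, (forall i, measurable (A i)) -> m1 (box A) = m2 (box A)) ->
  forall E, measurable E -> m1 E = m2 E.
Proof.
move=> fin m12 E mE.
pose G := [set B | exists2 A : 'I_n -> set T, (forall i, measurable (A i)) & B = box A].
apply: (@measure_unique _ _ _ G (fun=> setT) _ _ _ _ m1 m2 _ _ E mE).
- apply/seteqP; split.
    apply: smallest_sub; first exact: smallest_sigma_algebra.
    case: n {m1 m2 fin m12 E mE} @G => [|n] G; first by rewrite big_ord0.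
    rewrite -bigcup_mkord_ord; apply: bigcup_sub => i Ii B [C mC <-].
    apply: sub_sigma_algebra; exists (fun j => if j == inord i then C else setT).
      by move=> j; case: ifP => // _; exact: measurableT.
    rewrite setTI; apply/seteqP; split => t /=.
      by move=> Ct j; case: eqP => // ->.
    by move=> /(_ (inord i)); rewrite eqxx.
  apply: smallest_sub; first exact: sigma_algebra_measurable.
  by move=> B [A mA ->]; exact: measurable_box.
- move=> _ _ [A mA ->] [B mB ->]; exists (fun i => A i `&` B i).
    by move=> i; exact: measurableI.
  apply/seteqP; split => t /=; first by move=> [h1 h2] i.
  by move=> h; split => i; have [] := h i.
- move=> k; exists (fun=> setT) => //; apply/seteqP; split => //.
- by rewrite bigcup_const.
- by move=> B [A mA ->]; exact: m12.
- by move=> _.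
Qed.

Lemma iid_law_box (P : probability T R) n (A : 'I_n -> set T) : (forall i, measurable (A i)) ->
  iid_law P n (box A) = (\prod_(i < n) P (A i))%E.
Proof.
elim: n A => [|n IH] A mA.
  rewrite big_ord0 /= diracE mem_set// => -[]//.
rewrite /= /distribution /pushforward /=.
have -> : tcons @^-1` box A = A ord0 `*` box (fun i => A (lift ord0 i)).
  apply/seteqP; split => -[x t] /=.
    move=> h; split; first exact: (h ord0).
    by move=> i; have := h (lift ord0 i); rewrite /tcons/= tnthS.
  move=> [h0 h] i; have [->//|] := eqVneq i ord0.
  by case: (unliftP ord0 i) => [j -> _|->]; [rewrite /tcons/= tnthS; exact: h|rewrite eqxx].
rewrite [LHS]product_measure1E//; last by apply: measurable_box.
rewrite big_ord_recl; congr (_ * _)%E; apply: IH => i; exact: mA.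
Qed.

End boxes.

Section transfer.
Context {R : realType} {disp disp' : measure_display} {Omega : measurableType disp}
  {T : measurableType disp'}.
Variables (Pr : probability Omega R) (P : probability T R) (m1 m2 : nat).
Variable X : 'I_(m1 + m2) -> {RV Pr >-> T}.
Hypothesis hX : iid_from Pr P X.

Definition sample (w : Omega) : (m1 + m2).-tuple T := [tuple X i w | i < m1 + m2].

Lemma measurable_sample : measurable_fun setT sample.
Proof.
apply/measurable_fun_tnthP => i; rewrite (_ : _ \o _ = X i).
  exact: measurable_funP.
by apply/funext => w /=; rewrite tnth_mktuple.
Qed.

HB.instance Definition _ := isMeasurableFun.Build _ _ _ _ sample measurable_sample.

(** The first component is the second sample, since it is the one to be conditioned on. *)
Definition tcat (p : m2.-tuple T * m1.-tuple T) : (m1 + m2).-tuple T := [tuple of p.2 ++ p.1].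

Lemma tnth_tcat_l p i : tnth (tcat p) (lshift m2 i) = tnth p.2 i.
Proof. exact: tnth_lshift. Qed.

Lemma tnth_tcat_r p j : tnth (tcat p) (rshift m1 j) = tnth p.1 j.
Proof. exact: tnth_rshift. Qed.

Lemma measurable_tcat : measurable_fun setT tcat.
Proof.
apply/measurable_fun_tnthP => i; rewrite -[i]splitK; case: (fintype.split i) => j /=.
  rewrite (_ : _ \o _ = (@tnth _ T ^~ j) \o snd).
    exact: (measurableT_comp (measurable_tnth j)).
  by apply/funext => p; rewrite /= -tnth_tcat_l.
rewrite (_ : _ \o _ = (@tnth _ T ^~ j) \o fst).
  exact: (measurableT_comp (measurable_tnth j)).
by apply/funext => p; rewrite /= -tnth_tcat_r.
Qed.

HB.instance Definition _ := isMeasurableFun.Build _ _ _ _ tcat measurable_tcat.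

(** Independence determines the law of the whole sample, which is thus the product
    of the laws of its two blocks. *)
Lemma sample_law (E : set ((m1 + m2).-tuple T)) : measurable E ->
  Pr (sample @^-1` E) = (iid_law P m2 \x iid_law P m1)%E (tcat @^-1` E).
Proof.
apply: (measure_box_unique (m1 := distribution Pr sample)
  (m2 := distribution (iid_law P m2 \x iid_law P m1)%E tcat)).
  exact: (le_lt_trans (probability_le1 (distribution Pr sample) measurableT) (ltry 1)).
move=> A mA; have [h1 h2] := hX.
change (Pr (sample @^-1` box A) = (iid_law P m2 \x iid_law P m1)%E (tcat @^-1` box A)).
have -> : sample @^-1` box A = \bigcap_(i in [set: 'I_(m1 + m2)]) (X i @^-1` A i).
  apply/seteqP; split => w /=.
    by move=> h i _; have := h i; rewrite tnth_mktuple.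
  by move=> h i; rewrite tnth_mktuple; exact: h.
have -> : tcat @^-1` box A = box (A \o @rshift m1 m2) `*` box (A \o @lshift m1 m2).
  apply/seteqP; split => p /=.
    move=> h; split => i.
      by have := h (rshift m1 i); rewrite tnth_tcat_r.
    by have := h (lshift m2 i); rewrite tnth_tcat_l.
  move=> [hr hl] i; rewrite -[i]splitK; case: (fintype.split i) => j /=.
    by rewrite tnth_tcat_l; exact: hl.
  by rewrite tnth_tcat_r; exact: hr.
rewrite h2//; transitivity (iid_law P m2 (box (A \o @rshift m1 m2)) *
    iid_law P m1 (box (A \o @lshift m1 m2)))%E; last first.
  apply/esym; apply: product_measure1E;
    by apply: measurable_box => i; exact: mA.
rewrite (iid_law_box P) => [|i]; last exact: mA.
rewrite (iid_law_box P) => [|i]; last exact: mA.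
rewrite big_split_ord /= muleC; congr (_ * _)%E.
  by apply: eq_bigr => i _; rewrite /= -(h1 (rshift m1 i)).
by apply: eq_bigr => i _; rewrite /= -(h1 (lshift m2 i)).
Qed.

End transfer.

(** * The covariance statistic *)

Section class_cov_moments.
Context {R : realType} {d : nat} (P : probability (d.-tuple R) R) (c C0 : R).
Hypothesis hP : class_cov c C0 P.

Lemma class_cov_L1 (i : 'I_d) : L1fun P (fun x => coord i x ^+ 8).
Proof.
have [_ [_ [_ [_ [/(_ i) h8 _]]]]] := hP.
apply/integrableP; split.
  by apply/measurable_EFinP; apply: measurable_funX; exact: measurable_coord.
rewrite expectation.unlock in h8; apply: (le_lt_trans _ (lt_trans h8 (ltry _))).
rewrite le_eqVlt; apply/orP; left; apply/eqP; apply: eq_integral => x _ /=.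
by rewrite ger0_norm// exprn_even_ge0.
Qed.

Let expectation_mean f : L1fun P f -> ('E_P[f] = (mean P f)%:E)%E.
Proof. by move=> fi; rewrite expectation.unlock mean_EFin. Qed.

Let coord_L1 k (i : 'I_d) : (k <= 8)%N -> L1fun P (fun x => coord i x ^+ k).
Proof.
move=> k8; apply: (pol_L1 class_cov_L1 (m := k) k8).
by have := pol_exp k (pol_coord (ltn_ord i)); rewrite mul1n; apply.
Qed.

Lemma class_cov_mean (i : 'I_d) : mean P (coord i) = 0.
Proof.
have [_ [/(_ i) h _]] := hP; move: h; rewrite expectation_mean; first by case.
exact: (coord_L1 (k := 1)).
Qed.

Lemma class_cov_sqr (i : 'I_d) : mean P (fun x => coord i x ^+ 2) = 1.
Proof.
have [_ [h1 [/(_ i i) h2 _]]] := hP; move: h2.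
rewrite covariance.unlock !h1 eqxx /=.
have -> : ((coord i \- cst 0) * (coord i \- cst 0))%R = (fun x : d.-tuple R => coord i x ^+ 2).
  by apply/funext => x /=; rewrite /GRing.mul/= subr0 expr2.
by rewrite expectation_mean; [case|exact: (coord_L1 (k := 2))].
Qed.

Lemma class_cov_pow4 : exists2 Delta, c < Delta + 2 &
  forall i : 'I_d, mean P (fun x => coord i x ^+ 4) = 3 + Delta.
Proof.
have [_ [_ [_ [[Delta [h4 hD]] _]]]] := hP; exists Delta => // i.
by move: (h4 i); rewrite expectation_mean; [case|exact: (coord_L1 (k := 4))].
Qed.

Lemma class_cov_pow8 (i : 'I_d) : mean P (fun x => coord i x ^+ 8) <= C0.
Proof.
have [_ [_ [_ [_ [/(_ i) h8 _]]]]] := hP; move: h8.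
by rewrite expectation_mean ?lte_fin => [/ltW//|]; exact: class_cov_L1.
Qed.

(** The hypothesis concerns positive exponents at distinct indices; apply it on
    the support of [al]. *)
Lemma class_cov_factor al : (\sum_i al i <= 8)%N ->
  mean P (mono al) = \prod_i mean P (fun x => coord i x ^+ al i).
Proof.
move=> al8; have al_le i : (al i <= 8)%N.
  by apply: leq_trans al8; rewrite (bigD1 i)//= leq_addr.
pose S := [pred i | (0 < al i)%N].
have al0 i : i \notin S -> al i = 0%N by rewrite inE lt0n negbK => /eqP.
have prodS (F : 'I_d -> R) : (forall i, i \notin S -> F i = 1) ->
    \prod_i F i = \prod_(k < #|S|) F (enum_val k).
  move=> F1; rewrite -(big_enum_val F) [RHS]big_mkcond/=.
  by apply: eq_bigr => i _; case: ifPn => // /F1.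
have [q0|q0] := posnP #|S|.
  have a0 i : al i = 0%N by apply: al0; rewrite (card0_eq q0).
  rewrite (eq_mean _ (g := fun=> 1)); last first.
    by move=> x; rewrite /mono big1// => i _; rewrite a0 expr0.
  rewrite mean_cst big1// => i _; rewrite a0.
  by under eq_mean do rewrite expr0; rewrite mean_cst.
have [_ [_ [_ [_ [_ hf]]]]] := hP.
have := hf #|S| (@enum_val _ S) (fun k => al (enum_val k)) q0 (@enum_val_inj _ _).
have mE (x : d.-tuple R) : \prod_(k < #|S|) coord (enum_val k) x ^+ al (enum_val k) = mono al x.
  by rewrite /mono (prodS (fun i => coord i x ^+ al i))// => i iS; rewrite (al0 _ iS) expr0.
rewrite (funext mE) => h.
rewrite (prodS (fun i => mean P (fun x => coord i x ^+ al i))); last first.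
  by move=> i /al0 ->; under eq_mean do rewrite expr0; rewrite mean_cst.
have {}h : (mean P (mono al))%:E =
    (\prod_(k < #|S|) (mean P (fun x => coord (enum_val k) x ^+ al (enum_val k)))%:E)%E.
  rewrite -expectation_mean; last exact: (mono_L1 class_cov_L1).
  rewrite h.
  - apply: eq_bigr => k _; rewrite expectation_mean//; exact: coord_L1.
  - by move=> k; have := enum_valP k.
  - apply: leq_trans al8; rewrite -(big_enum_val (A := S) al).
    by rewrite big_mkcond /=; apply: leq_sum => i _; case: ifP.
have pE n (F : 'I_n -> R) : (\prod_(k < n) (F k)%:E)%E = (\prod_(k < n) F k)%:E.
  by elim/big_rec2: _ => // k x y _ ->; rewrite EFinM.
by move: h; rewrite pE; case.
Qed.

End class_cov_moments.

Section quadratic_statistic.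
Context {R : realType} {d : nat}.
Implicit Types (x : d.-tuple R) (A : 'I_d -> 'I_d -> R).

Lemma centered_outerE x i j :
  centered_outer x i j = coord i x * coord j x - (i == j)%:R.
Proof. by rewrite /centered_outer !mxE big_ord1 !mxE. Qed.

(** The deviation of the empirical second-moment matrix of the second sample from
    the identity; [f_cov] is the quadratic form of this matrix. *)
Definition cov_dev m (b : m.-tuple (d.-tuple R)) (i j : 'I_d) : R :=
  m%:R^-1 * \sum_(k < m) (coord i (tnth b k) * coord j (tnth b k) - (i == j)%:R).

Lemma cov_devC m (b : m.-tuple (d.-tuple R)) i j : cov_dev b i j = cov_dev b j i.
Proof.
rewrite /cov_dev; congr (_ * _); apply: eq_bigr => k _.
by rewrite mulrC eq_sym.
Qed.

Lemma sum_sym (G : 'I_d -> 'I_d -> R) : (forall i j, G i j = G j i) ->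
  \sum_i \sum_j G i j = \sum_i (G i i + 2 * \sum_(j < d | (j < i)%N) G i j).
Proof.
move=> Gs.
have split3 i : \sum_j G i j = G i i + (\sum_(j < d | (j < i)%N) G i j + \sum_(j < d | (i < j)%N) G i j).
  rewrite (bigD1 i)//=; congr (_ + _).
  rewrite (bigID (fun j : 'I_d => (j < i)%N))/=; congr (_ + _); apply: eq_bigl => j.
    by rewrite -val_eqE /= neq_ltn; case: ltngtP.
  by rewrite -val_eqE /= neq_ltn -leqNgt; case: ltngtP.
under eq_bigr do rewrite split3; rewrite !big_split/=; congr (_ + _).
have -> : \sum_(i < d) \sum_(j < d | (i < j)%N) G i j = \sum_(i < d) \sum_(j < d | (j < i)%N) G i j.
  rewrite (exchange_big_dep xpredT)//=; apply: eq_bigr => i _.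
  by apply: eq_bigr => j _.
by rewrite -mulr_sumr; ring.
Qed.

Lemma quad_partE A x : (forall i j, A i j = A j i) ->
  quad_part A d x = \sum_i \sum_j A i j * (coord i x * coord j x - (i == j)%:R).
Proof.
move=> As; rewrite (sum_sym (G := fun i j => A i j * (coord i x * coord j x - (i == j)%:R))).
  rewrite /quad_part; apply: eq_big => [i|i _]; first by rewrite ltn_ord.
  rewrite /quad_incr eqxx expr2; congr (_ + 2 * _).
  rewrite /lin_part mulr_suml; apply: eq_bigr => j ji.
  rewrite (_ : (i == j) = false) ?subr0; first by ring.
  by apply/negbTE; rewrite -val_eqE /= gt_eqF.
by move=> i j; rewrite As mulrC [coord i x * _]mulrC eq_sym mulrC.
Qed.

Lemma f_covE m1 m2 (X : 'I_(m1 + m2) -> d.-tuple R) (b : m2.-tuple (d.-tuple R)) x :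
  (forall j, X (rshift m1 j) = tnth b j) -> f_cov X x = quad_part (cov_dev b) d x.
Proof.
move=> Xb; rewrite quad_partE; last exact: cov_devC.
rewrite /f_cov /mxtrace.
under eq_bigr => j _ do under eq_bigr => i _ do rewrite mxE.
rewrite exchange_big/= mulr_sumr; apply: eq_bigr => i _.
rewrite exchange_big/= mulr_sumr; apply: eq_bigr => k _.
rewrite -mulr_sumr cov_devC /cov_dev mulrCA [RHS]mulrC; congr (_ * _).
  by rewrite centered_outerE.
by congr (_ * _); apply: eq_bigr => j _; rewrite centered_outerE Xb.
Qed.

Definition total_weight A : R := \sum_i quad_weight A i.

Lemma total_weight_ge0 A : 0 <= total_weight A.
Proof.
apply: sumr_ge0 => i _; rewrite addr_ge0 ?sqr_ge0// mulr_ge0// sumr_ge0// => j _.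
exact: sqr_ge0.
Qed.

Lemma total_weight_eq0 A : (forall i j, A i j = A j i) -> total_weight A = 0 ->
  forall i j, A i j = 0.
Proof.
move=> As h.
have E : \sum_i \sum_j A i j ^+ 2 = 0.
  by rewrite (sum_sym (G := fun i j => A i j ^+ 2)) => [|i j]; [exact: h|rewrite As].
move=> i j; apply/eqP; rewrite -sqrf_eq0; apply/eqP.
have h1 : \sum_j A i j ^+ 2 = 0.
  apply: (psumr_eq0P _ E) => // k _; apply: sumr_ge0 => l _; exact: sqr_ge0.
by apply: (psumr_eq0P _ h1) => // k _; exact: sqr_ge0.
Qed.

(** A vector is determined by its outer square up to sign. *)
Lemma outer_inj x y : (forall i j, coord i x * coord j x = coord i y * coord j y) ->
  y = x \/ y = [tuple - coord i x | i < d].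
Proof.
move=> h; have [/existsP[i xi]|] := boolP [exists i, coord i x != 0]; last first.
  rewrite negb_exists => /forallP x0; left; apply: eq_from_tnth => i.
  have xi : coord i x = 0 by apply/eqP; have := x0 i; rewrite negbK.
  have := h i i; rewrite xi mulr0 => /esym/eqP; rewrite mulf_eq0 orbb => /eqP yi.
  by rewrite -/(coord i y) -/(coord i x) yi xi.
have : (coord i y == coord i x) || (coord i y == - coord i x).
  by rewrite -eqf_sqr !expr2 h.
case/orP => /eqP yi; [left|right]; apply: eq_from_tnth => j.
  by apply: (mulfI xi); have := h i j; rewrite yi => ->.
rewrite tnth_mktuple; apply: (mulfI xi); have := h i j; rewrite yi.
by rewrite /coord => e; rewrite mulrN e mulNr opprK.
Qed.

End quadratic_statistic.

Section degenerate.
Context {R : realType} {d : nat}.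

Lemma measurable_tuple1 (x : d.-tuple R) : measurable [set x].
Proof.
rewrite (_ : [set x] = box (fun i => [set tnth x i])).
  by apply: measurable_box => i; exact: measurable_set1.
apply/seteqP; split => [y -> //|y /= h].
by apply: eq_from_tnth.
Qed.

Lemma measurable_total_weight m :
  measurable_fun setT (fun b : m.-tuple (d.-tuple R) => total_weight (cov_dev b)).
Proof.
have mc (k : 'I_m) (i : 'I_d) :
    measurable_fun setT (fun b : m.-tuple (d.-tuple R) => coord i (tnth b k)).
  exact: (measurableT_comp (measurable_coord i) (measurable_tnth k)).
have md (i j : 'I_d) :
    measurable_fun setT (fun b : m.-tuple (d.-tuple R) => cov_dev b i j).
  apply: measurable_funM => //; apply: measurable_sum => k.
  by apply: measurable_funB => //; exact: measurable_funM.
apply: measurable_sum => i; apply: measurable_funD; first exact: measurable_funX.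
apply: measurable_funM => //.
rewrite [X in measurable_fun _ X](_ : _ = fun b : m.-tuple (d.-tuple R) =>
  \sum_(j < d) if (j < i)%N then cov_dev b i j ^+ 2 else 0); last first.
  by apply/funext => b; rewrite big_mkcond.
by apply: measurable_sum => j; case: (j < i)%N => //; exact: measurable_funX.
Qed.

(** Given the other observations, [cov_dev b = 0] prescribes the outer square of
    the first one, that is, one of two opposite points, each of which has
    probability zero. *)
Lemma prob_cov_dev0 (P : probability (d.-tuple R) R) m :
  continuous_distribution P -> (0 < m)%N ->
  prob (iid_law P m) [set b | total_weight (cov_dev b) <= 0] = 0.
Proof.
move=> Pc; case: m => // m _; set Z := [set b | _].
have mZ : measurable Z.
  by apply: measurable_le_set => //; exact: measurable_total_weight.
have mtc y : measurable_fun setT (fun x : d.-tuple R => tcons (x, y) : m.+1.-tuple _).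
  exact: (measurableT_comp measurable_tcons (measurable_pair2 y)).
have msec y : measurable [set x | Z (tcons (x, y))].
  by rewrite -[X in measurable X]setTI; exact: (mtc y).
have iZ := L1_indic (iid_law P m.+1) mZ.
have sec x y : \1_Z (tcons (x, y)) = \1_[set x | Z (tcons (x, y))] x :> R.
  by rewrite !indicE; congr (_%:R); congr nat_of_bool; apply/idP/idP; rewrite !inE.
rewrite prob_mean// mean_iid_lawS// mean_prod2.
- rewrite (eq_mean _ (g := fun=> 0)) ?mean_cst// => y.
  rewrite /comp (eq_mean _ (sec ^~ y)) -prob_mean//.
  have [[x0 Zx0]|nZ] := pselect (exists x, Z (tcons (x, y))); last first.
    rewrite (_ : [set x | _] = set0) ?/prob ?measure0//.
    by apply/seteqP; split => // x Zx; apply: nZ; exists x.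
  apply: le_anti; rewrite prob_ge0 andbT.
  have mx (x : d.-tuple R) : prob P [set x] = 0 by rewrite /prob Pc.
  pose x1 : d.-tuple R := [tuple - coord i x0 | i < d].
  have m0 := measurable_tuple1 x0; have m1 := measurable_tuple1 x1.
  apply: (@le_trans _ _ (prob P ([set x0] `|` [set x1]))).
    apply: le_prob => //; first exact: measurableU.
    move=> x Zx; suff : x = x0 \/ x = x1 by [].
    have Zeq b : Z b -> forall i j, cov_dev b i j = 0.
      move=> /= hb; apply: total_weight_eq0; first exact: cov_devC.
      by apply: le_anti; rewrite hb total_weight_ge0.
    apply: outer_inj => i j.
    have := Zeq _ Zx i j; have := Zeq _ Zx0 i j.
    rewrite /cov_dev !big_ord_recl => /eqP; rewrite mulf_eq0 invr_eq0 pnatr_eq0 /= => /eqP h0.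
    move=> /eqP; rewrite mulf_eq0 invr_eq0 pnatr_eq0 /= => /eqP h1.
    move: h0 h1; rewrite /tcons /=.
    under eq_bigr do rewrite tnthS.
    move=> h0; under eq_bigr do rewrite tnthS.
    move: h0; set s := \sum_(k < m) _; rewrite !(tnth_nth x0)/=; lra.
  by apply: le_trans (prob_setU _ m0 m1) _; rewrite !mx addr0.
- by apply/L1_iid_lawS => //; exact: measurable_indic.
- move=> y; rewrite /comp (funext (sec ^~ y)); exact: L1_indic.
Qed.

End degenerate.

Section conditional.
Context {R : realType} {d : nat} (P : probability (d.-tuple R) R) (c C0 : R).
Hypotheses (hP : class_cov c C0 P) (c0 : 0 < c) (hC0 : 0 < C0).

Definition kurtosis_bound : R := 1 + 16 * quad_cst C0 / Num.min c 2 ^+ 2.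

(** The quadratic form divided by its standard deviation has kurtosis at most
    [kurtosis_bound], since its variance and its fourth moment are comparable to the
    weight of [A] and to the square of this weight. Dividing by a constant does not
    change Student's statistic. *)
Lemma quad_student_berry_esseen (C : R) (A : 'I_d -> 'I_d -> R) n z :
  (forall (g : d.-tuple R -> R), measurable_fun setT g -> L1fun P (fun x => g x ^+ 4) ->
    mean P g = 0 -> mean P (fun x => g x ^+ 2) = 1 ->
    mean P (fun x => g x ^+ 4) <= kurtosis_bound ->
    `|prob (iid_law P n.+1) [set t | studentT (fun i => g (tnth t i)) <= z] - ncdf z| <= C) ->
  0 < total_weight A ->
  `|prob (iid_law P n.+1) [set t | studentT (fun i => quad_part A d (tnth t i)) <= z] - ncdf z| <= C.
Proof.
move=> clt w0; have [Delta cD h4] := class_cov_pow4 hP.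
have h8i := class_cov_L1 hP; have hf := class_cov_factor hP.
have h1 := class_cov_mean hP; have h2 := class_cov_sqr hP; have h8 := class_cov_pow8 hP.
pose f := quad_part A d.
have mf : measurable_fun setT f by exact: measurable_quad_part.
have f4i : L1fun P (fun x => f x ^+ 4) by exact: (quad_part_L1 h8i).
have f2i : L1fun P (fun x => f x ^+ 2) by exact: (quad_part_L1 h8i).
have fi : L1fun P f by exact: (@quad_part_L1 _ _ _ h8i A d 1).
have f0 : mean P f = 0 by exact: (quad_part_mean h8i hf h1 h2).
have wE : \sum_(i < d | (i < d)%N) quad_weight A i = total_weight A.
  by apply: eq_bigl => i; rewrite ltn_ord.
have := quad_part_sqr_ge h8i hf h1 h2 h4 cD A (leqnn d).
have := quad_part_pow4 h8i hf h1 h2 h8 (ltW hC0) A (leqnn d).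
rewrite wE -/f; set w := total_weight A in w0 *; set v := mean P (fun x => f x ^+ 2).
set cm := Num.min c 2 => f4 f2.
have cm0 : 0 < cm by rewrite /cm lt_min c0 ltr0n.
have v0 : 0 < v by apply: lt_le_trans f2; rewrite mulr_gt0.
pose s := Num.sqrt v; have s0 : 0 < s by rewrite sqrtr_gt0.
have ss : s ^+ 2 = v by rewrite sqr_sqrtr// ltW.
have si0 : 0 < s^-1 by rewrite invr_gt0.
have -> : [set t | studentT (fun i => quad_part A d (tnth t i)) <= z] =
    [set t : n.+1.-tuple _ | studentT (fun i => s^-1 * f (tnth t i)) <= z].
  by apply/seteqP; split => t /=; rewrite studentT_scale.
apply: (clt (fun x => s^-1 * f x)).
- exact: measurable_funM.
- by under [X in L1fun _ X]eq_fun do rewrite exprMn; exact: L1Z.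
- by rewrite meanZ// f0 mulr0.
- under eq_mean do rewrite exprMn.
  by rewrite meanZ// -/v exprVn ss mulVf// gt_eqF.
under eq_mean do rewrite exprMn.
rewrite meanZ//; apply: (@le_trans _ _ (16 * quad_cst C0 / cm ^+ 2)); last by rewrite lerDr.
rewrite mulrC exprVn ler_pdivrMr ?exprn_gt0//; apply: (le_trans f4).
have -> : s ^+ 4 = v ^+ 2 by rewrite -ss -exprM.
have q0 : 0 <= 16 * quad_cst C0.
  by rewrite /quad_cst; have := sqr_ge0 (1 + C0); have := hC0; lra.
rewrite -[leRHS]mulrA; apply: ler_wpM2l => //.
rewrite mulrC ler_pdivlMr ?exprn_gt0// -exprMn mulrC.
by rewrite ler_pXn2r// nnegrE ltW// mulr_gt0.
Qed.

End conditional.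

Lemma T_covE (R : realType) d m1 m2 (X : 'I_(m1 + m2) -> d.-tuple R) :
  T_cov X = studentT (fun i => f_cov X (X (lshift m2 i))).
Proof. by []. Qed.

Lemma measurable_T_cov (R : realType) d m1 m2 :
  measurable_fun setT (fun t : (m1 + m2).-tuple (d.-tuple R) => T_cov (tnth t)).
Proof.
have mc (k : 'I_(m1 + m2)) (l : 'I_d) :
    measurable_fun setT (fun b : (m1 + m2).-tuple (d.-tuple R) => coord l (tnth b k)).
  exact: (measurableT_comp (measurable_coord l) (measurable_tnth k)).
have mco (k : 'I_(m1 + m2)) (l l' : 'I_d) :
    measurable_fun setT (fun b : (m1 + m2).-tuple (d.-tuple R) => centered_outer (tnth b k) l l').
  under eq_fun do rewrite centered_outerE.
  by apply: measurable_funB => //; exact: measurable_funM.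
apply: measurable_studentT => i.
apply: measurable_funM => //; apply: measurable_sum => j; apply: measurable_sum => k.
under eq_fun do rewrite mxE.
by apply: measurable_sum => l; exact: measurable_funM.
Qed.

Theorem proposition3p1 (R : realType) (c C0 : R) (hc : 0 < c) (hC0 : 0 < C0) :
  exists C : R, 0 < C /\
    forall (m1 m2 : nat) (hm1 : (0 < m1)%N) (hm2 : (0 < m2)%N)
      (d : nat) (hd : (0 < d)%N)
      (P : probability (d.-tuple R) R) (hP : class_cov c C0 P)
      (disp : measure_display) (Omega : measurableType disp)
      (Pr : probability Omega R)
      (X : 'I_(m1 + m2) -> {RV Pr >-> d.-tuple R}) (hX : iid_from Pr P X)
      (z : R),
      (`| Pr [set w | (T_cov (fun i => X i w) <= z)%R] - Phi z |
        <= (C / Num.sqrt m1%:R)%:E)%E.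
Proof.
have K1 : 1 <= kurtosis_bound c C0.
  rewrite lerDl divr_ge0 ?sqr_ge0//.
  by rewrite /quad_cst; have := sqr_ge0 (1 + C0); lra.
have [C C_gt0 clt] := student_berry_esseen K1.
exists C; split => // -[//|n] m2 _ hm2 d hd P hP disp Omega Pr X hX z.
pose E := [set t : (n.+1 + m2).-tuple (d.-tuple R) | T_cov (tnth t) <= z].
have mE : measurable E.
  by apply: measurable_le_set => //; exact: measurable_T_cov.
have sampleE w : tnth (sample X w) = fun i => X i w.
  by apply/funext => i; rewrite tnth_mktuple.
have -> : [set w | T_cov (fun i => X i w) <= z] = sample X @^-1` E.
  by apply/seteqP; split => w; rewrite /E /= sampleE.
rewrite (sample_law hX mE).
set Q1 := iid_law P n.+1; set Q2 := iid_law P m2.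
pose S : set (m2.-tuple (d.-tuple R) * n.+1.-tuple (d.-tuple R)) := @tcat _ _ n.+1 m2 @^-1` E.
have mS : measurable S by rewrite -[X in measurable X]setTI; exact: measurable_tcat.
have mSb b : measurable [set a | S (b, a)].
  by rewrite -[X in measurable X]setTI; exact: (measurable_pair1 b).
have SE b : [set a | S (b, a)] =
    [set a | studentT (fun i => quad_part (cov_dev b) d (tnth a i)) <= z].
  have e a : T_cov (tnth (tcat (b, a))) =
      studentT (fun i => quad_part (cov_dev b) d (tnth a i)).
    rewrite T_covE; congr studentT; apply/funext => i.
    rewrite (f_covE (b := b)) ?tnth_tcat_l// => j.
    by rewrite tnth_tcat_r.
  by apply/seteqP; split => a; rewrite /S /E /= e.
pose p b := prob Q1 [set a | S (b, a)].
pose Z := [set b : m2.-tuple (d.-tuple R) | total_weight (cov_dev b) <= 0].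
have mZ : measurable Z.
  by apply: measurable_le_set => //; exact: measurable_total_weight.
have iS := L1_indic (Q2 \x Q1)%E mS.
have sec b a : \1_S (b, a) = \1_[set a | S (b, a)] a :> R.
  by rewrite !indicE; congr (_%:R); congr nat_of_bool; apply/idP/idP; rewrite !inE.
have iSb b : L1fun Q1 (fun a => \1_S (b, a)) by rewrite (funext (sec b)); exact: L1_indic.
have pE b : mean Q1 (fun a => \1_S (b, a)) = p b.
  by rewrite (eq_mean _ (sec b)) -prob_mean.
have ip : L1fun Q2 p by rewrite -(funext pE); exact: L1_mean1.
have prS : prob (Q2 \x Q1)%E S = mean Q2 p.
  by rewrite prob_mean// mean_prod1// (eq_mean _ pE).
(* on the null set [Z] the two probabilities differ by at most [1] *)
have bound b : `|p b - ncdf z| <= C / Num.sqrt n.+1%:R + \1_Z b.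
  have Cs : 0 <= C / Num.sqrt n.+1%:R by rewrite divr_ge0// ltW.
  have [Zb|Zb] := boolP (b \in Z).
    rewrite indicE Zb.
    have := @prob_ge0 _ _ _ Q1 [set a | S (b, a)]; have := prob_le1 Q1 (mSb b).
    have := @ncdf_ge0 R z; have := @ncdf_le1 R z.
    by rewrite -/(p b) ler_norml /=; lra.
  rewrite indicE (negbTE Zb) addr0 /p SE.
  apply: (quad_student_berry_esseen hP hc hC0) => [g mg g4i g0 g2 g4|]; first exact: clt.
  by rewrite ltNge; apply/negP => hb; move/negP: Zb; apply; rewrite inE.
have iZ := L1_indic Q2 mZ.
have main : `|prob (Q2 \x Q1)%E S - ncdf z| <= C / Num.sqrt n.+1%:R.
  rewrite prS -[X in _ - X](mean_cst Q2) -meanB//; last exact: L1_cst.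
  have ipc : L1fun Q2 (fun b => p b - ncdf z) by apply: L1B => //; exact: L1_cst.
  apply: (le_trans (ler_norm_mean ipc)).
  apply: (@le_trans _ _ (mean Q2 (fun b => C / Num.sqrt n.+1%:R + \1_Z b))).
    apply: le_mean => //; first exact: L1_norm.
    by apply: L1D => //; exact: L1_cst.
  rewrite meanD//; last exact: L1_cst.
  rewrite mean_cst -prob_mean// prob_cov_dev0 ?addr0//.
  by have [] := hP.
have -> : (Q2 \x Q1)%E S = (prob (Q2 \x Q1)%E S)%:E by rewrite prob_EFin.
by rewrite -[Phi z]fineK ?ncdf_fin.
Qed.
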